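(* Let the ground field be $\mathbb{F}_2$. For natural numbers $d$ and $n\leq8$, the natural surjection $\mathfrak{Q}^n_d\twoheadrightarrow Q^n_d$ is an isomorphism except in the case $(n,d)=(7,3)$, when there is a short exact sequence in $\mathcal{F}$ $$0\rightarrow\Lambda^2\rightarrow\mathfrak{Q}^7_3\rightarrow Q^7_3\rightarrow0,$$ where the kernel $\Lambda^2\cong\mathcal{O}(L_{(2,2)})$ corresponds to the composition factor $L_{(2,2)}$ of $\mathfrak{Q}^6_4$.
   Context: $\mathcal{F}$ is the category of functors from finite-dimensional $\mathbb{F}_2$-vector spaces to $\mathbb{F}_2$-vector spaces. With $\overline{\Delta}F(V):=F(V\oplus\mathbb{F}_2)/F(V)$, $F$ is polynomial of degree $\leq d$ if $\overline{\Delta}^{d+1}F=0$, and $p_dF$ is the largest subfunctor of $F$ of degree $\leq d$. $S^n$, $\Lambda^n$ are the symmetric and exterior power functors. The mod 2 Steenrod algebra $\mathcal{A}(2)$ acts naturally on $S^*(V)$ (Steenrod squares, satisfying the Cartan formula, with total square $x\mapsto x+x^2$ on $x\in S^1(V)=V$), by natural transformations, hence on $p_dS^*/p_{d-1}S^*$. $Q^n$ is the degree $n$ part of $\mathbb{F}_2\otimes_{\mathcal{A}(2)}S^*$ (quotient by the image of positive degree operations); $Q^n[d]\subset Q^n$ is the image of $p_dS^n$; $Q^n_d:=Q^n[d]/Q^n[d-1]$; $\mathfrak{Q}^n_d$ is the degree $n$ part of $\mathbb{F}_2\otimes_{\mathcal{A}(2)}(p_dS^*/p_{d-1}S^* )$.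 There is a natural surjection $\mathfrak{Q}^n_d\twoheadrightarrow Q^n_d$. $\mathfrak{Q}^n_d$ is also regarded as an object of the category $\mathcal{P}_d$ of strict polynomial functors of degree $d$ (since $p_dS^n/p_{d-1}S^n$ is a direct sum of tensor products of exterior powers $\bigotimes_i\Lambda^{\omega_i}$ with $\sum\omega_i=d$, $\sum\omega_i2^i=n$, and the Steenrod operations are morphisms of $\mathcal{P}_d$); $L_\lambda$ is the simple object of $\mathcal{P}_d$ of highest weight $\lambda$, a partition of $d$, and $\mathcal{O}:\mathcal{P}_d\to\mathcal{F}$ is the forgetful functor. *)

(* Defs.v *)
From HB Require Import structures.
From mathcomp Require Import all_boot all_order all_fingroup all_algebra.
From mathcomp Require Import boolp.
From mathcomp Require Import mpoly.
From mathcomp Require Import generic_quotient ring_quotient.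

Set Implicit Arguments.
Unset Strict Implicit.
Unset Printing Implicit Defensive.

Import GRing.Theory.
Local Open Scope ring_scope.
Local Open Scope quotient_scope.

Definition F2 : fieldType := 'F_2.

(** * Submodules and quotient modules *)

Record submod (U : lmodType F2) := Submod {
  smem :> U -> Prop;
  smem0 : smem 0;
  smemP : forall a u v, smem u -> smem v -> smem (a *: u + v) }.

Section SubQuo.
Variables (U : lmodType F2) (N : submod U).

Definition in_submod : U -> bool := fun u => `[< N u >].

Lemma in_submodE u : (u \in in_submod) = `[< N u >]. Proof. by []. Qed.

Fact in_submod_closed : submod_closed in_submod.
Proof.
split=> [|a u v]; rewrite !in_submodE; first exact/asboolP/smem0.
by move=> /asboolP Nu /asboolP Nv; apply/asboolP/smemP.
Qed.
HB.instance Definition _ :=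
  GRing.isSubmodClosed.Build F2 U in_submod in_submod_closed.

Record sub_of := SubOf { sval_of :> U; _ : sval_of \in in_submod }.
HB.instance Definition _ := [isSub for sval_of].
HB.instance Definition _ := [Choice of sub_of by <:].
HB.instance Definition _ := [SubChoice_isSubLmodule of sub_of by <:].

Lemma sub_ofP (x : sub_of) : N (sval_of x).
Proof. by case: x => u /= /asboolP. Qed.

Definition mksub u (Nu : N u) : sub_of := @SubOf u (introT (asboolP (N u)) Nu).

Lemma sval_of_linear : linear sval_of. Proof. by []. Qed.

Definition quo := Quotient.quot (GRing.ZmodClosed.clone U in_submod _).
HB.instance Definition _ := GRing.Zmodule.on quo.
HB.instance Definition _ := Quotient.on quo.

Definition quo_pi (u : U) : quo := \pi_quo u.

Lemma quo_piK x : quo_pi (repr x) = x. Proof. exact: reprK. Qed.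

Lemma quo_piE u v : quo_pi u = quo_pi v <-> N (u - v).
Proof.
have H : (u - v \in in_submod) = (quo_pi u == quo_pi v).
  exact: Quotient.idealrBE.
split; first by move/eqP; rewrite -H in_submodE => /asboolP.
by move=> Nuv; apply/eqP; rewrite -H in_submodE; apply/asboolP.
Qed.

Lemma quo_piD u v : quo_pi (u + v) = quo_pi u + quo_pi v.
Proof. exact: raddfD. Qed.

Definition quo_scale (a : F2) (x : quo) : quo := quo_pi (a *: repr x).

Lemma quo_scaleE a u : quo_scale a (quo_pi u) = quo_pi (a *: u).
Proof.
apply/quo_piE; rewrite -scalerBr -[_ *: _]addr0.
by apply: smemP (smem0 N); apply/quo_piE; rewrite quo_piK.
Qed.

Fact quo_scaleA a b x : quo_scale a (quo_scale b x) = quo_scale (a * b) x.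
Proof. by rewrite -[x]quo_piK !quo_scaleE scalerA. Qed.
Fact quo_scale1 : left_id 1 quo_scale.
Proof. by move=> x; rewrite -[x]quo_piK !quo_scaleE scale1r. Qed.
Fact quo_scaleDr : right_distributive quo_scale +%R.
Proof.
by move=> a x y; rewrite -[x]quo_piK -[y]quo_piK -quo_piD !quo_scaleE -quo_piD scalerDr.
Qed.
Fact quo_scaleDl x : {morph quo_scale^~ x : a b / a + b}.
Proof. by move=> a b; rewrite -[x]quo_piK !quo_scaleE -quo_piD scalerDl. Qed.
HB.instance Definition _ := GRing.Zmodule_isLmodule.Build F2 quo
  quo_scaleA quo_scale1 quo_scaleDr quo_scaleDl.

Lemma quo_pi_linear : linear quo_pi.
Proof. by move=> a u v; rewrite quo_piD -quo_scaleE. Qed.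

Lemma quo_pi0 u : quo_pi u = 0 <-> N u.
Proof.
rewrite -[u in X in _ <-> X]subr0 -quo_piE.
by have <- : quo_pi 0 = 0 by exact: raddf0.
Qed.

Lemma quoW (P : quo -> Prop) : (forall u, P (quo_pi u)) -> forall x, P x.
Proof. by move=> HP x; rewrite -[x]quo_piK. Qed.
End SubQuo.

Section LinearFacts.
Variables (U V : lmodType F2) (f : U -> V).
Hypothesis f_lin : linear f.

Lemma lin0 : f 0 = 0.
Proof.
by have := f_lin (-1) 0 0; rewrite scaler0 addr0 scaleN1r addNr.
Qed.
Lemma linD u v : f (u + v) = f u + f v.
Proof. by have := f_lin 1 u v; rewrite !scale1r. Qed.
Lemma linB u v : f (u - v) = f u - f v.
Proof. by rewrite addrC -scaleN1r f_lin scaleN1r addrC. Qed.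
End LinearFacts.

(** * Functors to F_2-vector spaces

   All source categories have the finite-dimensional F_2-vector spaces as
   objects; [vect] has linear maps as morphisms, [gamma d] (below) has the
   equivariant maps of d-fold tensor powers. *)

Record category := Category {
  hom : vectType F2 -> vectType F2 -> Type;
  idm : forall V, hom V V;
  compm : forall U V W, hom V W -> hom U V -> hom U W;
  compmA : forall U V W X (h : hom W X) (g : hom V W) (f : hom U V),
    compm h (compm g f) = compm (compm h g) f;
  comp1m : forall U V (f : hom U V), compm (idm V) f = f;
  compm1 : forall U V (f : hom U V), compm f (idm U) = f }.

Record functor (C : category) := Functor {
  fobj :> vectType F2 -> lmodType F2;
  fmap : forall V W, hom C V W -> fobj V -> fobj W;
  fmap_linear : forall V W (f : hom C V W), linear (fmap f);
  fmap_id : forall V x, fmap (idm C V) x = x;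
  fmap_comp : forall U V W (g : hom C V W) (f : hom C U V) x,
    fmap (compm g f) x = fmap g (fmap f x) }.

Record nat_trans C (F G : functor C) := NatTrans {
  nt :> forall V, F V -> G V;
  nt_linear : forall V, linear (@nt V);
  nt_nat : forall V W (f : hom C V W) x, nt (fmap f x) = fmap f (nt x) }.
Arguments nt {C F G} _ V _.

Record subfunctor C (F : functor C) := Subfunctor {
  sf :> forall V, submod (F V);
  sf_stable : forall V W (f : hom C V W) x, sf V x -> sf W (fmap f x) }.

Local Obligation Tactic := idtac.

Section Functors.
Variable C : category.
Implicit Types F G H : functor C.

Definition is_zero F := forall V (x : F V), x = 0.

Definition is_iso F G (a : nat_trans F G) :=
  exists b : nat_trans G F,
    (forall V, cancel (a V) (b V)) /\ (forall V, cancel (b V) (a V)).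

Definition is_epi F G (a : nat_trans F G) :=
  forall V (y : G V), exists x, a V x = y.

Definition short_exact F G H (a : nat_trans F G) (b : nat_trans G H) :=
  [/\ forall V, injective (a V),
      forall V (y : G V), b V y = 0 <-> exists x, a V x = y
    & is_epi b].

Program Definition nat_comp F G H (b : nat_trans G H) (a : nat_trans F G) :
  nat_trans F H := @NatTrans C F H (fun V x => b V (a V x)) _ _.
Next Obligation. by move=> F G H b a V c u v /=; rewrite !nt_linear. Qed.
Next Obligation. by move=> * /=; rewrite !nt_nat. Qed.

Program Definition nat_add F G (a b : nat_trans F G) : nat_trans F G :=
  @NatTrans C F G (fun V x => a V x + b V x) _ _.
Next Obligation. by move=> F G a b V c u v /=; rewrite !nt_linear scalerDr addrACA. Qed.
Next Obligation. by move=> * /=; rewrite !nt_nat (linD (fmap_linear _)). Qed.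

(** Subfunctors as functors, quotient functors. *)

Section Sub.
Variables (F : functor C) (A : subfunctor F).

Program Definition sub_functor : functor C :=
  @Functor C (fun V => sub_of (A V))
    (fun V W f x => mksub (sf_stable f (sub_ofP x))) _ _ _.
Next Obligation. by move=> V W f a x y; apply/val_inj; rewrite /= fmap_linear. Qed.
Next Obligation. by move=> V x; apply/val_inj; rewrite /= fmap_id. Qed.
Next Obligation. by move=> *; apply/val_inj; rewrite /= fmap_comp. Qed.

Program Definition sub_incl : nat_trans sub_functor F :=
  @NatTrans C sub_functor F (fun V x => sval_of x) _ _.
Next Obligation. by []. Qed.
Next Obligation. by []. Qed.

Fact quo_map_subproof V W (f : hom C V W) x :
  quo_pi (A W) (fmap f (repr (quo_pi (A V) x))) = quo_pi (A W) (fmap f x).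
Proof.
apply/quo_piE; rewrite -(linB (fmap_linear f)); apply: sf_stable.
by apply/quo_piE; rewrite quo_piK.
Qed.

Program Definition quo_functor : functor C :=
  @Functor C (fun V => quo (A V))
    (fun V W f x => quo_pi (A W) (fmap f (repr x))) _ _ _.
Next Obligation.
move=> V W f a; elim/quoW=> x; elim/quoW=> y.
by rewrite -quo_pi_linear !quo_map_subproof fmap_linear quo_pi_linear.
Qed.
Next Obligation. by move=> V; elim/quoW=> x; rewrite quo_map_subproof fmap_id. Qed.
Next Obligation.
move=> U V W g f; elim/quoW=> x.
by rewrite !quo_map_subproof -fmap_comp quo_map_subproof.
Qed.

Program Definition quo_proj : nat_trans F quo_functor :=
  @NatTrans C F quo_functor (fun V x => quo_pi (A V) x) _ _.
Next Obligation. by move=> V; exact: quo_pi_linear. Qed.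
Next Obligation. by move=> * /=; rewrite quo_map_subproof. Qed.
End Sub.

Section Maps.
Variables (F G : functor C) (a : nat_trans F G).

Program Definition preimage (B : subfunctor G) : subfunctor F :=
  @Subfunctor C F (fun V => @Submod (F V) (fun x => B V (a V x)) _ _) _.
Next Obligation.
by move=> B V /=; rewrite (lin0 (@nt_linear _ _ _ a V)); apply: smem0.
Qed.
Next Obligation. by move=> * /=; rewrite nt_linear; apply: smemP. Qed.
Next Obligation. by move=> * /=; rewrite nt_nat; apply: sf_stable. Qed.

Program Definition image : subfunctor G :=
  @Subfunctor C G (fun V => @Submod (G V) (fun y => exists x, a V x = y) _ _) _.
Next Obligation. by move=> V; exists 0; apply: lin0 (@nt_linear _ _ _ a V). Qed.
Next Obligation.
by move=> V c _ _ [x <-] [y <-]; exists (c *: x + y); rewrite nt_linear.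
Qed.
Next Obligation. by move=> V W f _ [x <-]; exists (fmap f x); rewrite nt_nat. Qed.

(** The map of subfunctors, resp. of quotients, induced by [a]. *)
Program Definition sub_map (A : subfunctor F) (B : subfunctor G)
    (aAB : forall V x, A V x -> B V (a V x)) :
    nat_trans (sub_functor A) (sub_functor B) :=
  @NatTrans C (sub_functor A) (sub_functor B)
    (fun V x => mksub (aAB V _ (sub_ofP x))) _ _.
Next Obligation.
by move=> A B aAB V c x y; apply/val_inj; rewrite /= nt_linear.
Qed.
Next Obligation. by move=> *; apply/val_inj; rewrite /= nt_nat. Qed.

Fact quo_lift_subproof (A : subfunctor F) (aA : forall V x, A V x -> a V x = 0)
  V x : a V (repr (quo_pi (A V) x)) = a V x.
Proof.
apply/eqP; rewrite -subr_eq0 -(linB (@nt_linear _ _ _ a V)); apply/eqP/aA.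
by apply/quo_piE; rewrite quo_piK.
Qed.

Program Definition quo_lift (A : subfunctor F)
    (aA : forall V x, A V x -> a V x = 0) : nat_trans (quo_functor A) G :=
  @NatTrans C (quo_functor A) G (fun V x => a V (repr x)) _ _.
Next Obligation.
move=> A aA V c; elim/quoW=> x; elim/quoW=> y.
by rewrite -quo_pi_linear !(quo_lift_subproof aA) nt_linear.
Qed.
Next Obligation.
move=> A aA V W f; elim/quoW=> x /=.
by rewrite quo_map_subproof !(quo_lift_subproof aA) nt_nat.
Qed.
End Maps.

Lemma quo_lift_pi F G (a : nat_trans F G) A aA V x :
  @quo_lift F G a A aA V (quo_proj A V x) = a V x.
Proof. exact: quo_lift_subproof. Qed.

(** The smallest subfunctor containing a family of elements. *)
Program Definition gen_sub F (P : forall V, F V -> Prop) : subfunctor F :=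
  @Subfunctor C F (fun V => @Submod (F V) (fun x =>
    forall A : subfunctor F, (forall W y, P W y -> A W y) -> A V x) _ _) _.
Next Obligation. by move=> F P V A _; apply: smem0. Qed.
Next Obligation.
by move=> F P V a x y Px Py A HA; apply: smemP; [apply: Px | apply: Py].
Qed.
Next Obligation. by move=> F P V W f x Px A HA; apply/sf_stable/Px. Qed.

Lemma gen_sub_in F (P : forall V, F V -> Prop) V x : P V x -> gen_sub P V x.
Proof. by move=> Px A; apply. Qed.

(** The subquotient A / (A :&: B) of F. *)
Definition subquo F (A B : subfunctor F) : functor C :=
  quo_functor (preimage (sub_incl A) B).

Definition subquo_proj F (A B : subfunctor F) :
  nat_trans (sub_functor A) (subquo A B) := quo_proj (preimage (sub_incl A) B).

Fact subquo_map_subproof F G (a : nat_trans F G) (A B : subfunctor F)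
    (A' B' : subfunctor G) (aA : forall V x, A V x -> A' V (a V x))
    (aB : forall V x, B V x -> B' V (a V x)) V (x : sub_functor A V) :
  preimage (sub_incl A) B V x -> subquo_proj A' B' V (sub_map aA V x) = 0.
Proof. by move=> Bx; apply/quo_pi0; apply: aB. Qed.

Definition subquo_map F G (a : nat_trans F G) (A B : subfunctor F)
    (A' B' : subfunctor G) (aA : forall V x, A V x -> A' V (a V x))
    (aB : forall V x, B V x -> B' V (a V x)) :
    nat_trans (subquo A B) (subquo A' B') :=
  quo_lift (a := nat_comp (subquo_proj A' B') (sub_map aA))
    (subquo_map_subproof aA aB).

Lemma subquo_map_pi F G (a : nat_trans F G) (A B : subfunctor F)
    (A' B' : subfunctor G) (aA : forall V x, A V x -> A' V (a V x))
    (aB : forall V x, B V x -> B' V (a V x)) V x :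
  subquo_map aA aB V (subquo_proj A B V x) =
  subquo_proj A' B' V (sub_map aA V x).
Proof. exact: quo_lift_pi. Qed.
End Functors.

(** * The category F and polynomial functors *)

Program Definition vect : category :=
  @Category (fun V W => 'Hom(V, W)) (fun V => \1%VF)
    (fun U V W g f => (g \o f)%VF) _ _ _.
Next Obligation. by move=> * /=; rewrite comp_lfunA. Qed.
Next Obligation. by move=> * /=; rewrite comp_lfun1l. Qed.
Next Obligation. by move=> * /=; rewrite comp_lfun1r. Qed.

(** V (+) F_2 *)
Definition plus1 (V : vectType F2) : vectType F2 := (V * F2^o)%type.

Section Plus1.
Variables V W : vectType F2.
Definition inl1_fun (v : V) : plus1 V := (v, 0).
Fact inl1_linear : linear inl1_fun.
Proof. by move=> a u v; congr pair; rewrite /= scaler0 addr0. Qed.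
HB.instance Definition _ :=
  GRing.isLinear.Build F2 V (plus1 V) *:%R inl1_fun inl1_linear.
Definition inl1 : 'Hom(V, plus1 V) := linfun inl1_fun.

Variable f : 'Hom(V, W).
Definition plus1_map_fun (x : plus1 V) : plus1 W := (f x.1, x.2).
Fact plus1_map_linear : linear plus1_map_fun.
Proof. by move=> a u v; congr pair; rewrite /= linearP. Qed.
HB.instance Definition _ :=
  GRing.isLinear.Build F2 (plus1 V) (plus1 W) *:%R plus1_map_fun
    plus1_map_linear.
Definition plus1_map : 'Hom(plus1 V, plus1 W) := linfun plus1_map_fun.
End Plus1.

Lemma plus1_map_id (V : vectType F2) : plus1_map \1%VF = \1%VF :> 'End(plus1 V).
Proof.
by apply/lfunP=> -[x y]; rewrite lfunE id_lfunE /= /plus1_map_fun /= id_lfunE.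
Qed.

Lemma plus1_map_comp (U V W : vectType F2) (g : 'Hom(V, W)) (f : 'Hom(U, V)) :
  plus1_map (g \o f)%VF = (plus1_map g \o plus1_map f)%VF.
Proof.
apply/lfunP=> x; rewrite comp_lfunE !lfunE /= /plus1_map_fun /=.
by rewrite comp_lfunE.
Qed.

Lemma plus1_map_inl (U V : vectType F2) (f : 'Hom(U, V)) :
  (plus1_map f \o inl1 U = inl1 V \o f)%VF.
Proof. by apply/lfunP=> x; rewrite !comp_lfunE !lfunE. Qed.

Program Definition shift (F : functor vect) : functor vect :=
  @Functor vect (fun V => F (plus1 V))
    (fun V W f x => fmap (plus1_map f : hom vect _ _) x) _ _ _.
Next Obligation. by move=> F V W f; apply: fmap_linear. Qed.
Next Obligation.
by move=> F V x; rewrite /= plus1_map_id; apply: (fmap_id (C := vect)).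
Qed.
Next Obligation.
move=> F U V W g f x; rewrite /= plus1_map_comp.
exact: (fmap_comp (C := vect)).
Qed.

Program Definition shift_incl F : nat_trans F (shift F) :=
  @NatTrans vect F (shift F) (fun V x => fmap (inl1 V : hom vect _ _) x) _ _.
Next Obligation. by move=> F V; apply: fmap_linear. Qed.
Next Obligation.
move=> F V W f x /=; rewrite -!fmap_comp /=.
by congr (fmap _ x); rewrite plus1_map_inl.
Qed.

(** The difference functor V |-> F(V (+) F_2) / F(V). *)
Definition Delta (F : functor vect) : functor vect :=
  quo_functor (image (shift_incl F)).

(** [poly_lt k F] means that F is polynomial of degree < k. *)
Definition poly_lt (k : nat) (F : functor vect) := is_zero (iter k Delta F).

(** [polyfilt k F] is the sum of all subfunctors of degree < k, that is
   p_(k-1) F; with this indexing p_(-1) F = 0 is [polyfilt 0 F]. It is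
   shown below to have degree < k itself. *)
Definition polyfilt (k : nat) (F : functor vect) : subfunctor F :=
  gen_sub (fun V x =>
    exists2 A : subfunctor F, poly_lt k (sub_functor A) & A V x).

(** A family of maps covers G when the sum of the images is G. *)
Definition covers (I : Type) (F : I -> functor vect) (G : functor vect)
    (a : forall i, nat_trans (F i) G) :=
  forall V (N : submod (G V)), (forall i x, N (a i V x)) -> forall y, N y.

Program Definition shift_map F G (a : nat_trans F G) :
  nat_trans (shift F) (shift G) :=
  @NatTrans vect (shift F) (shift G) (fun V x => a (plus1 V) x) _ _.
Next Obligation. by move=> F G a V; apply: (@nt_linear _ _ _ a (plus1 V)). Qed.
Next Obligation. by move=> F G a V W f x /=; rewrite nt_nat. Qed.

Fact Delta_map_subproof F G (a : nat_trans F G) V x :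
  image (shift_incl F) V x ->
  nat_comp (quo_proj (image (shift_incl G))) (shift_map a) V x = 0.
Proof.
by move=> [y <-]; apply/quo_pi0; exists (a V y); rewrite /= nt_nat.
Qed.

Definition Delta_map F G (a : nat_trans F G) : nat_trans (Delta F) (Delta G) :=
  quo_lift (Delta_map_subproof a).

Program Definition submod_pre (U U' : lmodType F2) (f : U -> U')
    (f_lin : linear f) (N : submod U') : submod U :=
  @Submod U (fun x => N (f x)) _ _.
Next Obligation. by move=> U U' f fl N /=; rewrite (lin0 fl); apply: smem0. Qed.
Next Obligation. by move=> U U' f fl N a x y /=; rewrite fl; apply: smemP. Qed.

Lemma covers_Delta I (F : I -> functor vect) G (a : forall i, nat_trans (F i) G) :
  covers a -> covers (fun i => Delta_map (a i)).
Proof.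
move=> ca V N HN; apply: (@quoW _ (image (shift_incl G) V) N) => y.
apply: (ca (plus1 V) (submod_pre (@quo_pi_linear _ _) N)) => i x /=.
have := HN i (quo_pi _ x); congr (N _).
exact: (quo_lift_pi (Delta_map_subproof (a i)) x).
Qed.

Lemma covers_poly_lt I k (F : I -> functor vect) G
    (a : forall i, nat_trans (F i) G) :
  covers a -> (forall i, poly_lt k (F i)) -> poly_lt k G.
Proof.
elim: k F G a => [|k IH] F G a ca HF; rewrite /poly_lt /=; last first.
  have: poly_lt k (Delta G).
    apply: IH (covers_Delta ca) _ => i.
    by have := HF i; rewrite /poly_lt iterSr.
  by rewrite /poly_lt -iterSr.
move=> V y.
have S0 : forall c (u v : G V), u = 0 -> v = 0 -> c *: u + v = 0.
  by move=> c u v -> ->; rewrite scaler0 addr0.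
apply: (ca V (Submod (erefl 0) S0)) => i x /=.
by rewrite (HF i V x) (lin0 (@nt_linear _ _ _ (a i) V)).
Qed.

Lemma polyfilt_ge k F (A : subfunctor F) V x :
  poly_lt k (sub_functor A) -> A V x -> polyfilt k F V x.
Proof. by move=> HA Ax; apply: gen_sub_in; exists A. Qed.

Lemma poly_lt_image k F G (a : nat_trans F G) :
  poly_lt k F -> poly_lt k (sub_functor (image a)).
Proof.
move=> HF; pose b V (x : F V) : sub_functor (image a) V :=
  @mksub _ (image a V) (a V x) (ex_intro _ x (erefl _)).
have b_lin V : linear (@b V).
  by move=> c x y; apply/val_inj; rewrite /= nt_linear.
have b_nat V W (f : hom vect V W) x : b W (fmap f x) = fmap f (b V x).
  by apply/val_inj; rewrite /= nt_nat.
apply: (@covers_poly_lt unit k (fun=> F) _ (fun=> NatTrans b_lin b_nat)) => //.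
move=> V N HN y; have [x ax] := sub_ofP y.
by have := HN tt x; congr (N _); apply/val_inj.
Qed.

Lemma polyfilt_poly_lt k F : poly_lt k (sub_functor (polyfilt k F)).
Proof.
pose I := {A : subfunctor F | poly_lt k (sub_functor A)}.
pose a (i : I) V (x : sub_functor (sval i) V) :
    sub_functor (polyfilt k F) V :=
  mksub (polyfilt_ge (svalP i) (sub_ofP x)).
have a_lin i V : linear (@a i V) by move=> c x y; apply/val_inj.
have a_nat i V W (f : hom vect V W) x : a i W (fmap f x) = fmap f (a i V x).
  exact/val_inj.
apply: (@covers_poly_lt I k _ _ (fun i => NatTrans (a_lin i) (a_nat i))).
  move=> V N HN y.
  pose P W (x : F W) := forall f : hom vect W V,
    exists2 n : sub_functor (polyfilt k F) V, N n & sval_of n = fmap f x.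
  have P0 W : P W 0.
    by move=> f; exists 0; [apply: smem0 | rewrite (lin0 (fmap_linear f))].
  have PD W c x z : P W x -> P W z -> P W (c *: x + z).
    move=> Px Pz f; have [[n Nn nx] [m Nm mz]] := (Px f, Pz f).
    exists (c *: n + m); first exact: smemP.
    by rewrite fmap_linear -nx -mz.
  have Pst W X (g : hom vect W X) x : P W x -> P X (fmap g x).
    by move=> Px f; rewrite -fmap_comp; apply: Px.
  pose B := @Subfunctor vect F (fun W => Submod (P0 W) (@PD W)) Pst.
  have [|n Nn ny] := sub_ofP y B _ (idm vect V).
    move=> W x [A HA Ax] f.
    pose i : I := exist _ A HA.
    exists (a i V (mksub (sf_stable f Ax))); first exact: HN.
    by [].
  by have -> : y = n by apply/val_inj; rewrite /= ny fmap_id.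
by case.
Qed.

Lemma polyfilt_nat k F G (a : nat_trans F G) V x :
  polyfilt k F V x -> polyfilt k G V (a V x).
Proof.
move=> /(_ (preimage a (polyfilt k G))); apply=> {V x} V x [A HA Ax] /=.
apply: (@polyfilt_ge k G (image (nat_comp a (sub_incl A)))).
  exact: poly_lt_image.
by exists (mksub Ax).
Qed.

(** p_d F, and the quotient p_d F / p_(d-1) F. *)
Definition p_ (d : nat) (F : functor vect) : functor vect :=
  sub_functor (polyfilt d.+1 F).

Definition gr (d : nat) (F : functor vect) : functor vect :=
  subquo (polyfilt d.+1 F) (polyfilt d F).

Definition gr_map d F G (a : nat_trans F G) : nat_trans (gr d F) (gr d G) :=
  subquo_map (@polyfilt_nat d.+1 F G a) (@polyfilt_nat d F G a).

(** * Symmetric powers and Steenrod squares *)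

Section Basis.
Variable V : vectType F2.
Definition rk := \dim {:V}.
Definition bas (i : 'I_rk) : V := tnth (vbasis {:V}) i.
Definition crd (i : 'I_rk) (v : V) : F2 := coord (vbasis {:V}) i v.
End Basis.

(** The j-th coordinate of the image of the i-th basis vector. *)
Definition coef (V W : vectType F2) (f : 'Hom(V, W)) (i : 'I_(rk V)) (j : 'I_(rk W)) : F2 :=
  crd j (f (bas i)).

Lemma vec_coord (V : vectType F2) (v : V) : v = \sum_i crd i v *: bas i.
Proof.
rewrite {1}(coord_vbasis (memvf v)); apply: eq_bigr => i _.
by rewrite /bas (tnth_nth 0).
Qed.

Lemma coef_id (V : vectType F2) (i j : 'I_(rk V)) :
  coef (\1%VF : 'End(V)) i j = (i == j)%:R.
Proof.
rewrite /coef id_lfunE /crd /bas (tnth_nth 0) coord_free //.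
exact: basis_free (vbasisP _).
Qed.

Lemma coef_comp (U V W : vectType F2) (g : 'Hom(V, W)) (f : 'Hom(U, V))
    (i : 'I_(rk U)) (k : 'I_(rk W)) :
  coef (g \o f)%VF i k = \sum_j coef f i j * coef g j k.
Proof.
rewrite /coef comp_lfunE {1}[f _]vec_coord linear_sum /= /crd linear_sum /=.
by apply: eq_bigr => j _; rewrite !linearZ.
Qed.

Section Subst.
Variables (m n : nat).
Implicit Types (p : {mpoly F2[m]}) (t : m.-tuple {mpoly F2[n]}).

Lemma eq_comp_mpoly p t u : tnth t =1 tnth u -> p \mPo t = p \mPo u.
Proof. by move=> /eq_from_tnth ->. Qed.

Lemma comp_mpolyA k p t (u : n.-tuple {mpoly F2[k]}) :
  (p \mPo t) \mPo u = p \mPo [tuple tnth t i \mPo u | i < m].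
Proof.
rewrite (comp_mpolyE p t) (comp_mpolyE p) raddf_sum /=; apply: eq_bigr => a _.
rewrite comp_mpolyZ rmorph_prod /=; congr (_ *: _).
by apply: eq_bigr => i _; rewrite rmorphXn /= tnth_mktuple.
Qed.

Hypothesis t : m.-tuple {mpoly F2[n]}.
Hypothesis t1 : forall i, tnth t i \is 1.-homog for mdeg.

Lemma comp_mpolyX_homog (a : 'X_{1..m}) :
  'X_[a] \mPo t \is (mdeg a).-homog for mdeg.
Proof.
rewrite comp_mpolyX mdegE.
pose aa := [tuple a i | i < m].
pose tt := [tuple tnth t i ^+ a i | i < m].
have -> : \prod_(i < m) tnth t i ^+ a i = \prod_(q <- tt) q.
  by rewrite big_tuple; apply: eq_bigr => i _; rewrite tnth_mktuple.
have -> : (\sum_(i < m) a i = \sum_(e <- aa) e)%N.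
  by rewrite big_tuple; apply: eq_bigr => i _; rewrite tnth_mktuple.
apply: dhomog_prod => i; rewrite !tnth_mktuple.
by have := dhomogMn (a i) (t1 i); rewrite mul1n.
Qed.

Lemma comp_mpoly_homog d p :
  p \is d.-homog for mdeg -> p \mPo t \is d.-homog for mdeg.
Proof.
move=> /dhomogP hp; rewrite comp_mpolyEX big_seq; apply: rpred_sum => a ap.
by apply: dhomogZ; rewrite -(hp a ap); apply: comp_mpolyX_homog.
Qed.

Lemma pihomog_comp d p :
  pihomog mdeg d (p \mPo t) = pihomog mdeg d p \mPo t.
Proof.
have -> : pihomog mdeg d p = \sum_(a <- msupp p) p@_a *: pihomog mdeg d 'X_[a].
  by rewrite {1}[p]mpolyE linear_sum /=; apply: eq_bigr => a _; rewrite linearZ.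
rewrite comp_mpolyEX !linear_sum /=.
apply: eq_bigr => a _; rewrite linearZ /= comp_mpolyZ pihomogX.
congr (_ *: _); case: eqP => [<-|/eqP ad].
  by rewrite pihomog_dE // comp_mpolyX_homog.
by rewrite comp_mpoly0 (pihomog_ne0 ad) // comp_mpolyX_homog.
Qed.
End Subst.

(** S^*(V) is the polynomial algebra on the chosen basis of V, S^n(V) its
   homogeneous part of degree n. *)
Definition symalg (V : vectType F2) := {mpoly F2[rk V]}.

Section SymMap.
Variables (V W : vectType F2) (f : 'Hom(V, W)).
Definition sym_subst : (rk V).-tuple {mpoly F2[rk W]} :=
  [tuple \sum_j coef f i j *: 'X_j | i < rk V].
Definition symalg_map (p : symalg V) : symalg W := p \mPo sym_subst.
End SymMap.

(** The total Steenrod square. *)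
Definition sq_subst m : m.-tuple {mpoly F2[m]} := [tuple 'X_i + 'X_i ^+ 2 | i < m].
Definition total_sq (V : vectType F2) (p : symalg V) : symalg V :=
  p \mPo sq_subst (rk V).

Section SymMap.
Variables (V W : vectType F2) (f : 'Hom(V, W)).

Lemma sym_subst1 i : tnth (sym_subst f) i \is 1.-homog for mdeg.
Proof.
rewrite tnth_mktuple; apply: rpred_sum => j _; apply: dhomogZ.
by rewrite dhomogX /= mdeg1.
Qed.

Lemma symalg_map_homog n (p : dhomog (rk V) F2 n) :
  symalg_map f p \is n.-homog for mdeg.
Proof. exact/comp_mpoly_homog/dhomog_is_dhomog/sym_subst1. Qed.

Definition sym_map n (p : dhomog (rk V) F2 n) : dhomog (rk W) F2 n :=
  DHomog (symalg_map_homog p).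
End SymMap.

Lemma symalg_map_id (V : vectType F2) (p : symalg V) : symalg_map (\1%VF : 'End(V)) p = p.
Proof.
rewrite /symalg_map -[RHS]comp_mpoly_id.
apply: eq_comp_mpoly => i; rewrite !tnth_mktuple (bigD1 i) //=.
rewrite coef_id eqxx scale1r big1 ?addr0 // => j ji.
by rewrite coef_id (eq_sym i) (negPf ji) scale0r.
Qed.

Lemma symalg_map_comp (U V W : vectType F2) (g : 'Hom(V, W)) (f : 'Hom(U, V)) p :
  symalg_map (g \o f)%VF p = symalg_map g (symalg_map f p).
Proof.
rewrite /symalg_map comp_mpolyA; apply: eq_comp_mpoly => i.
rewrite !tnth_mktuple linear_sum /=.
under eq_bigr do rewrite coef_comp scaler_suml.
rewrite exchange_big /=; apply: eq_bigr => j _.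
rewrite comp_mpolyZ comp_mpolyXU -tnth_nth tnth_mktuple scaler_sumr.
by apply: eq_bigr => k _; rewrite scalerA.
Qed.

(** The symmetric power functor S^n. *)
Program Definition Sym (n : nat) : functor vect :=
  @Functor vect (fun V => dhomog (rk V) F2 n) (fun V W f p => sym_map f p) _ _ _.
Next Obligation.
by move=> n V W f a p q; apply/val_inj; rewrite /= /symalg_map linearP.
Qed.
Next Obligation. by move=> n V p; apply/val_inj; rewrite /= symalg_map_id. Qed.
Next Obligation.
by move=> n U V W g f p; apply/val_inj; rewrite /= symalg_map_comp.
Qed.

Lemma total_sq_nat (V W : vectType F2) (f : 'Hom(V, W)) p :
  total_sq (symalg_map f p) = symalg_map f (total_sq p).
Proof.
rewrite /total_sq /symalg_map !comp_mpolyA; apply: eq_comp_mpoly => i.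
rewrite !tnth_mktuple linear_sum /=.
rewrite rmorphD rmorphXn /= !comp_mpolyXU -!tnth_nth !tnth_mktuple.
have F2_sqD (x y : {mpoly F2[rk W]}) : (x + y) ^+ 2 = x ^+ 2 + y ^+ 2.
  have c2 : (2 : {mpoly F2[rk W]}) = 0.
    by rewrite -[2]mpolyC_nat -[X in X%:MP]/((2%:R : 'F_2)) pchar_Zp // mpolyC0.
  by rewrite sqrrD -mulr_natr c2 mulr0 addr0.
have -> (I : finType) (F : I -> {mpoly F2[rk W]}) :
    (\sum_i F i) ^+ 2 = \sum_i F i ^+ 2.
  by apply: (big_morph (fun x => x ^+ 2)) => //; rewrite expr0n.
rewrite -big_split /=; apply: eq_bigr => j _.
rewrite comp_mpolyZ comp_mpolyXU -tnth_nth tnth_mktuple scalerDr exprZn.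
congr (_ + _ *: _); move: (coef f i j) => [[|[|k]] ck] //; exact/val_inj.
Qed.

(** The Steenrod square Sq^(n - m) : S^m -> S^n; for n < m it is 0. *)
Program Definition Sq (m n : nat) : nat_trans (Sym m) (Sym n) :=
  @NatTrans vect (Sym m) (Sym n)
    (fun V p => @DHomog (rk V) F2 n (pihomog mdeg n (total_sq (V := V) p))
       (pihomogP _ _ _)) _ _.
Next Obligation.
by move=> m n V a p q; apply/val_inj; rewrite /= /total_sq !linearP.
Qed.
Next Obligation.
move=> m n V W f p; apply/val_inj => /=.
by rewrite total_sq_nat pihomog_comp //; apply: sym_subst1.
Qed.

(** * Indecomposables for the Steenrod algebra *)

(** A graded functor M_* with natural operations Sq^(n - m) : M_m -> M_n. *)
Record sq_functor := SqFunctor {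
  sqobj :> nat -> functor vect;
  sqop : forall m n, nat_trans (sqobj m) (sqobj n) }.

(** Actions M_m -> M_n of the elements of degree n - m > 0 of A(2), the
   algebra generated by the squares. *)
Inductive pos_op (M : sq_functor) :
    forall m n, nat_trans (M m) (M n) -> Prop :=
  | pos_sq m n : (m < n)%N -> pos_op (sqop M m n)
  | pos_add m n (a b : nat_trans (M m) (M n)) :
      pos_op a -> pos_op b -> pos_op (nat_add a b)
  | pos_comp m n k (a : nat_trans (M m) (M n)) (b : nat_trans (M n) (M k)) :
      pos_op a -> pos_op b -> pos_op (nat_comp b a).

Definition hits (M : sq_functor) (n : nat) : subfunctor (M n) :=
  gen_sub (fun V x =>
    exists m (a : nat_trans (M m) (M n)) y, pos_op a /\ x = a V y).

(** The degree n part of the tensor product of F_2 and M over A(2). *)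
Definition indec (M : sq_functor) (n : nat) : functor vect :=
  quo_functor (hits M n).

Definition SymSq : sq_functor := SqFunctor Sq.
Definition grSq (d : nat) : sq_functor :=
  @SqFunctor (fun n => gr d (Sym n)) (fun m n => gr_map d (Sq m n)).

Definition Q (n : nat) : functor vect := indec SymSq n.

(** The image of [polyfilt k S^n] in Q^n; thus Q^n[d] is [Qfilt n d.+1]. *)
Definition Qfilt (n k : nat) : subfunctor (Q n) :=
  image (nat_comp (quo_proj (hits SymSq n)) (sub_incl (polyfilt k (Sym n)))).

Definition Qgr (n d : nat) : functor vect := subquo (Qfilt n d.+1) (Qfilt n d).

Definition frakQ (n d : nat) : functor vect := indec (grSq d) n.

Definition frakQ_class n d :
    nat_trans (p_ d (Sym n)) (frakQ n d) :=
  nat_comp (quo_proj (hits (grSq d) n)) (subquo_proj _ _).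

(** The natural surjection from frakQ^n_d to Q^n_d, [x] |-> [x]. *)

Fact Qfilt_class n k V x :
  polyfilt k (Sym n) V x -> Qfilt n k V (quo_proj (hits SymSq n) V x).
Proof. by move=> Hx; exists (mksub Hx). Qed.

Definition gr_to_Qgr n d : nat_trans (gr d (Sym n)) (Qgr n d) :=
  subquo_map (@Qfilt_class n d.+1) (@Qfilt_class n d).

Fact gr_to_Qgr_sq m n d V (y : sub_functor (polyfilt d.+1 (Sym m)) V) :
  (m < n)%N ->
  gr_to_Qgr n d V (gr_map d (Sq m n) V (subquo_proj _ (polyfilt d _) V y)) = 0.
Proof.
move=> mn.
have -> : gr_map d (Sq m n) V (subquo_proj _ (polyfilt d _) V y) =
    subquo_proj _ _ V (sub_map (@polyfilt_nat d.+1 _ _ (Sq m n)) V y).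
  exact: (@subquo_map_pi _ _ _ (Sq m n)).
have -> z : gr_to_Qgr n d V (subquo_proj _ (polyfilt d _) V z) =
    subquo_proj _ _ V (sub_map (@Qfilt_class n d.+1) V z).
  exact: (@subquo_map_pi _ _ _ (quo_proj (hits SymSq n))).
apply/quo_pi0.
suff E : quo_proj (hits SymSq n) V (Sq m n V (sval_of y)) = 0.
  by have Z : Qfilt n d V 0 := smem0 _; rewrite -E in Z.
apply/quo_pi0; apply: gen_sub_in.
exists m, (sqop SymSq m n), (sval_of y); split=> //; exact: (@pos_sq SymSq).
Qed.

Fact gr_to_Qgr_hits n d V x :
  hits (grSq d) n V x -> gr_to_Qgr n d V x = 0.
Proof.
have opP m k (a : nat_trans (grSq d m) (grSq d k)) : pos_op a ->
    forall W y, gr_to_Qgr k d W (a W y) = 0.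
  elim=> {m k a} [m k mk|m k a b _ IHa _ IHb|m k l a b _ _ _ IHb] W y.
  - move: y; apply: (@quoW _ (preimage (sub_incl (polyfilt d.+1 (Sym m)))
      (polyfilt d (Sym m)) W)) => y.
    exact: gr_to_Qgr_sq.
  - by rewrite (linD (@nt_linear _ _ _ (gr_to_Qgr k d) W)) IHa IHb addr0.
  - exact: IHb.
move=> Hx.
pose P W (y : gr d (Sym n) W) := gr_to_Qgr n d W y = 0.
have P0 W : P W 0 by apply: (lin0 (@nt_linear _ _ _ (gr_to_Qgr n d) W)).
have PD W c y z : P W y -> P W z -> P W (c *: y + z).
  by rewrite /P nt_linear => -> ->; rewrite scaler0 addr0.
have Pst W X (f : hom vect W X) y : P W y -> P X (fmap f y).
  by rewrite /P nt_nat => ->; apply: (lin0 (fmap_linear f)).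
apply: (Hx (@Subfunctor vect _ (fun W => Submod (P0 W) (@PD W)) Pst)).
by move=> W _ [m [a [y [Ha ->]]]]; apply: opP Ha _ _.
Qed.

Definition frakQ_to_Qgr n d : nat_trans (frakQ n d) (Qgr n d) :=
  quo_lift (@gr_to_Qgr_hits n d).

Lemma frakQ_to_Qgr_class n d V (x : p_ d (Sym n) V) :
  frakQ_to_Qgr n d V (frakQ_class n d V x) =
  subquo_proj (Qfilt n d.+1) (Qfilt n d) V
    (mksub (Qfilt_class (sub_ofP x))).
Proof.
rewrite /frakQ_to_Qgr; transitivity (gr_to_Qgr n d V (subquo_proj _ _ V x)).
  exact: quo_lift_pi.
have -> : gr_to_Qgr n d V (subquo_proj _ (polyfilt d _) V x) =
    subquo_proj _ _ V (sub_map (@Qfilt_class n d.+1) V x).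
  exact: (@subquo_map_pi _ _ _ (quo_proj (hits SymSq n))).
by congr (subquo_proj _ _ V _); apply/val_inj.
Qed.

Lemma frakQ_to_Qgr_epi n d : is_epi (frakQ_to_Qgr n d).
Proof.
move=> V; apply: quoW => -[y Hy].
have [x xy] := sub_ofP (SubOf Hy).
exists (frakQ_class n d V x); rewrite frakQ_to_Qgr_class.
by congr (subquo_proj _ _ V _); apply/val_inj; exact: xy.
Qed.

(** * Tensor and exterior powers *)

Section Tensors.
Variable d : nat.

(** The d-fold tensor power of V, in coordinates: t i is the coefficient of
   the tensor of the basis vectors [bas (i 0)], ..., [bas (i (d - 1))]. *)
Definition Tens (V : vectType F2) : vectType F2 :=
  {ffun {ffun 'I_d -> 'I_(rk V)} -> F2^o}.

Definition pure (V : vectType F2) (v : 'I_d -> V) : Tens V :=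
  [ffun i : {ffun 'I_d -> 'I_(rk V)} => \prod_k crd (i k) (v k)].

Section Map.
Variables (V W : vectType F2) (f : 'Hom(V, W)).
Definition tens_map_fun (t : Tens V) : Tens W :=
  [ffun j : {ffun 'I_d -> 'I_(rk W)} =>
    \sum_i t i * \prod_k coef f (i k) (j k)].
Fact tens_map_linear : linear tens_map_fun.
Proof.
move=> a t u; apply/ffunP=> j; rewrite !ffunE scaler_sumr -big_split /=.
by apply: eq_bigr => i _; rewrite !ffunE mulrDl -scalerAl.
Qed.
HB.instance Definition _ :=
  GRing.isLinear.Build F2 (Tens V) (Tens W) *:%R tens_map_fun tens_map_linear.
Definition tens_map : 'Hom(Tens V, Tens W) := linfun tens_map_fun.

Lemma tens_map_pure (v : 'I_d -> V) : tens_map (pure v) = pure (fun k => f (v k)).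
Proof.
rewrite lfunE; apply/ffunP=> j; rewrite !ffunE.
transitivity (\sum_(i : {ffun 'I_d -> 'I_(rk V)})
    \prod_k (crd (i k) (v k) * coef f (i k) (j k))).
  by apply: eq_bigr => i _; rewrite /pure ffunE -big_split.
rewrite -(bigA_distr_bigA (fun k i => crd i (v k) * coef f i (j k))) /=.
apply: eq_bigr => k _; rewrite {2}[v k]vec_coord linear_sum /crd linear_sum /=.
by apply: eq_bigr => i _; rewrite !linearZ.
Qed.
End Map.

Lemma tens_map_id (V : vectType F2) : tens_map \1%VF = \1%VF :> 'End(Tens V).
Proof.
apply/lfunP=> t; rewrite lfunE id_lfunE; apply/ffunP=> j; rewrite ffunE.
rewrite (bigD1 j) //= [X in _ + X]big1 => [|i ij].
  rewrite big1 => [|k _]; last by rewrite coef_id eqxx.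
  by rewrite mulr1 addr0.
have [k kij] : exists k, i k != j k.
  apply/existsP; rewrite -negb_forall; apply: contra ij => /forallP e.
  by apply/eqP/ffunP=> k; apply/eqP.
by rewrite (bigD1 k) //= coef_id (negPf kij) mul0r mulr0.
Qed.

Lemma tens_map_comp (U V W : vectType F2) (g : 'Hom(V, W)) (f : 'Hom(U, V)) :
  tens_map (g \o f)%VF = (tens_map g \o tens_map f)%VF.
Proof.
apply/lfunP=> t; rewrite comp_lfunE !lfunE; apply/ffunP=> j; rewrite !ffunE.
under [RHS]eq_bigr do rewrite ffunE mulr_suml.
rewrite exchange_big /=; apply: eq_bigr => i _.
under [RHS]eq_bigr do rewrite -mulrA -big_split /=.
rewrite -mulr_sumr; congr (_ * _).
rewrite -(bigA_distr_bigA (fun k l => coef f (i k) l * coef g l (j k))) /=.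
by apply: eq_bigr => k _; rewrite coef_comp.
Qed.

Section Perm.
Variables (V : vectType F2) (s : 'S_d).
Definition tens_perm_fun (t : Tens V) : Tens V :=
  [ffun i : {ffun 'I_d -> 'I_(rk V)} => t [ffun k => i (s k)]].
Fact tens_perm_linear : linear tens_perm_fun.
Proof. by move=> a t u; apply/ffunP=> i; rewrite !ffunE. Qed.
HB.instance Definition _ :=
  GRing.isLinear.Build F2 (Tens V) (Tens V) *:%R tens_perm_fun
    tens_perm_linear.
Definition tens_perm : 'End(Tens V) := linfun tens_perm_fun.
End Perm.

Program Definition TensF : functor vect :=
  @Functor vect Tens (fun V W f t => tens_map f t) _ _ _.
Next Obligation. by move=> V W f a t u; rewrite linearP. Qed.
Next Obligation. by move=> V t /=; rewrite tens_map_id id_lfunE. Qed.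
Next Obligation. by move=> U V W g f t /=; rewrite tens_map_comp comp_lfunE. Qed.

(** The exterior power functor. *)
Definition Ext : functor vect := quo_functor (gen_sub (F := TensF)
  (fun V t => exists (v : 'I_d -> V) i j, [/\ i != j, v i = v j & t = pure v])).

(** * Strict polynomial functors

   P_d is the category of F_2-linear functors on [gamma d], whose morphisms
   V -> W are the S_d-equivariant maps of d-fold tensor powers, that is the
   elements of Gamma^d(Hom(V, W)). *)

Definition equivariant (V W : vectType F2) : 'Hom(Tens V, Tens W) -> bool := fun phi =>
  [forall s : 'S_d, (phi \o tens_perm V s == tens_perm W s \o phi)%VF].

Fact equivariant_submod (V W : vectType F2) : submod_closed (@equivariant V W).
Proof.
split=> [|a f g].
  by apply/forallP=> s; rewrite comp_lfun0l comp_lfun0r.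
move=> /forallP Ef /forallP Eg; apply/forallP=> s.
rewrite comp_lfunDl comp_lfunDr -comp_lfunZl -comp_lfunZr.
by rewrite (eqP (Ef s)) (eqP (Eg s)).
Qed.
HB.instance Definition _ (V W : vectType F2) := GRing.isSubmodClosed.Build F2
  'Hom(Tens V, Tens W) (@equivariant V W) (@equivariant_submod V W).

Record gamma_hom (V W : vectType F2) := GammaHom {
  gamma_val :> 'Hom(Tens V, Tens W);
  _ : gamma_val \in @equivariant V W }.
HB.instance Definition _ (V W : vectType F2) := [isSub for @gamma_val V W].
HB.instance Definition _ (V W : vectType F2) := [Choice of gamma_hom V W by <:].
HB.instance Definition _ (V W : vectType F2) := [SubChoice_isSubLmodule of gamma_hom V W by <:].

Lemma gamma_homP V W (f : gamma_hom V W) s :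
  (f \o tens_perm V s)%VF = (tens_perm W s \o f)%VF.
Proof. by case: f => f /= /forallP/(_ s)/eqP. Qed.

Program Definition gamma : category :=
  @Category gamma_hom (fun V => @GammaHom V V \1%VF _)
    (fun U V W g f => @GammaHom U W (g \o f)%VF _) _ _ _.
Next Obligation.
by move=> V; apply/forallP=> s; rewrite comp_lfun1l comp_lfun1r.
Qed.
Next Obligation.
move=> U V W g f; apply/forallP=> s; apply/eqP.
by rewrite -comp_lfunA gamma_homP !comp_lfunA gamma_homP.
Qed.
Next Obligation. by move=> *; apply/val_inj; rewrite /= comp_lfunA. Qed.
Next Obligation. by move=> *; apply/val_inj; rewrite /= comp_lfun1l. Qed.
Next Obligation. by move=> *; apply/val_inj; rewrite /= comp_lfun1r. Qed.

Record strict := Strict {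
  strict_fun :> functor gamma;
  strict_linear : forall V W (a : F2) (f g : gamma_hom V W) x,
    fmap (a *: f + g : hom gamma V W) x =
    a *: fmap (f : hom gamma V W) x + fmap (g : hom gamma V W) x
      :> strict_fun W }.

Fact tens_map_equivariant (V W : vectType F2) (f : 'Hom(V, W)) :
  tens_map f \in @equivariant V W.
Proof.
apply/forallP=> s; apply/eqP/lfunP=> t; rewrite !comp_lfunE !lfunE.
apply/ffunP=> j; rewrite !ffunE.
pose h (i : {ffun 'I_d -> 'I_(rk V)}) := [ffun k => i (s k)].
pose h' (i : {ffun 'I_d -> 'I_(rk V)}) := [ffun k => i ((s^-1)%g k)].
have hK : cancel h h' by move=> i; apply/ffunP=> k; rewrite !ffunE permKV.
have h'K : cancel h' h by move=> i; apply/ffunP=> k; rewrite !ffunE permK.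
rewrite [RHS](reindex h) /=; last by exists h' => i _; rewrite ?hK ?h'K.
apply: eq_bigr => i _; rewrite ffunE; congr (_ * _).
rewrite [LHS](reindex_inj (@perm_inj _ s)) /=.
by apply: eq_bigr => k _; rewrite !ffunE.
Qed.

Definition gamma_pow (V W : vectType F2) (f : 'Hom(V, W)) : hom gamma V W :=
  GammaHom (tens_map_equivariant f).

(** The forgetful functor from P_d to F. *)
Program Definition forget (T : strict) : functor vect :=
  @Functor vect T (fun V W f x => fmap (gamma_pow f) x) _ _ _.
Next Obligation. by move=> T V W f; apply: fmap_linear. Qed.
Next Obligation.
move=> T V x; rewrite -[RHS](fmap_id (C := gamma)); congr (fmap _ x).
by apply/val_inj; rewrite /= tens_map_id.
Qed.
Next Obligation.
move=> T U V W g f x; rewrite /= -fmap_comp; congr (fmap _ x).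
by apply/val_inj; rewrite /= tens_map_comp.
Qed.

(** Simple objects: subobjects in P_d are the subfunctors over [gamma]. *)
Definition simple (T : strict) :=
  ~ is_zero T /\
  forall A : subfunctor T,
    (forall V x, A V x -> x = 0) \/ (forall V x, A V x).

(** Weight spaces: on the tensor power of V, the weight mu part is spanned by
   the basis tensors in which the j-th basis vector occurs mu j times; T(V)_mu
   is the image of the corresponding idempotent of the Schur algebra. *)
Section Weights.
Variables (V : vectType F2) (mu : 'I_(rk V) -> nat).

Definition has_content (i : {ffun 'I_d -> 'I_(rk V)}) :=
  [forall j, #|[set k | i k == j]| == mu j].

Definition weight_proj_fun (t : Tens V) : Tens V :=
  [ffun i : {ffun 'I_d -> 'I_(rk V)} => if has_content i then t i else 0].
Fact weight_proj_linear : linear weight_proj_fun.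
Proof.
move=> a t u; apply/ffunP=> i; rewrite !ffunE.
by case: ifP => _ //; rewrite scaler0 addr0.
Qed.
HB.instance Definition _ :=
  GRing.isLinear.Build F2 (Tens V) (Tens V) *:%R weight_proj_fun
    weight_proj_linear.

Fact weight_proj_equivariant : linfun weight_proj_fun \in @equivariant V V.
Proof.
apply/forallP=> s; apply/eqP/lfunP=> t; rewrite !comp_lfunE !lfunE.
apply/ffunP=> i; rewrite !ffunE; congr (if _ then _ else _).
apply: eq_forallb => j; congr (_ == _).
rewrite -[LHS](card_preimset _ (@perm_inj _ s)).
by apply: eq_card => k; rewrite !inE ?ffunE.
Qed.

Definition weight_proj : hom gamma V V := GammaHom weight_proj_equivariant.

Definition is_weight (T : strict) :=
  exists2 x : T V, x != 0 & fmap weight_proj x = x.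
End Weights.

(** Highest weight for the dominance order, lambda being extended by 0. *)
Definition highest_weight (T : strict) (lambda : seq nat) :=
  (forall V, (size lambda <= rk V)%N ->
     is_weight (V := V) (fun j => nth 0%N lambda j) T) /\
  (forall V (mu : 'I_(rk V) -> nat), is_weight mu T ->
     forall m, (\sum_(j < rk V | j < m) mu j <= \sum_(j < m) nth 0%N lambda j)%N).
End Tensors.

(** * The strict structure of frakQ^n_d and the connecting operation *)

(** The map sending the tensor of v_0, ..., v_(d-1) to the product of the
   v_k ^ (2 ^ s k); it is linear since the Frobenius is additive. *)
Definition frob_tensor d (s : 'I_d -> nat) V (t : Tens d V) : symalg V :=
  \sum_(i : {ffun 'I_d -> 'I_(rk V)}) t i *: \prod_k 'X_(i k) ^+ (2 ^ s k).

(** T, through theta, is frakQ^n_d regarded as an object of P_d. The strict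
   structure on p_d S^n / p_(d-1) S^n is that of the direct sum of the tensor
   products of the Lambda^(omega_i); equivalently, it makes the composites of
   the d-fold tensor power ->> tensor product of the Lambda^(omega_i) with the
   inclusions, which are the maps [frob_tensor s] with s taking omega_i times
   the value i, morphisms of P_d. As these are jointly surjective, this
   determines the action of [gamma d] on the quotient frakQ^n_d. *)
Definition strict_frakQ n d (T : strict d) (theta : nat_trans (forget T) (frakQ n d)) :=
  is_iso theta /\
  forall (s : 'I_d -> nat) V W (phi : gamma_hom d V W) (t : Tens d V)
      (x : p_ d (Sym n) V) (y : p_ d (Sym n) W) (a : T V),
    sval_of x = frob_tensor s t :> symalg V ->
    sval_of y = frob_tensor s (phi t) :> symalg W ->
    theta V a = frakQ_class n d V x ->
    theta W (fmap (phi : hom (gamma d) V W) a) = frakQ_class n d W y.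

(** z in frakQ^n_e(V) is the class of Sq^(n - m) x, where x in p_d S^m(V) has
   Sq^(n - m) x in p_e S^n(V). For e < d this is the connecting operation of
   the polynomial filtration: its values vanish in Q^n_e. *)
Definition sq_connects m d n e V (x : p_ d (Sym m) V) (z : frakQ n e V) :=
  exists2 y : p_ e (Sym n) V,
    sval_of y = Sq m n V (sval_of x) & z = frakQ_class n e V y.

(* Main.v *)
From HB Require Import structures.
From mathcomp Require Import all_boot all_order all_fingroup all_algebra.
From mathcomp Require Import boolp mpoly zify ring.
Require Import Defs.

Set Implicit Arguments.
Unset Strict Implicit.
Unset Printing Implicit Defensive.

Import GRing.Theory.

(** In a basis of [V] write a monomial as a product of factors
   [x ^ (2 ^ s)], one for each binary digit of its exponents; the number of
   factors is its weight. Linear substitutions are additive on each factor, so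
   a monomial of weight [e] is a polynomial map of degree [e] of the
   substitution, and conversely its [e]-fold differences show all its factors.
   Hence [p_d S^n] is spanned by the monomials of weight at most [d]
   ([polyfilt_Sym]), and everything becomes a statement on polynomials: the
   surjection from [frakQ^n_d] to [Q^n_d] is injective if and only if each hit
   form of weight at most [d] is, up to lower weight, hit from forms of weight
   at most [d].

   A hit form [x = sum Sq^i y_i] is lowered one weight at a time. If the [y_i]
   have weight at most [e] and [x] has weight less than [e], the leading parts
   of the [y_i] satisfy a relation, and it suffices that this relation comes
   from one that holds exactly. In degree at most 8 few shapes of leading parts
   occur, and the relations are consequences of [Sq^1 Sq^1 = 0] and
   [Sq^1 Sq^2 = Sq^3], two instances of [Sq^1 Sq^k = (k + 1) Sq^(k+1)]
   ([Dsq_sq]), as soon as the leading part of [Sq^1] is exact. That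
   leading part is the differential of a tensor product over the variables,
   with homology spanned by the monomials with all exponents 0 or 3 modulo 4
   ([Dsq_exact]); as [3 wt <= 2 deg] for these, with equality when all exponents
   are 0 or 3, they do not occur before the forms [x^3 y^3] of degree 6 and
   weight 4. When the weight is too low for odd exponents a form is a square,
   and is hit by the top Steenrod square ([Hit_even]).

   The class of [x^3 y^3] is responsible for the exception: its [Sq^1], which is
   [x^4 y^3 + x^3 y^4], has weight 3 and vanishes in [Q^7_3]. Its class in
   [frakQ^7_3] does not: all factors of weight 3 may be permuted there, and
   [detect] reads off the coefficient. This gives the kernel [Lambda^2]
   ([iota73_short_exact]).

   On the other side [frakQ^6_4] is the quotient of the fourth tensor power by
   relations that are written with permutations of the slots, which gives its
   strict structure ([T64]). The kernel of the leading part of [Sq^1], modulo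
   the image, consists of the classes of the tensors that are symmetric both
   in the slots 0, 2 and in the slots 1, 3 ([B64]). Such a tensor is determined
   by its coefficients on [v (x) w (x) v (x) w] ([rel64_diag]), which identifies
   [B64] with the Frobenius twist of [Lambda^2]: it is generated by any of its
   nonzero elements, has highest weight [(2, 2)], and its image under [Sq^1] is
   the kernel above. *)

(** * Binary digits *)

Section Popcount.

Fixpoint popcount_rec (fuel n : nat) : nat :=
  if fuel is k.+1 then odd n + popcount_rec k n./2 else 0.

Definition popcount n := popcount_rec n n.

Lemma popcount_recE k n : n <= k -> popcount_rec k n = popcount n.
Proof.
rewrite /popcount; elim/ltn_ind: n k => -[|n] IH k nk.
  by elim: k {nk} => //= k ->.
case: k nk => //= k nk; congr (_ + _).
by rewrite !IH //; lia.
Qed.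

Lemma popcountE n : popcount n = odd n + popcount n./2.
Proof.
case: n => // n; rewrite {1}/popcount [LHS]/= popcount_recE //.
lia.
Qed.

Lemma popcount_double n : popcount n.*2 = popcount n.
Proof. by rewrite popcountE odd_double doubleK. Qed.

Lemma popcount_exp2 s : popcount (2 ^ s) = 1.
Proof. by elim: s => // s; rewrite expnS mul2n popcount_double. Qed.

(** A full adder; the carry is there for the induction. *)
Lemma popcountD_carry m n (c : bool) :
  popcount (m + n + c) <= popcount m + popcount n + c.
Proof.
elim/ltn_ind: {m n}(m + n) {-2}m {-2}n (erefl (m + n)) c => N IH m n mn c.
case: (posnP N) => [N0|N0].
  by have [-> ->] : m = 0 /\ n = 0 by [lia]; case: c.
rewrite (popcountE (_ + c)) (popcountE m) (popcountE n).
pose c' := [|| odd m && odd n, odd m && c | odd n && c].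
have -> : (m + n + c)./2 = m./2 + n./2 + c' by rewrite /c'; lia.
have := IH (m./2 + n./2) ltac:(lia) m./2 n./2 erefl c'.
rewrite !oddD {}/c'; case: (odd m); case: (odd n); case: c => //=; lia.
Qed.

Lemma popcountD m n : popcount (m + n) <= popcount m + popcount n.
Proof. by have := popcountD_carry m n false; rewrite !addn0. Qed.

(** Beyond 1, digits are densest at 3. *)
Lemma popcount_bound n : 3 * popcount n <= 2 * n + (n == 1).
Proof.
elim/ltn_ind: n => -[|[|[|[|n]]]] IH //.
rewrite popcountE; have := IH n.+4./2; lia.
Qed.

Lemma popcount_bound_eq n : 1 < n -> 2 * n <= 3 * popcount n -> n = 3.
Proof.
case: n => [|[|[|[|n]]]] // _; rewrite popcountE => H.
have := popcount_bound n.+4./2; lia.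
Qed.

Fixpoint bits_rec (fuel n : nat) : seq nat :=
  if fuel is k.+1 then nseq (odd n) 0 ++ map S (bits_rec k n./2) else [::].

Definition bits n := bits_rec n n.

Lemma size_bits n : size (bits n) = popcount n.
Proof.
suff H k m : size (bits_rec k m) = popcount_rec k m by exact: H.
by elim: k m => //= k IH m; rewrite size_cat size_nseq size_map IH.
Qed.

Lemma sum_bits n : \sum_(s <- bits n) 2 ^ s = n.
Proof.
rewrite /bits; suff H k : n <= k -> \sum_(s <- bits_rec k n) 2 ^ s = n by exact: H.
elim: k n => [|k IH] n nk /=; first by rewrite big_nil; case: n nk.
rewrite big_cat big_map /=.
under [X in _ + X]eq_bigr do rewrite expnS.
rewrite -big_distrr IH /=; last by case: n nk => //= n; lia.
have -> : \sum_(i <- nseq (odd n) 0) 2 ^ i = odd n.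
  by case: (odd n); rewrite /= ?big_cons big_nil.
lia.
Qed.

Lemma odd_bin_double n j : odd 'C(n.*2, j.*2) = odd 'C(n, j).
Proof.
elim: n j => [|n IH] [|j]; rewrite ?bin0 //.
have := IH j.+1; rewrite !doubleS !binS !oddD IH => ->.
by case: (odd 'C(n.*2, j.*2.+1)); case: (odd 'C(n, j)); case: (odd 'C(n, j.+1)).
Qed.

(** The divided derivative that removes the lowest binary digit of an exponent
   is not zero modulo 2. *)
Lemma odd_bin_popcount n : 0 < n ->
  exists2 j, 0 < j <= n & odd 'C(n, j) /\ (popcount (n - j)).+1 = popcount n.
Proof.
elim/ltn_ind: n => n IH n0; case: (boolP (odd n)) => [on|en].
  exists 1; first lia; rewrite bin1 on; split=> //.
  rewrite [RHS]popcountE on (popcountE (n - 1)).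
  by have -> : odd (n - 1) = false by [lia]; have -> : (n - 1)./2 = n./2 by lia.
have [j jn [oj ej]] := IH n./2 ltac:(lia) ltac:(lia).
exists j.*2; first lia.
have -> : n = n./2.*2 by lia.
by rewrite odd_bin_double -doubleB !popcount_double.
Qed.

End Popcount.

(** * The weight of a monomial *)

Section Char2.
Local Open Scope ring_scope.

Lemma F2_cases (c : F2) : c = 0 \/ c = 1.
Proof.
by case: c => [[|[|k]] ck] //; [left | right]; apply/val_inj.
Qed.

Lemma F2_addcc (c : F2) : c + c = 0.
Proof. by case: (F2_cases c) => ->; apply/val_inj. Qed.

Lemma F2_exp (c : F2) n : (0 < n)%N -> c ^+ n = c.
Proof. by case: n => // n _; case: (F2_cases c) => ->; rewrite ?expr1n ?expr0n. Qed.

Lemma F2_nat n : n%:R = (odd n)%:R :> F2.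
Proof. by elim: n => // n IH; rewrite mulrS IH /=; case: (odd n); apply/val_inj. Qed.

Lemma F2_add0 (a b : F2) : a + b = 0 -> a = b.
Proof. by move=> ab; rewrite -[a]addr0 -(F2_addcc b) addrA ab add0r. Qed.

Lemma lmod2_addxx (U : lmodType F2) (x : U) : x + x = 0.
Proof. by rewrite -[x]scale1r -scalerDl F2_addcc scale0r. Qed.

Lemma lmod2_opp (U : lmodType F2) (x : U) : - x = x.
Proof. by apply/eqP; rewrite eq_sym -addr_eq0 lmod2_addxx. Qed.

Lemma pchar_mpoly2 r : (2 \in [pchar {mpoly F2[r]}])%N.
Proof. by rewrite !inE /= mulr2n lmod2_addxx. Qed.

Lemma frobD (R : comNzRingType) s (x y : R) : (2 \in [pchar R])%N ->
  (x + y) ^+ (2 ^ s) = x ^+ (2 ^ s) + y ^+ (2 ^ s).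
Proof.
move=> R2; apply: exprDn_pchar; rewrite pnatX; apply/orP; left.
by rewrite pnatE.
Qed.

Lemma frob_sum (R : comNzRingType) s (I : Type) (l : seq I) (f : I -> R) :
  (2 \in [pchar R])%N ->
  (\sum_(i <- l) f i) ^+ (2 ^ s) = \sum_(i <- l) f i ^+ (2 ^ s).
Proof.
move=> R2; elim: l => [|i l IH]; first by rewrite !big_nil expr0n expn_eq0.
by rewrite !big_cons frobD // IH.
Qed.

End Char2.

Section Weight.
Local Open Scope ring_scope.
Variable r : nat.
Implicit Types (a b c : 'X_{1..r}) (p q : {mpoly F2[r]}).

(** The least number of factors [x ^ (2 ^ s)] of which a monomial is the
   product. *)
Definition wt a : nat := (\sum_i popcount (a i))%N.

Lemma wtD a b : (wt (a + b)%MM <= wt a + wt b)%N.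
Proof.
rewrite /wt -big_split; apply: leq_sum => i _.
by rewrite mnmDE popcountD.
Qed.

Lemma wt0 : wt 0%MM = 0%N.
Proof. by apply: big1 => i _; rewrite mnm0E. Qed.

Lemma wt_le_mdeg a : (wt a <= mdeg a)%N.
Proof.
rewrite mdegE; apply: leq_sum => i _.
have := popcount_bound (a i); case: (a i) => [|[|n]] //; lia.
Qed.

Lemma wtUn (i : 'I_r) n : wt (U_(i) *+ n)%MM = popcount n.
Proof.
rewrite /wt (bigD1 i) //= mulmnE mnm1E eqxx mul1n big1 ?addn0 // => j ji.
by rewrite mulmnE mnm1E eq_sym (negPf ji).
Qed.

(** The span of the monomials of weight [< k]; it will turn out to be the
   polynomial filtration of the symmetric powers. *)
Definition Fil k p := forall a, (k <= wt a)%N -> p@_a = 0.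

Lemma Fil0 k : Fil k 0.
Proof. by move=> a _; rewrite mcoeff0. Qed.

Lemma FilD k p q : Fil k p -> Fil k q -> Fil k (p + q).
Proof. by move=> Fp Fq a ka; rewrite mcoeffD Fp ?Fq ?addr0. Qed.

Lemma FilB k p q : Fil k p -> Fil k q -> Fil k (p - q).
Proof. by rewrite lmod2_opp; apply: FilD. Qed.

Lemma FilZ k (c : F2) p : Fil k p -> Fil k (c *: p).
Proof. by move=> Fp a ka; rewrite mcoeffZ Fp // mulr0. Qed.

Lemma Fil_sum k (I : Type) (l : seq I) (P : pred I) (f : I -> {mpoly F2[r]}) :
  (forall i, P i -> Fil k (f i)) -> Fil k (\sum_(i <- l | P i) f i).
Proof. by move=> H; elim/big_ind: _ => //; [exact: Fil0 | exact: FilD]. Qed.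

Lemma FilW k l p : (k <= l)%N -> Fil k p -> Fil l p.
Proof. by move=> kl Fp a la; apply: Fp; apply: leq_trans la. Qed.

Lemma Fil_supp k p a : Fil k p -> a \in msupp p -> (wt a < k)%N.
Proof.
move=> Fp; rewrite mcoeff_msupp ltnNge; apply: contraNN => ka.
by rewrite Fp.
Qed.

Lemma FilX k a : (wt a < k)%N -> Fil k 'X_[a].
Proof.
move=> ak b kb; rewrite mcoeffX; case: eqP kb => [<-|] //; lia.
Qed.

Lemma Fil_msupp k p : (forall a, a \in msupp p -> (wt a < k)%N) -> Fil k p.
Proof. by move=> H a ka; apply: memN_msupp_eq0; apply/negP => /H; lia. Qed.

Lemma FilM d e p q : Fil d.+1 p -> Fil e.+1 q -> Fil (d + e).+1 (p * q).
Proof.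
move=> Fp Fq; apply: Fil_msupp => c /msuppM_le /allpairsP[[a b] /= [ap bq ->]].
have := wtD a b; have := Fil_supp Fp ap; have := Fil_supp Fq bq; lia.
Qed.

Lemma Fil1 k : Fil k.+1 1.
Proof. by rewrite -mpolyX0; apply: FilX; rewrite wt0. Qed.

Lemma Fil_prod (I : Type) (l : seq I) (f : I -> {mpoly F2[r]}) :
  (forall i, Fil 2 (f i)) -> Fil (size l).+1 (\prod_(i <- l) f i).
Proof.
move=> H; elim: l => [|i l IH]; first by rewrite big_nil; apply: Fil1.
by rewrite big_cons; apply: (@FilM 1 (size l)).
Qed.

Lemma Fil_homog n p : p \is n.-homog for mdeg -> Fil n.+1 p.
Proof.
move=> /dhomogP Hp; apply: Fil_msupp => a ap.
by rewrite ltnS -(Hp a ap) wt_le_mdeg.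
Qed.

(** The factors of a monomial corresponding to its binary digits. *)
Definition factors a : seq ('I_r * nat) :=
  [seq (i, s) | i <- enum 'I_r, s <- bits (a i)].

Lemma size_factors a : size (factors a) = wt a.
Proof.
rewrite size_allpairs_dep sumnE big_map /wt big_enum /=.
by apply: eq_bigr => i _; rewrite size_bits.
Qed.

Lemma prod_factors (R : comNzRingType) (f : 'I_r -> R) a :
  \prod_i f i ^+ a i = \prod_(x <- factors a) f x.1 ^+ (2 ^ x.2).
Proof.
rewrite big_allpairs_dep big_enum /=; apply: eq_bigr => i _.
by rewrite -{1}(sum_bits (a i)) expr_sum.
Qed.

End Weight.

(** A monomial of weight [e] is a product of [e] factors [x ^ (2 ^ s)], so the
   weight is not raised by substitutions [t] all of whose powers
   [t ^ (2 ^ s)] have weight one. *)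
Section FilComp.
Local Open Scope ring_scope.
Variables (m r : nat) (t : m.-tuple {mpoly F2[r]}).
Hypothesis t_add : forall i s, Fil 2 (tnth t i ^+ (2 ^ s)).

Lemma Fil_comp k (p : {mpoly F2[m]}) : Fil k p -> Fil k (p \mPo t).
Proof.
move=> Fp; rewrite comp_mpolyEX big_seq; apply: Fil_sum => a ap.
apply: FilZ; rewrite comp_mpolyX prod_factors.
apply: (@FilW _ (size (factors a)).+1).
  by rewrite size_factors; apply: Fil_supp ap.
by apply: Fil_prod => x; apply: t_add.
Qed.
End FilComp.

Section FilComp2.
Local Open Scope ring_scope.

Lemma Fil_Xexp r (i : 'I_r) s : Fil 2 ('X_i ^+ (2 ^ s) : {mpoly F2[r]}).
Proof. by rewrite mpolyXn; apply: FilX; rewrite wtUn popcount_exp2. Qed.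

Lemma Fil_total_sq r k (p : {mpoly F2[r]}) : Fil k p -> Fil k (p \mPo sq_subst r).
Proof.
apply: Fil_comp => i s; rewrite tnth_mktuple frobD ?pchar_mpoly2 //.
by apply: FilD; rewrite -?exprM -?expnS; apply: Fil_Xexp.
Qed.

Lemma Fil_sym_subst (V W : vectType F2) (f : 'Hom(V, W)) k (p : symalg V) :
  Fil k p -> Fil k (symalg_map f p).
Proof.
apply: Fil_comp => i s; rewrite tnth_mktuple frob_sum ?pchar_mpoly2 //.
by apply: Fil_sum => j _; rewrite exprZn; apply/FilZ/Fil_Xexp.
Qed.

Lemma Fil_pihomog r n k (p : {mpoly F2[r]}) : Fil k p -> Fil k (pihomog mdeg n p).
Proof.
move=> Fp; rewrite pihomogE big_seq_cond; apply: Fil_sum => a /andP[ap _].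
by apply/FilZ/FilX; apply: Fil_supp ap.
Qed.

End FilComp2.

(** * Forms of low weight make up a functor of low degree *)

Section DegLt.
Local Open Scope ring_scope.

(** [h] is a polynomial map of degree [< k]: its [k]-fold differences vanish. *)
Fixpoint deg_lt (M N : zmodType) (k : nat) (h : M -> N) : Prop :=
  if k is k'.+1 then forall g, deg_lt k' (fun f => h (f + g) - h f)
  else forall f, h f = 0.

Lemma deg_lt_ext (M N : zmodType) k (h h' : M -> N) :
  h =1 h' -> deg_lt k h -> deg_lt k h'.
Proof. by move=> /funext->. Qed.

Lemma deg_lt_zero (M N : zmodType) k : deg_lt k (fun _ : M => 0 : N).
Proof. by elim: k => //= k IH g; apply: deg_lt_ext IH => f; rewrite subr0. Qed.

Lemma deg_ltD (M N : zmodType) k (h h' : M -> N) :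
  deg_lt k h -> deg_lt k h' -> deg_lt k (fun f => h f + h' f).
Proof.
elim: k h h' => [|k IH] h h' /= Hh Hh'; first by move=> f; rewrite Hh Hh' addr0.
move=> g; apply: deg_lt_ext (IH _ _ (Hh g) (Hh' g)) => f /=.
by rewrite opprD addrACA.
Qed.

Lemma deg_lt_sum (M N : zmodType) k (I : Type) (l : seq I) (P : pred I)
    (h : I -> M -> N) :
  (forall i, P i -> deg_lt k (h i)) ->
  deg_lt k (fun f => \sum_(i <- l | P i) h i f).
Proof.
move=> H; elim: l => [|i l IH].
  by apply: deg_lt_ext (deg_lt_zero _ _ k) => f; rewrite big_nil.
case: (boolP (P i)) => Pi.
  by apply: deg_lt_ext (deg_ltD (H i Pi) IH) => f; rewrite big_cons Pi.
by apply: deg_lt_ext IH => f; rewrite big_cons (negPf Pi).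
Qed.

Lemma deg_lt_comp (M M' N N' : zmodType) k (h : M -> N) (u : M' -> M) (v : N -> N') :
  {morph u : x y / x + y} -> {morph v : x y / x - y} ->
  deg_lt k h -> deg_lt k (fun f => v (h (u f))).
Proof.
move=> uD vB; elim: k h => [|k IH] h /= Hh.
  by move=> f; rewrite Hh; have := vB 0 0; rewrite !subrr.
by move=> g; apply: deg_lt_ext (IH _ (Hh (u g))) => f /=; rewrite vB uD.
Qed.

Lemma deg_lt_inj (M N N' : zmodType) k (h : M -> N) (v : N -> N') :
  {morph v : x y / x - y} -> injective v ->
  deg_lt k (fun f => v (h f)) -> deg_lt k h.
Proof.
move=> vB vI; elim: k h => [|k IH] h /= Hh.
  by move=> f; apply: vI; rewrite Hh; have := vB 0 0; rewrite !subrr.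
by move=> g; apply: IH; apply: deg_lt_ext (Hh g) => f /=; rewrite vB.
Qed.

Lemma deg_ltS (M N : zmodType) k (h : M -> N) : deg_lt k h -> deg_lt k.+1 h.
Proof.
elim: k h => [|k IH] h Hh; first by move=> g f; rewrite !Hh subrr.
by move=> g; apply: IH; apply: Hh.
Qed.

Lemma deg_ltW (M N : zmodType) k l (h : M -> N) :
  (k <= l)%N -> deg_lt k h -> deg_lt l h.
Proof.
move=> /subnK <-; elim: (l - k)%N => // n IH Hh.
exact: deg_ltS (IH Hh).
Qed.

(** Leibniz rule for differences. *)
Lemma deg_ltM_add (M : zmodType) (R : comNzRingType) k (h A : M -> R) :
  {morph A : x y / x + y} -> deg_lt k h -> deg_lt k.+1 (fun f => h f * A f).
Proof.
move=> AD; elim: k h => [|k IH] h Hh g; first by move=> f; rewrite !Hh !mul0r subrr.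
have c (h' : M -> R) : deg_lt k.+1 h' -> deg_lt k.+1 (fun f => h' f * A g).
  by apply: (deg_lt_comp (u := id) (v := fun x => x * A g)) => // x y; rewrite mulrBl.
refine (deg_lt_ext _ (deg_ltD (IH _ (Hh g)) (deg_ltD (c _ Hh) (c _ (deg_ltS (Hh g)))))).
by move=> f /=; rewrite AD; ring.
Qed.

Lemma deg_lt_prod (M : zmodType) (R : comNzRingType) (I : Type) (l : seq I)
    (A : I -> M -> R) : (forall i, {morph A i : x y / x + y}) ->
  deg_lt (size l).+1 (fun f => \prod_(i <- l) A i f).
Proof.
move=> AD; elim: l => [|i l IH].
  by move=> g f; rewrite !big_nil subrr.
by apply: deg_lt_ext (deg_ltM_add (AD i) IH) => f; rewrite big_cons mulrC.
Qed.

End DegLt.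

Section PolyLt.
Local Open Scope ring_scope.

Section PlusMaps.
Variable V : vectType F2.

Definition fst1_fun (x : plus1 V) : V := x.1.
Fact fst1_linear : linear fst1_fun. Proof. by []. Qed.
HB.instance Definition _ :=
  GRing.isLinear.Build F2 (plus1 V) V *:%R fst1_fun fst1_linear.
Definition fst1 : 'Hom(plus1 V, V) := linfun fst1_fun.
End PlusMaps.

Definition snd1_fun (V V' : vectType F2) (x : plus1 V) : plus1 V' := (0, x.2).
Fact snd1_linear V V' : linear (@snd1_fun V V').
Proof. by move=> a x y; congr pair; rewrite /= scaler0 addr0. Qed.
HB.instance Definition _ V V' :=
  GRing.isLinear.Build F2 (plus1 V) (plus1 V') *:%R (@snd1_fun V V')
    (@snd1_linear V V').

Lemma plus1_mapE (V V' : vectType F2) (f : 'Hom(V, V')) :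
  plus1_map f = (inl1 V' \o (f \o fst1 V))%VF + linfun (@snd1_fun V V').
Proof.
apply/lfunP=> x; rewrite add_lfunE !comp_lfunE !lfunE /=.
by congr pair; rewrite /= ?addr0 ?add0r.
Qed.

(** The difference functor takes one difference of the maps [f |-> F(f) x],
   in the direction of the new summand. *)
Lemma deg_lt_poly_lt k (G : functor vect) :
  (forall (V V' : vectType F2) (x : G V),
     deg_lt k (fun f : 'Hom(V, V') => fmap (f : hom vect V V') x : G V')) ->
  poly_lt k G.
Proof.
elim: k G => [|k IH] G HG.
  by move=> V x; rewrite -[x](fmap_id (C := vect)); apply: HG.
have: poly_lt k (Delta G); last by rewrite /poly_lt -iterSr.
apply: IH => V V'; apply: quoW => y.
pose h (f : 'Hom(plus1 V, plus1 V')) : G (plus1 V') :=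
  fmap (f : hom vect _ _) y.
have /(_ (linfun (@snd1_fun V V'))) Hh : deg_lt k.+1 h by apply: HG.
pose u (f : 'Hom(V, V')) := (inl1 V' \o (f \o fst1 V))%VF.
have uD : {morph u : f g / f + g}.
  by move=> f g; rewrite /u comp_lfunDl comp_lfunDr.
apply: deg_lt_ext (deg_lt_comp (v := quo_pi (image (shift_incl G) V')) uD _ Hh).
  move=> f; symmetry.
  apply: etrans (@quo_map_subproof vect (shift G) (image (shift_incl G)) V V' f y) _.
  apply/quo_piE.
  have : image (shift_incl G) V' (fmap (u f : hom vect _ _) y).
    exists (fmap (f \o fst1 V : hom vect _ _)%VF y).
    by rewrite /= -fmap_comp.
  set z := fmap (u f : hom vect _ _) y => -[w ew]; exists w.
  by rewrite [LHS]ew /z /h /u -plus1_mapE /= opprB addrC subrK.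
by move=> a b; rewrite (linB (@quo_pi_linear _ _)).
Qed.

Lemma coefD (V W : vectType F2) (f g : 'Hom(V, W)) i j :
  coef (f + g) i j = coef f i j + coef g i j.
Proof. by rewrite /coef add_lfunE /crd linearD. Qed.

(** A monomial of weight [e] is, as a function of the substitution, a product of
   [e] additive maps. *)
Lemma deg_lt_symalg_map (V W : vectType F2) k (p : symalg V) : Fil k p ->
  deg_lt k (fun f : 'Hom(V, W) => symalg_map f p).
Proof.
move=> Fp.
have E (f : 'Hom(V, W)) : symalg_map f p = \sum_(a <- msupp p | a \in msupp p)
    p@_a *: \prod_(x <- factors a) tnth (sym_subst f) x.1 ^+ (2 ^ x.2).
  rewrite /symalg_map comp_mpolyEX big_seq; apply: eq_bigr => a _.
  by rewrite comp_mpolyX prod_factors.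
apply: (deg_lt_ext (fun f => esym (E f))).
apply: deg_lt_sum => a ap.
pose h (f : 'Hom(V, W)) := \prod_(x <- factors a) tnth (sym_subst f) x.1 ^+ (2 ^ x.2).
apply: (deg_lt_comp (u := id) (h := h) (v := fun q => p@_a *: q)) => //.
  by move=> x y; rewrite scalerBr.
apply: (@deg_ltW _ _ (size (factors a)).+1).
  by rewrite size_factors (Fil_supp Fp ap).
apply: (@deg_lt_prod _ _ _ (factors a)
  (fun x f => tnth (sym_subst f) x.1 ^+ (2 ^ x.2))).
move=> x f g; rewrite !tnth_mktuple -frobD ?pchar_mpoly2 //.
congr (_ ^+ _); rewrite -big_split; apply: eq_bigr => j _ /=.
by rewrite coefD scalerDl.
Qed.

Local Obligation Tactic := idtac.

Program Definition FilSym n k : subfunctor (Sym n) :=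
  @Subfunctor vect (Sym n) (fun V => @Submod (Sym n V)
    (fun p : dhomog (rk V) F2 n => Fil k (p : {mpoly F2[rk V]})) _ _) _.
Next Obligation. by move=> n k V; apply: Fil0. Qed.
Next Obligation. by move=> n k V a p q Fp Fq; apply: FilD => //; apply: FilZ. Qed.
Next Obligation. by move=> n k V W f p Fp; apply: Fil_sym_subst. Qed.

Lemma poly_lt_FilSym n k : poly_lt k (sub_functor (FilSym n k)).
Proof.
apply: deg_lt_poly_lt => V V' x.
pose v (y : sub_functor (FilSym n k) V') : {mpoly F2[rk V']} :=
  sval_of y : dhomog (rk V') F2 n.
apply: (deg_lt_inj (v := v)); first by [].
  by move=> y z vyz; apply/val_inj/val_inj.
exact: (deg_lt_symalg_map V' (sub_ofP x)).
Qed.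

Lemma Fil_polyfilt n k V (p : dhomog (rk V) F2 n) :
  Fil k (p : {mpoly F2[rk V]}) -> polyfilt k (Sym n) V p.
Proof. by move=> Fp; apply: polyfilt_ge (@poly_lt_FilSym n k) _. Qed.

End PolyLt.

(** * Elements of low degree have low weight *)

Section Realization.
Local Open Scope ring_scope.
Variables (R : comNzRingType) (iota : {rmorphism F2 -> R}).

Definition lin_over (V : vectType F2) (rho : V -> R) :=
  forall c u v, rho (c *: u + v) = iota c * rho u + rho v.

Lemma lin_over0 (V : vectType F2) (rho : V -> R) : lin_over rho -> rho 0 = 0.
Proof.
by move=> L; have := L (-1) 0 0; rewrite scaler0 addr0 rmorphN1 mulN1r addNr.
Qed.

Lemma lin_over_sum (V : vectType F2) (rho : V -> R) (I : Type) (l : seq I)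
    (c : I -> F2) (v : I -> V) : lin_over rho ->
  rho (\sum_(i <- l) c i *: v i) = \sum_(i <- l) iota (c i) * rho (v i).
Proof.
move=> L; elim: l => [|i l IH]; first by rewrite !big_nil lin_over0.
by rewrite !big_cons L IH.
Qed.

(** Differences of a function of linear maps [V -> R] are only taken in the
   directions [phi * z] of rank one: these are what [V (+) F_2] sees. *)
Fixpoint eval_lt (V : vectType F2) k (P : (V -> R) -> R) : Prop :=
  if k is k'.+1 then forall (z : R) (phi : 'Hom(V, F2^o)),
    eval_lt k' (fun rho => P (fun v => rho v + iota (phi v) * z) - P rho)
  else forall rho, lin_over rho -> P rho = 0.

Lemma lin_overD (V : vectType F2) (rho : V -> R) z (phi : 'Hom(V, F2^o)) :
  lin_over rho -> lin_over (fun v => rho v + iota (phi v) * z).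
Proof.
by move=> L c u v; rewrite L linearP /= rmorphD rmorphM; ring.
Qed.

Lemma eval_lt_ext (V : vectType F2) k (P P' : (V -> R) -> R) :
  (forall rho, lin_over rho -> P rho = P' rho) -> eval_lt k P -> eval_lt k P'.
Proof.
elim: k P P' => [|k IH] P P' E /= H; first by move=> rho L; rewrite -E // H.
by move=> z phi; apply: IH (H z phi) => rho L; rewrite !E //; apply: lin_overD.
Qed.

Definition extend1 (V : vectType F2) (rho : V -> R) (z : R) (x : plus1 V) : R :=
  rho x.1 + iota x.2 * z.

Lemma lin_extend1 (V : vectType F2) (rho : V -> R) z :
  lin_over rho -> lin_over (extend1 rho z).
Proof. by move=> L c u v; rewrite /extend1 /= L rmorphD rmorphM; ring. Qed.

Definition graph_fun (V : vectType F2) (phi : 'Hom(V, F2^o)) (v : V) : plus1 V :=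
  (v, phi v).
Fact graph_linear V phi : linear (@graph_fun V phi).
Proof. by move=> a x y; congr pair; rewrite linearP. Qed.
HB.instance Definition _ (V : vectType F2) (phi : 'Hom(V, F2^o)) :=
  GRing.isLinear.Build F2 V (plus1 V) *:%R (@graph_fun V phi)
    (@graph_linear V phi).

(** A difference of the evaluation of [G] is an evaluation of [Delta G]. *)
Lemma poly_lt_eval k (G : functor vect) (E : forall V : vectType F2, (V -> R) -> G V -> R) :
  poly_lt k G ->
  (forall (V : vectType F2) (rho : V -> R), lin_over rho -> {morph E V rho : x y / x - y}) ->
  (forall (V W : vectType F2) (f : 'Hom(V, W)) rho x, lin_over rho ->
     E W rho (fmap (f : hom vect V W) x) = E V (fun v => rho (f v)) x) ->
  forall V x, eval_lt k (fun rho => E V rho x).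
Proof.
elim: k G E => [|k IH] G E HG EB Enat V x.
  move=> rho L; have -> : x = 0 by apply: HG.
  by have := EB V rho L 0 0; rewrite !subrr.
move=> z phi.
have {}HG : poly_lt k (Delta G) by rewrite /poly_lt -iterSr.
pose E' (V : vectType F2) (rho : V -> R) (y : Delta G V) :=
  E _ (extend1 rho z) (generic_quotient.repr y) -
  E _ (extend1 rho 0) (generic_quotient.repr y).
have E'pi (W : vectType F2) (rho : W -> R) y : lin_over rho ->
    E' W rho (quo_pi _ y) = E _ (extend1 rho z) y - E _ (extend1 rho 0) y.
  move=> L; rewrite /E'; set y' := generic_quotient.repr _.
  have [w ew] : image (shift_incl G) W (y' - y) by apply/quo_piE; rewrite quo_piK.
  have : E _ (extend1 rho z) (y' - y) = E _ (extend1 rho 0) (y' - y).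
    rewrite -ew /= !Enat; try exact: lin_extend1.
    congr (E _ _ _); apply/funext => v; rewrite lfunE /extend1 /=.
    by rewrite rmorph0 !mul0r.
  rewrite !EB; try exact: lin_extend1.
  by move/(canRL (subrK _)) => ->; ring.
have E'B (W : vectType F2) (rho : W -> R) : lin_over rho -> {morph E' W rho : x y / x - y}.
  move=> L; apply: quoW => y1; apply: quoW => y2.
  rewrite -(linB (@quo_pi_linear _ _)) !E'pi // !EB; try exact: lin_extend1.
  by ring.
have E'nat (U W : vectType F2) (f : 'Hom(U, W)) rho y : lin_over rho ->
    E' W rho (fmap (f : hom vect U W) y) = E' U (fun v => rho (f v)) y.
  move=> L; move: y; apply: quoW => y.
  have Lf : lin_over (fun v => rho (f v)) by move=> c u v; rewrite linearP L.
  rewrite E'pi //.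
  have -> : fmap (f : hom vect U W) (quo_pi (image (shift_incl G) U) y : Delta G U)
      = quo_pi _ (fmap (plus1_map f : hom vect _ _) y).
    exact: (@quo_map_subproof vect (shift G) (image (shift_incl G)) U W f y).
  rewrite E'pi // !Enat; try exact: lin_extend1.
  by congr (_ - _); congr (E _ _ _); apply/funext => v; rewrite lfunE.
have := IH _ E' HG E'B E'nat V
  (quo_pi _ (fmap (linfun (graph_fun phi) : hom vect V (plus1 V)) x)).
apply: eval_lt_ext => rho L; rewrite E'pi // !Enat; try exact: lin_extend1.
by congr (_ - _); congr (E _ _ _); apply/funext => v; rewrite lfunE /extend1 /=;
   rewrite ?mulr0 ?addr0.
Qed.

Definition crd_fun (V : vectType F2) (i : 'I_(rk V)) (v : V) : F2^o := crd i v.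
Fact crd_linear V i : linear (@crd_fun V i).
Proof. by move=> a x y; rewrite /crd_fun /crd linearP. Qed.
HB.instance Definition _ (V : vectType F2) (i : 'I_(rk V)) :=
  GRing.isLinear.Build F2 V F2^o *:%R (@crd_fun V i) (@crd_linear V i).

(** The same differences for functions of the images of the basis vectors; the
   coordinate directions are enough to see the weights. *)
Fixpoint coord_lt m k (P : ('I_m -> R) -> R) : Prop :=
  if k is k'.+1 then forall (z : R) (i : 'I_m),
    coord_lt k' (fun u => P (fun l => u l + (l == i)%:R * z) - P u)
  else forall u, P u = 0.

Lemma eval_coord_lt (V : vectType F2) k (P : (V -> R) -> R) : eval_lt k P ->
  coord_lt k (fun u => P (fun v => \sum_(i < rk V) iota (crd i v) * u i)).
Proof.
elim: k P => [|k IH] P /= H.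
  move=> u; apply: H => c v w; rewrite mulr_sumr -big_split; apply: eq_bigr => i _ /=.
  by rewrite /crd linearP rmorphD rmorphM /=; ring.
move=> z i; have := IH _ (H z (linfun (crd_fun i))).
congr (coord_lt _ _); apply/funext => u; congr (P _ - P _); apply/funext => v.
rewrite lfunE /=; symmetry; rewrite (eq_bigr (fun j =>
  iota (crd j v) * u j + iota (crd j v) * ((j == i)%:R * z))).
  rewrite big_split /=; congr (_ + _); rewrite (bigD1 i) //= eqxx mul1r.
  by rewrite big1 ?addr0 // => j /negPf->; rewrite mul0r mulr0.
by move=> j _; rewrite mulrDr.
Qed.

End Realization.

Section Converse.
Local Open Scope ring_scope.

Lemma rmorph_mmap m (S T : comNzRingType) (g : {rmorphism S -> T})
    (f : {rmorphism F2 -> S}) (h : 'I_m -> S) (p : {mpoly F2[m]}) :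
  g (mmap f h p) = mmap (g \o f) (fun i => g (h i)) p.
Proof.
rewrite /mmap rmorph_sum; apply: eq_bigr => a _; rewrite rmorphM; congr (_ * _).
by rewrite /mmap1 rmorph_prod; apply: eq_bigr => i _; rewrite rmorphXn.
Qed.

Lemma mmap_comp m n (S : comNzRingType) (f : {rmorphism F2 -> S}) (h : 'I_n -> S)
    (t : m.-tuple {mpoly F2[n]}) (p : {mpoly F2[m]}) :
  mmap f h (p \mPo t) = mmap f (fun i => mmap f h (tnth t i)) p.
Proof.
rewrite comp_mpolyEX raddf_sum /=; apply: eq_bigr => a _.
rewrite mmapZ comp_mpolyX rmorph_prod; congr (_ * _).
by apply: eq_bigr => i _; rewrite rmorphXn.
Qed.

Lemma coord_lt_coefp (R : comNzRingType) m k j (P : ('I_m -> {poly R}) -> {poly R}) :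
  coord_lt k P -> coord_lt k (fun u => (P (fun l => (u l)%:P))`_j).
Proof.
elim: k P => [|k IH] P /= H; first by move=> u; rewrite H coef0.
move=> z i; have := IH _ (H z%:P i); congr (coord_lt _ _); apply/funext => u.
rewrite coefB; congr (_ `_ _ - _); congr (P _); apply/funext => l.
by rewrite polyCD polyCM; case: (l == i).
Qed.

(** The substitution [x_i |-> x_i + t] gives the divided derivatives in [x_i]. *)
Lemma coef_mmap1 m (i : 'I_m) (b : 'X_{1..m}) j :
  (mmap1 (fun l => ('X_l : {mpoly F2[m]})%:P + (l == i)%:R * 'X) b)`_j =
  'X_[b - U_(i) *+ j] *+ 'C(b i, j).
Proof.
rewrite /mmap1 (bigD1 i) //= eqxx mul1r.
have -> : \prod_(l < m | l != i) (('X_l : {mpoly F2[m]})%:P + (l == i)%:R * 'X) ^+ b l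
    = (\prod_(l < m | l != i) 'X_l ^+ b l)%:P.
  rewrite rmorph_prod; apply: eq_bigr => l /negPf->.
  by rewrite mul0r addr0 rmorphXn.
rewrite coefMC exprDn coef_sum.
have [ji|ij] := leqP j (b i); last first.
  rewrite bin_small // mulr0n big1 ?mul0r // => k _.
  rewrite coefMn -rmorphXn coefCM coefXn.
  by case: eqP => [e|]; rewrite ?mulr0 ?mul0rn //; have := ltn_ord k; lia.
rewrite (bigD1 (Ordinal (ji : (j < (b i).+1)%N))) //= big1 => [|k /negPf kj].
  rewrite addr0 coefMn -rmorphXn coefCM coefXn eqxx mulr1.
  rewrite mulrnAl; congr (_ *+ _); rewrite [RHS]mpolyXE_id [RHS](bigD1 i) //=.
  rewrite mnmBE mulmnE mnm1E eqxx mul1n; congr (_ * _).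
  apply: eq_bigr => l li; rewrite mnmBE mulmnE mnm1E eq_sym (negPf li).
  by rewrite mul0n subn0.
rewrite coefMn -rmorphXn coefCM coefXn.
rewrite (_ : (j == k) = false) ?mulr0 ?mul0rn // eq_sym.
exact: kj.
Qed.

Lemma mmap_ext m (S : nzRingType) (f f' : F2 -> S) (h h' : 'I_m -> S) p :
  f =1 f' -> h =1 h' -> mmap f h p = mmap f' h' p.
Proof. by move=> /funext-> /funext->. Qed.

(** Weights are detected by differences: over [R[t]], the coefficient of [t^j]
   in the difference of [p] in the direction [t e_i] is a divided derivative of
   [p]; for a suitable [j] it only lowers by one the weight of a given
   monomial. *)
Lemma coord_lt_Fil m k (p : {mpoly F2[m]}) :
  (forall (R : comNzRingType) (iota : {rmorphism F2 -> R}),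
     coord_lt k (fun u => mmap iota u p)) ->
  Fil k p.
Proof.
elim: k p => [|k IH] p Hp.
  have p0 : mmap (@mpolyC m F2) (tnth [tuple ('X_i : {mpoly F2[m]}) | i < m]) p = 0.
    exact: (Hp _ (@mpolyC m F2)).
  move=> a _.
  have := comp_mpoly_id p; rewrite /comp_mpoly (_ : mmap _ _ p = 0) => [<-|].
    by rewrite mcoeff0.
  exact: p0.
move=> a ka; apply/eqP; apply: contraT => pa.
have [i ai] : exists i, (0 < a i)%N.
  apply/existsP; apply: contraT; rewrite negb_exists => /forallP a0.
  suff : wt a = 0%N by lia.
  by apply: big1 => i _; have := a0 i; case: (a i).
have [j ji [oj ej]] := odd_bin_popcount ai.
pose q := (mmap (polyC \o @mpolyC m F2)
  (fun l => ('X_l : {mpoly F2[m]})%:P + (l == i)%:R * 'X) p)`_j.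
have qE : q = \sum_(b <- msupp p) p@_b *: ('X_[b - U_(i) *+ j] *+ 'C(b i, j)).
  rewrite /q /mmap coef_sum; apply: eq_bigr => b _.
  by rewrite coefCM coef_mmap1 mul_mpolyC.
have Fq : Fil k q.
  apply: IH => R iota.
  have /(_ 'X i)/(coord_lt_coefp j) := Hp {poly R} (polyC \o iota).
  congr (coord_lt _ _); apply/funext => u.
  have -> : mmap iota u q = (map_poly (mmap iota u) (mmap (polyC \o @mpolyC m F2)
      (fun l => ('X_l : {mpoly F2[m]})%:P + (l == i)%:R * 'X) p))`_j.
    by rewrite coef_map.
  rewrite rmorph_mmap coefB [X in _ - X](_ : _ = 0).
    rewrite subr0; congr (_ `_ _).
    congr polyseq; apply: mmap_ext => x.
      by rewrite /= map_polyC /= mmapC.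
    by rewrite rmorphD rmorphM rmorph_nat /= map_polyX map_polyC /= mmapX mmap1U.
  have -> : mmap (polyC \o iota) (fun l => (u l)%:P) p = (mmap iota u p)%:P.
    by rewrite rmorph_mmap.
  by rewrite coefC; case: (j) ji.
have := Fq (a - U_(i) *+ j)%MM.
have -> : (k <= wt (a - U_(i) *+ j)%MM)%N.
  have : (wt (a - U_(i) *+ j)%MM).+1 = wt a; last by lia.
  rewrite /wt (bigD1 i) //= [RHS](bigD1 i) //= mnmBE mulmnE mnm1E eqxx mul1n.
  rewrite -ej addSn; congr (_ + _).+1; apply: eq_bigr => l li.
  by rewrite mnmBE mulmnE mnm1E eq_sym (negPf li) mul0n subn0.
move=> /(_ isT) q0; suff qa : q@_(a - U_(i) *+ j) = p@_a by rewrite -qa q0 eqxx in pa.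
rewrite qE raddf_sum /= (bigD1_seq a) ?msupp_uniq //=; last first.
  by rewrite mcoeff_msupp.
rewrite big_seq_cond big1 => [|b /andP[bp ba]].
  by rewrite addr0 mcoeffZ mcoeffMn mcoeffX eqxx F2_nat oj mulr1.
rewrite mcoeffZ mcoeffMn mcoeffX.
have [jb|bj] := leqP j (b i); last by rewrite bin_small // mulr0n mulr0.
case: eqP => [e|]; last by rewrite mul0rn mulr0.
case/eqP: ba; apply/mnmP => l; move/mnmP/(_ l): e.
rewrite !mnmBE !mulmnE !mnm1E; case: eqP => [<-|_]; lia.
Qed.


(** The differences of the evaluations of the subfunctor [p_(k-1) S^n], which
   is itself of degree [< k], detect the weights of its elements. *)
Theorem polyfilt_Sym n k V (p : dhomog (rk V) F2 n) :
  polyfilt k (Sym n) V p <-> Fil k (p : {mpoly F2[rk V]}).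
Proof.
split; last exact: Fil_polyfilt.
move=> Hp; apply: coord_lt_Fil => R iota.
pose A := polyfilt k (Sym n).
pose E (W : vectType F2) (rho : W -> R) (x : sub_functor A W) : R :=
  mmap iota (fun i => rho (bas i)) (sval_of x : dhomog (rk W) F2 n).
have EB (W : vectType F2) (rho : W -> R) : lin_over iota rho ->
    {morph E W rho : x y / x - y}.
  by move=> _ x y; apply: mmapB.
have Enat (U W : vectType F2) (f : 'Hom(U, W)) rho x : lin_over iota rho ->
    E W rho (fmap (f : hom vect U W) x) = E U (fun v => rho (f v)) x.
  move=> L; rewrite /E /= /symalg_map mmap_comp; apply: mmap_ext => // i.
  rewrite tnth_mktuple raddf_sum /= [in RHS](vec_coord (f (bas i))).
  rewrite (lin_over_sum _ _ _ L); apply: eq_bigr => j _.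
  by rewrite mmapZ mmapX mmap1U.
have := poly_lt_eval (@polyfilt_poly_lt k (Sym n)) EB Enat (mksub Hp).
move/eval_coord_lt; congr (coord_lt _ _); apply/funext => u.
apply: mmap_ext => // i; rewrite (bigD1 i) //= big1 => [|j ji].
  rewrite addr0 /crd /bas (tnth_nth 0) coord_free; last exact: basis_free (vbasisP _).
  by rewrite eqxx rmorph1 mul1r.
rewrite /crd /bas (tnth_nth 0) coord_free; last exact: basis_free (vbasisP _).
by rewrite eq_sym (negPf ji) rmorph0 mul0r.
Qed.

End Converse.

(** * Steenrod squares in coordinates *)

Section Squares.
Local Open Scope ring_scope.
Variable r : nat.
Implicit Types (a b : 'X_{1..r}) (p q : {mpoly F2[r]}).

(** The component in degree [n] of the total square: [Sq^(n - m)] on the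
   forms of degree [m]. *)
Definition sq n p := pihomog mdeg n (p \mPo sq_subst r).

Lemma sqD n p q : sq n (p + q) = sq n p + sq n q.
Proof. by rewrite /sq comp_mpolyD linearD. Qed.

Lemma sq_is0 n : sq n 0 = 0.
Proof. by rewrite /sq comp_mpoly0 linear0. Qed.

Lemma sqZ n (c : F2) p : sq n (c *: p) = c *: sq n p.
Proof. by rewrite /sq comp_mpolyZ linearZ. Qed.

Lemma sq_sum n (I : Type) (l : seq I) (P : pred I) (f : I -> {mpoly F2[r]}) :
  sq n (\sum_(i <- l | P i) f i) = \sum_(i <- l | P i) sq n (f i).
Proof. exact: (big_morph (sq n) (sqD n) (sq_is0 n)). Qed.

Lemma Fil_sq n k p : Fil k p -> Fil k (sq n p).
Proof. by move=> Fp; apply/Fil_pihomog/Fil_total_sq. Qed.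

Lemma sq_homog n p : sq n p \is n.-homog for mdeg.
Proof. exact: pihomogP. Qed.

Lemma mcoeff_pihomog n p b :
  (pihomog mdeg n p)@_b = if mdeg b == n then p@_b else 0.
Proof.
rewrite pihomogE raddf_sum /=.
under eq_bigr do rewrite mcoeffZ mcoeffX.
case: eqP => bn; last first.
  apply: big1 => a /eqP an; case: eqP => [ab|]; last by rewrite mulr0.
  by case: bn; rewrite -ab.
transitivity ((\sum_(m <- msupp p) p@_m *: 'X_[m])@_b); last by rewrite -mpolyE.
rewrite raddf_sum /= big_mkcond; apply: eq_bigr => a _.
rewrite mcoeffZ mcoeffX; case: eqP => // an.
by case: eqP => [ab|]; [case: an; rewrite ab | rewrite mulr0].
Qed.

(** The coefficient of [x ^ k] in the total square of [x ^ j]. *)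
Definition sq_bin (j k : nat) : nat := if (j <= k)%N then 'C(j, k - j) else 0.

Lemma sq_subst_exp (i : 'I_r) j N : (2 * j < N)%N ->
  ('X_i + 'X_i ^+ 2 : {mpoly F2[r]}) ^+ j =
  \sum_(k < N) (sq_bin j k)%:R *: 'X_[U_(i) *+ k].
Proof.
move=> jN; rewrite exprDn.
have -> : \sum_(l < j.+1) ('X_i : {mpoly F2[r]}) ^+ (j - l) * ('X_i ^+ 2) ^+ l *+ 'C(j, l)
    = \sum_(l < j.+1) (sq_bin j (l + j))%:R *: 'X_[U_(i) *+ (l + j)].
  apply: eq_bigr => l _; rewrite -exprM -exprD scaler_nat /sq_bin leq_addl addnK.
  by rewrite mpolyXn; congr ('X_[_ *+ _] *+ _); have := ltn_ord l; lia.
rewrite -(big_mkord xpredT (fun l => (sq_bin j (l + j))%:R *: 'X_[U_(i) *+ (l + j)])).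
rewrite -(big_mkord xpredT (fun k => (sq_bin j k)%:R *: 'X_[U_(i) *+ k])).
rewrite [RHS](big_cat_nat (n := j)) //=; last lia.
rewrite [X in _ = X + _]big_nat [X in _ = X + _]big1 ?add0r; last first.
  by move=> k /andP[_ kj]; rewrite /sq_bin leqNgt kj scale0r.
rewrite [RHS](big_cat_nat (n := (j + j.+1)%N)) //=; [|lia|lia].
rewrite [X in _ = _ + X]big_nat [X in _ = _ + X]big1 ?addr0; last first.
  by move=> k /andP[jk _]; rewrite /sq_bin bin_small ?if_same ?scale0r //; lia.
by symmetry; rewrite -{1}[j]add0n big_addn addKn.
Qed.

Lemma total_sqX_coef a b :
  ('X_[a] \mPo sq_subst r)@_b = (\prod_i sq_bin (a i) (b i))%:R.
Proof.
pose N := (2 * mdeg a + mdeg b).+1.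
have aN i : (2 * a i < N)%N.
  by rewrite /N ltnS mdegE (bigD1 i) //=; lia.
have bN i : (b i < N)%N.
  by rewrite /N ltnS [mdeg b]mdegE (bigD1 i) //=; lia.
rewrite comp_mpolyX (eq_bigr (fun i : 'I_r =>
    \sum_(k < N) (sq_bin (a i) k)%:R *: 'X_[U_(i) *+ k])); last first.
  by move=> i _; rewrite tnth_mktuple; apply: sq_subst_exp.
rewrite bigA_distr_bigA /= raddf_sum /=.
have mono (f : {ffun 'I_r -> 'I_N}) :
    \prod_i ((sq_bin (a i) (f i))%:R *: 'X_[U_(i) *+ f i]) =
    (\prod_i sq_bin (a i) (f i))%:R *: 'X_[[multinom (f i : nat) | i < r]]
      :> {mpoly F2[r]}.
  rewrite scaler_prod natr_prod; congr (_ *: _); rewrite mpolyXE_id.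
  by apply: eq_bigr => i _; rewrite mnmE -mpolyXn.
under eq_bigr do rewrite mono mcoeffZ mcoeffX.
pose f0 := [ffun i => Ordinal (bN i)].
rewrite (bigD1 f0) //= [X in _ + X]big1 => [|f /eqP ff0].
  rewrite addr0 (_ : _ == b) ?mulr1; last first.
    by apply/eqP/mnmP => i; rewrite mnmE ffunE.
  by congr (_%:R); apply: eq_bigr => i _; rewrite ffunE.
case: eqP => [e|]; last by rewrite mulr0.
case: ff0; apply/ffunP => i; rewrite ffunE; apply/val_inj => /=.
by rewrite -e mnmE.
Qed.

Lemma sq_coef n p b : mdeg b = n ->
  (sq n p)@_b = \sum_(a <- msupp p) p@_a * (\prod_i sq_bin (a i) (b i))%:R.
Proof.
move=> bn; rewrite mcoeff_pihomog bn eqxx comp_mpolyEX raddf_sum /=; apply: eq_bigr => a _.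
by rewrite mcoeffZ total_sqX_coef.
Qed.

Lemma sq_bin_le j k : odd (sq_bin j k) -> (j <= k <= 2 * j)%N.
Proof.
rewrite /sq_bin; case: leqP => // jk; case: (leqP (k - j) j) => kj; first lia.
by rewrite bin_small.
Qed.

Lemma odd_prod_sq_bin a b : odd (\prod_i sq_bin (a i) (b i)) ->
  forall i, odd (sq_bin (a i) (b i)).
Proof.
move=> + i; rewrite (bigD1 i) //= oddM => /andP[]//.
Qed.

(** Leading parts are detected at monomials [b] that have a single source [a]. *)
Lemma sq_coef1 n p a b : mdeg b = n ->
  (forall a', a' \in msupp p -> odd (\prod_i sq_bin (a' i) (b i)) -> a' = a) ->
  odd (\prod_i sq_bin (a i) (b i)) ->
  (sq n p)@_b = p@_a.
Proof.
move=> bn H oa; rewrite sq_coef //; case: (boolP (a \in msupp p)) => ap.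
  rewrite (bigD1_seq a) ?msupp_uniq //= F2_nat oa mulr1 big_seq_cond big1 ?addr0 //.
  move=> a' /andP[a'p a'a]; rewrite F2_nat; case: (boolP (odd _)) => [o|]; last by rewrite mulr0.
  by rewrite (H a' a'p o) eqxx in a'a.
rewrite (memN_msupp_eq0 ap) big_seq big1 // => a' a'p; rewrite F2_nat.
case: (boolP (odd _)) => [o|]; last by rewrite mulr0.
by have e := H a' a'p o; rewrite e (negPf ap) in a'p.
Qed.

Lemma mnm_eq_deg a b : (forall i, a i <= b i)%N -> (mdeg b <= mdeg a)%N -> a = b.
Proof.
move=> ab; rewrite !mdegE => ba; apply/mnmP => i; apply/eqP.
rewrite eqn_leq ab /= leqNgt; apply/negP => lt.
move: ba; rewrite (bigD1 i) //= [X in (_ <= X)%N](bigD1 i) //=.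
have le : (\sum_(j < r | j != i) a j <= \sum_(j < r | j != i) b j)%N by apply: leq_sum.
move=> ba; have := leq_trans ba (leq_add (leqnn _) le).
by rewrite leq_add2r leqNgt lt.
Qed.

Lemma sq_id m p : p \is m.-homog for mdeg -> sq m p = p.
Proof.
move=> Hp; apply/mpolyP => b.
case: (eqVneq (mdeg b) m) => [bm|bm]; last first.
  by rewrite mcoeff_pihomog (negPf bm) (dhomog_nemf_coeff Hp).
apply: sq_coef1 => // [a ap /odd_prod_sq_bin o|].
  apply: mnm_eq_deg => [i|]; first by case/andP: (sq_bin_le (o i)).
  by rewrite bm (dhomog_mf Hp ap).
elim/big_ind: _ => // [x y|i _]; first by rewrite oddM => -> ->.
by rewrite /sq_bin leqnn subnn bin0.
Qed.

Lemma sq_top a : sq (2 * mdeg a) 'X_[a] = 'X_[a *+ 2].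
Proof.
apply/mpolyP => b; rewrite mcoeffX.
case: (eqVneq (mdeg b) (2 * mdeg a)%N) => [ba|ba]; last first.
  by rewrite mcoeff_pihomog (negPf ba); case: eqP => // e;
     rewrite -e mdegMn mulnC eqxx in ba.
rewrite sq_coef // msuppX big_seq1 mcoeffX eqxx mul1r F2_nat; congr (_%:R).
congr nat_of_bool; apply/idP/eqP => [/odd_prod_sq_bin o|<-].
  symmetry; apply: mnm_eq_deg => [i|]; last by rewrite mdegMn mulnC ba.
  by rewrite mulmnE; case/andP: (sq_bin_le (o i)); lia.
elim/big_ind: _ => // [x y|i _]; first by rewrite oddM => -> ->.
by rewrite mulmnE /sq_bin ifT; [have -> : (a i * 2 - a i = a i)%N by [lia]; rewrite binn | lia].
Qed.

End Squares.

(** * [Sq^1] as a derivation *)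

Section Derivation.
Local Open Scope ring_scope.
Variable r : nat.
Implicit Types (a b : 'X_{1..r}) (p q : {mpoly F2[r]}).

Lemma mpoly_lin_ext (U : lmodType F2) (F G : {mpoly F2[r]} -> U) p :
  linear F -> linear G -> (forall a, a \in msupp p -> F 'X_[a] = G 'X_[a]) ->
  F p = G p.
Proof.
move=> FL GL FG; rewrite (mpolyE p) !big_seq.
pose P (x : {mpoly F2[r]}) := F x = G x.
apply: (big_ind P) => [|x y|a ap]; rewrite /P ?(lin0 FL) ?(lin0 GL) //.
  by rewrite !linD // => -> ->.
by rewrite -[_ *: _]addr0 FL GL (lin0 FL) (lin0 GL) FG.
Qed.

(** The derivation [x |-> x ^ 2], that is [Sq^1]. *)
Definition Dsq p := \sum_(j < r) 'X_j ^+ 2 * p^`M(j).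

Lemma DsqD p q : Dsq (p + q) = Dsq p + Dsq q.
Proof.
rewrite /Dsq -big_split; apply: eq_bigr => j _ /=.
by rewrite mderivD mulrDr.
Qed.

Lemma Dsq0 : Dsq 0 = 0.
Proof. by rewrite /Dsq big1 // => j _; rewrite mderiv0 mulr0. Qed.

Lemma DsqZ (c : F2) p : Dsq (c *: p) = c *: Dsq p.
Proof.
rewrite /Dsq scaler_sumr; apply: eq_bigr => j _.
by rewrite mderivZ scalerAr.
Qed.

Lemma Dsq_sum (I : Type) (l : seq I) (P : pred I) (f : I -> {mpoly F2[r]}) :
  Dsq (\sum_(i <- l | P i) f i) = \sum_(i <- l | P i) Dsq (f i).
Proof. exact: (big_morph Dsq DsqD Dsq0). Qed.

Lemma DsqX a : Dsq 'X_[a] = \sum_(j < r) (a j)%:R *: 'X_[a + U_(j)].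
Proof.
apply: eq_bigr => j _; rewrite mderivX -scalerAr.
case: (posnP (a j)) => [->|aj]; first by rewrite !scale0r.
congr (_ *: _); rewrite mpolyXn -mpolyXD; congr 'X_[_].
apply/mnmP => i; rewrite ?mulmnE ?mnmDE ?mulmnE ?mnmBE ?mnm1E.
by case: eqP => [<-|_]; lia.
Qed.

Lemma Dsq_homog n p : p \is n.-homog for mdeg -> Dsq p \is n.+1.-homog for mdeg.
Proof.
move=> Hp; rewrite (mpolyE p) Dsq_sum big_seq rpred_sum // => a ap.
rewrite DsqZ DsqX rpredZ // rpred_sum // => j _; rewrite rpredZ // dhomogX /=.
by rewrite mdegD mdeg1 (dhomog_mf Hp ap) addn1.
Qed.

(** The derivation fixing all [X_j + X_j ^ 2]. *)
Let Der p := \sum_(j < r) ('X_j + 'X_j ^+ 2) * p^`M(j).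

Let DerE p : Der p = \sum_(j < r) 'X_j * p^`M(j) + Dsq p.
Proof. by rewrite -big_split; apply: eq_bigr => j _; rewrite /= mulrDl. Qed.

Let DerM p q : Der (p * q) = Der p * q + p * Der q.
Proof.
rewrite /Der mulr_suml mulr_sumr -big_split; apply: eq_bigr => j _ /=.
by rewrite mderivM; ring.
Qed.

Let Der1 : Der 1 = 0.
Proof. by rewrite /Der big1 // => j _; rewrite mderivC mulr0. Qed.

Let DerX (f : 'I_r -> {mpoly F2[r]}) a : (forall i, Der (f i) = f i) ->
  Der (\prod_i f i ^+ a i) = (mdeg a)%:R *: \prod_i f i ^+ a i.
Proof.
move=> fE.
have fn i n : Der (f i ^+ n) = n%:R *: f i ^+ n.
  elim: n => [|n IH]; first by rewrite expr0 Der1 scale0r.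
  by rewrite exprS DerM fE IH -scalerAr mulrS scalerDl scale1r.
rewrite mdegE; elim: (index_enum _) => [|i l IH].
  by rewrite !big_nil Der1 scale0r.
by rewrite !big_cons DerM IH fn natrD scalerDl scalerAl scalerAr.
Qed.

Let Der_total_sq m p : p \is m.-homog for mdeg ->
  Der (p \mPo sq_subst r) = m%:R *: (p \mPo sq_subst r).
Proof.
move=> Hp.
apply: (@mpoly_lin_ext _ (fun q => Der (q \mPo sq_subst r))
    (fun q => m%:R *: (q \mPo sq_subst r))) => [c u v|c u v|a ap].
- rewrite /Der scaler_sumr -big_split; apply: eq_bigr => j _ /=.
  by rewrite comp_mpolyD comp_mpolyZ mderivD mderivZ mulrDr scalerAr.
- by rewrite comp_mpolyD comp_mpolyZ scalerDr !scalerA mulrC.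
rewrite comp_mpolyX -(dhomog_mf Hp ap); apply: DerX.
move=> i; rewrite tnth_mktuple /Der (bigD1 i) //= big1 => [|j ji]; last first.
  rewrite mderivD expr2 mderivM !mderivX mnm1E eq_sym (negPf ji) !scale0r.
  by rewrite mul0r mulr0 !addr0 mulr0.
rewrite addr0 mderivD expr2 mderivM !mderivX mnm1E eqxx scale1r.
rewrite (_ : U_(i) - U_(i) = 0)%MM; last by apply/mnmP => l; rewrite mnmBE mnm0E subnn.
rewrite mpolyX0 mulr1 mul1r lmod2_addxx addr0 mulr1.
by [].
Qed.

Let pihomog_euler n p :
  pihomog mdeg n (\sum_(j < r) 'X_j * p^`M(j)) = n%:R *: pihomog mdeg n p.
Proof.
have E a : \sum_(j < r) 'X_j * ('X_[a] : {mpoly F2[r]})^`M(j) = (mdeg a)%:R *: 'X_[a].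
  rewrite mdegE natr_sum scaler_suml; apply: eq_bigr => j _; rewrite mderivX -scalerAr.
  case: (posnP (a j)) => [->|aj]; first by rewrite !scale0r.
  congr (_ *: _); rewrite -mpolyXD; congr 'X_[_].
  by apply/mnmP => i; rewrite !mnmDE mnmBE !mnm1E; case: eqP => [<-|_]; lia.
apply: (@mpoly_lin_ext _
    (fun q => pihomog mdeg n (\sum_(j < r) 'X_j * q^`M(j)))
    (fun q => n%:R *: pihomog mdeg n q)) => [c u v|c u v|a ap].
- rewrite -linearZ -linearD /=; congr (pihomog _ _ _).
  rewrite scaler_sumr -big_split; apply: eq_bigr => j _ /=.
  by rewrite mderivD mderivZ mulrDr scalerAr.
- by rewrite linearD linearZ scalerDr !scalerA mulrC.
rewrite E linearZ /= pihomogX.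
by case: eqP => [->|_] //; rewrite !scaler0.
Qed.

Let pihomog_Dsq n p : pihomog mdeg n.+1 (Dsq p) = Dsq (pihomog mdeg n p).
Proof.
apply: (@mpoly_lin_ext _ (fun q => pihomog mdeg n.+1 (Dsq q))
    (fun q => Dsq (pihomog mdeg n q))) => [c u v|c u v|a ap].
- by rewrite DsqD DsqZ linearD linearZ.
- by rewrite linearD linearZ /= DsqD DsqZ.
rewrite pihomogX; case: eqP => [<-|an].
  by apply: pihomog_dE; apply: Dsq_homog; rewrite dhomogX.
rewrite Dsq0; rewrite (pihomog_ne0 (d := (mdeg a).+1)) //; first by apply/eqP => -[].
by apply: Dsq_homog; rewrite dhomogX.
Qed.

(** [Sq^1 Sq^k = (k + 1) Sq^(k+1)]: the Euler field and [Sq^1] add up to the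
   derivation that fixes [x + x ^ 2] for all [x] of degree one, and which thus
   multiplies the total square of a form by the degree of the form. *)
Lemma Dsq_sq m n p : p \is m.-homog for mdeg ->
  Dsq (sq n p) = (n.+1 + m)%:R *: sq n.+1 p.
Proof.
move=> Hp; have := congr1 (pihomog mdeg n.+1) (Der_total_sq Hp).
rewrite DerE linearD /= pihomog_euler pihomog_Dsq linearZ /= -!/(sq _ _) => e.
by rewrite natrD scalerDl -e addrA lmod2_addxx add0r.
Qed.

Lemma Dsq_sq1 m p : p \is m.-homog for mdeg -> Dsq p = sq m.+1 p.
Proof.
move=> Hp; have := Dsq_sq m Hp; rewrite sq_id // => ->.
by rewrite F2_nat addSn addnn /= odd_double scale1r.
Qed.

Lemma Dsq_Dsq m p : p \is m.-homog for mdeg -> Dsq (Dsq p) = 0.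
Proof.
move=> Hp; rewrite [in X in Dsq X](Dsq_sq1 Hp) (Dsq_sq _ Hp).
by rewrite F2_nat !addSn addnn /= odd_double scale0r.
Qed.

Lemma sq3 m p : p \is m.-homog for mdeg -> sq m.+3 p = Dsq (sq m.+2 p).
Proof.
move=> Hp; rewrite (Dsq_sq _ Hp).
by rewrite F2_nat !addSn addnn /= odd_double scale1r.
Qed.

Lemma Fil_Dsq k p : Fil k p -> Fil k (Dsq p).
Proof.
move=> Fp; rewrite (mpolyE p) Dsq_sum big_seq; apply: Fil_sum => a ap.
rewrite DsqZ; apply: FilZ; apply: (@FilW _ (wt a).+1); first exact: Fil_supp Fp ap.
rewrite (@Dsq_sq1 (mdeg a)) ?dhomogX //.
by apply: Fil_sq; apply: FilX.
Qed.

End Derivation.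

(** * Exactness of [Sq^1] on leading parts *)

Section Homotopy.
Local Open Scope ring_scope.
Variable r : nat.
Implicit Types (a b : 'X_{1..r}) (p q : {mpoly F2[r]}).

Lemma popcountS1 n : (n %% 4)%N = 1%N -> popcount n.+1 = popcount n.
Proof.
move=> n1; rewrite [RHS]popcountE [LHS]popcountE (popcountE n.+1./2) (popcountE n./2).
have -> : n.+1./2./2 = n./2./2 by lia.
lia.
Qed.

Lemma popcountS3 n : (n %% 4)%N = 3%N -> (popcount n.+1 < popcount n)%N.
Proof.
move=> n3; rewrite [X in (_ < X)%N]popcountE popcountE (popcountE n.+1./2) (popcountE n./2).
have -> : n.+1./2./2 = (n./2./2 + 1)%N by lia.
have : (popcount (n./2./2 + 1) <= popcount n./2./2 + 1)%N by apply: popcountD.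
lia.
Qed.

Lemma wt_addU a j : (wt (a + U_(j))%MM + popcount (a j) = wt a + popcount (a j).+1)%N.
Proof.
rewrite /wt (bigD1 j) //= [X in _ = (X + _)%N](bigD1 j) //=.
rewrite mnmDE mnm1E eqxx addn1 (eq_bigr (fun i => popcount (a i))).
  by rewrite addnC addnCA addnC.
by move=> i ij; rewrite mnmDE mnm1E eq_sym (negPf ij) addn0.
Qed.

Lemma wt_addU1 a j : (a j %% 4)%N = 1%N -> wt (a + U_(j))%MM = wt a.
Proof. by move=> aj; have := wt_addU a j; rewrite popcountS1 //; lia. Qed.

Lemma wt_addU3 a j : (a j %% 4)%N = 3%N -> (wt (a + U_(j))%MM < wt a)%N.
Proof. by move=> aj; have := wt_addU a j; have := popcountS3 aj; lia. Qed.

Lemma mnm_subUK a j : (0 < a j)%N -> (a - U_(j) + U_(j))%MM = a.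
Proof.
by move=> aj; apply/mnmP => i; rewrite mnmDE mnmBE mnm1E; case: eqP => [<-|_]; lia.
Qed.

(** The leading part of [Sq^1] sends [x ^ (4 k + 1)] to [x ^ (4 k + 2)] and
   kills the other powers. A variable is active when its power is one of these
   two; the set of active variables, and so the first one, is the same for a
   monomial and for all the terms of its image. *)
Definition active a (i : 'I_r) := ((a i %% 4)%N == 1%N) || ((a i %% 4)%N == 2%N).
Definition pivot a := [pick i | active a i].

(** The inverse of the differential on the pivot. *)
Definition contract a : {mpoly F2[r]} :=
  if pivot a is Some i then if (a i %% 4)%N == 2%N then 'X_[a - U_(i)] else 0 else 0.

Lemma pivotP a i : pivot a = Some i -> active a i.
Proof. by rewrite /pivot; case: pickP => // j aj [<-]. Qed.

Lemma pivot_addU a j : (a j %% 4)%N = 1%N -> pivot (a + U_(j))%MM = pivot a.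
Proof.
move=> aj; apply: eq_pick => i; rewrite /active mnmDE mnm1E.
case: (j =P i) => [<-|_]; last by rewrite addn0.
by rewrite -modnDml aj.
Qed.

Lemma wt_subU a i : (a i %% 4)%N = 2%N -> wt (a - U_(i))%MM = wt a.
Proof.
move=> ai; rewrite -[in RHS](@mnm_subUK a i); last by case: (a i) ai.
by rewrite wt_addU1 // mnmBE mnm1E eqxx; lia.
Qed.

Lemma Fil_contract a : Fil (wt a).+1 (contract a).
Proof.
rewrite /contract; case E: (pivot a) => [i|]; last exact: Fil0.
case: eqP => [ai|_]; last exact: Fil0.
by apply: FilX; rewrite wt_subU.
Qed.

Lemma contract_homog a : contract a \is (mdeg a).-1.-homog for mdeg.
Proof.
rewrite /contract; case E: (pivot a) => [i|]; last exact: rpred0.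
case: eqP => [ai|_]; last exact: rpred0.
rewrite dhomogX /= -[X in _ == (mdeg X).-1](@mnm_subUK a i); last by case: (a i) ai.
by rewrite mdegD mdeg1 addn1.
Qed.

(** The homotopy formula, up to lower weight: the terms of [Sq^1] on an exponent
   that is 3 modulo 4 lose a binary digit. *)
Lemma homotopy_mon a e : (wt a <= e)%N ->
  Fil e ('X_[a] - Dsq (contract a) - \sum_(j < r) (a j)%:R *: contract (a + U_(j))
    - (if pivot a is None then 'X_[a] else 0)).
Proof.
move=> ae.
have low j : (a j %% 4)%N = 3%N -> Fil e (contract (a + U_(j))%MM).
  by move=> aj; apply: (FilW _ (@Fil_contract _)); have := wt_addU3 aj; lia.
case E: (pivot a) => [i|]; last first.
  rewrite /contract E Dsq0 subr0 addrAC subrr add0r lmod2_opp; apply: Fil_sum => j _.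
  move: E; rewrite {1}/pivot; case: pickP => // /(_ j) aj _; rewrite F2_nat.
  case: (boolP (odd (a j))) => [oj|_]; last by rewrite scale0r; apply: Fil0.
  apply/FilZ/low; move: aj oj; rewrite /active; lia.
rewrite subr0; have := pivotP E.
have aux j : j != i -> odd (a j) -> (a j %% 4)%N <> 3%N ->
    [/\ (a j %% 4)%N = 1%N, pivot (a + U_(j))%MM = Some i & (a + U_(j))%MM i = a i].
  move=> ji oj aj3; have aj : (a j %% 4)%N = 1%N by lia.
  by rewrite pivot_addU // mnmDE mnm1E (negPf ji) addn0.
rewrite /active => /orP[/eqP ai|/eqP ai].
  rewrite {1}/contract E ai /= Dsq0 subr0 (bigD1 i) //=.
  rewrite F2_nat (_ : odd (a i)); last lia.
  rewrite scale1r {1}/contract pivot_addU // E mnmDE mnm1E eqxx.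
  rewrite ifT; last lia.
  rewrite addmK opprD addrA subrr add0r lmod2_opp; apply: Fil_sum => j ji.
  rewrite F2_nat; case: (boolP (odd (a j))) => [oj|_]; last by rewrite scale0r; apply: Fil0.
  case: (eqVneq ((a j %% 4)%N) 3%N) => [aj|/eqP aj3]; first exact/FilZ/low.
  have [aj pj aji] := aux j ji oj aj3.
  by rewrite /contract pj aji ai /= scaler0; apply: Fil0.
have ai0 : (0 < a i)%N by case: (a i) ai.
rewrite {1}/contract E ai /= DsqX (bigD1 i) //= mnm_subUK //.
rewrite mnmBE mnm1E eqxx F2_nat (_ : odd (a i - 1)); last lia.
rewrite scale1r opprD addrA subrr add0r lmod2_opp [X in _ - X](bigD1 i) //=.
rewrite [(a i)%:R]F2_nat (_ : odd (a i) = false); last lia.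
rewrite scale0r add0r lmod2_opp -big_split; apply: Fil_sum => j ji /=.
rewrite mnmBE mnm1E eq_sym (negPf ji) subn0 F2_nat.
case: (boolP (odd (a j))) => [oj|_]; last by rewrite !scale0r addr0; apply: Fil0.
rewrite !scale1r.
case: (eqVneq ((a j %% 4)%N) 3%N) => [aj|/eqP aj3].
  apply: FilD; last exact: low.
  apply: FilX; apply: leq_trans (wt_addU3 _) _; last by rewrite wt_subU.
  by rewrite mnmBE mnm1E eq_sym (negPf ji) subn0.
have [aj pj aji] := aux j ji oj aj3.
rewrite {1}/contract pj aji ai /= (_ : (a + U_(j) - U_(i)) = (a - U_(i) + U_(j)))%MM.
  by rewrite lmod2_addxx; apply: Fil0.
apply/mnmP => l; rewrite !mnmBE !mnmDE !mnmBE !mnm1E.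
by case: (eqVneq i l) ai0 => [<-|]; lia.
Qed.

(** The linear extension of [contract] to the degrees below [k]; a bound makes it
   linear without a choice of supports. *)
Definition contraction k p : {mpoly F2[r]} :=
  \sum_(a : 'X_{1..r < k}) p@_a *: contract a.

Lemma contraction_linear k : linear (contraction k).
Proof.
move=> c u v; rewrite scaler_sumr -big_split; apply: eq_bigr => a _ /=.
by rewrite mcoeffD mcoeffZ scalerDl scalerA.
Qed.

Lemma contractionZ k (c : F2) p : contraction k (c *: p) = c *: contraction k p.
Proof.
have L := contraction_linear k.
by rewrite -[c *: p]addr0 L (lin0 L) addr0.
Qed.

Lemma contraction_sum k (I : Type) (l : seq I) (P : pred I) (f : I -> {mpoly F2[r]}) :
  contraction k (\sum_(i <- l | P i) f i) = \sum_(i <- l | P i) contraction k (f i).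
Proof.
have L := contraction_linear k.
exact: (big_morph (contraction k) (linD L) (lin0 L)).
Qed.

Lemma contractionX k a : (mdeg a < k)%N -> contraction k 'X_[a] = contract a.
Proof.
move=> ak; rewrite /contraction (bigD1 (BMultinom ak)) //= mcoeffX eqxx scale1r.
rewrite big1 ?addr0 // => b ba; rewrite mcoeffX.
by case: eqP => [e|]; rewrite ?scale0r //; case/eqP: ba; apply/val_inj.
Qed.

Lemma Fil_contraction k l p : Fil k p -> Fil k (contraction l p).
Proof.
move=> Fp; apply: Fil_sum => a _; case: (ltnP (wt a) k) => ak.
  by apply: FilZ; apply: (FilW _ (@Fil_contract _)).
by rewrite Fp // scale0r; apply: Fil0.
Qed.

Lemma contraction_homog m k p : p \is m.-homog for mdeg ->
  contraction k p \is m.-1.-homog for mdeg.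
Proof.
move=> Hp; apply: rpred_sum => a _; case: (eqVneq (mdeg a) m) => [<-|am].
  by apply: rpredZ; apply: contract_homog.
by rewrite (dhomog_nemf_coeff Hp) // scale0r rpred0.
Qed.

(** On the leading parts, [Sq^1] is the differential of a tensor product, over
   the variables, of complexes whose homology is spanned by the powers
   [x ^ (4 k)] and [x ^ (4 k + 3)]. *)
Lemma Dsq_exact m e p : p \is m.-homog for mdeg -> Fil e.+1 p -> Fil e (Dsq p) ->
  exists2 u, u \is m.-1.-homog for mdeg /\ Fil e.+1 u &
    Fil e (p - Dsq u - \sum_(a <- msupp p | pivot a == None) p@_a *: 'X_[a]).
Proof.
move=> Hp Fp FDp; pose k := m.+2; exists (contraction k p).
  by split; [apply: contraction_homog | apply: Fil_contraction].
suff H : Fil e (p - Dsq (contraction k p) - contraction k (Dsq p)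
    - \sum_(a <- msupp p | pivot a == None) p@_a *: 'X_[a]).
  have := FilD H (Fil_contraction k FDp); congr (Fil _ _).
  by rewrite addrAC; congr (_ - _); rewrite subrK.
have -> : p - Dsq (contraction k p) - contraction k (Dsq p)
    - \sum_(a <- msupp p | pivot a == None) p@_a *: 'X_[a]
  = \sum_(a <- msupp p) p@_a *: ('X_[a] - Dsq (contract a)
      - \sum_(j < r) (a j)%:R *: contract (a + U_(j))
      - (if pivot a is None then 'X_[a] else 0)).
  under [RHS]eq_bigr do rewrite !scalerBr.
  rewrite !sumrB; congr (_ - _); last first.
    by rewrite big_mkcond; apply: eq_bigr => a _; case: (pivot a); rewrite ?scaler0.
  congr (_ - _ - _).
  - exact: mpolyE.
  - rewrite {1}(mpolyE p) contraction_sum Dsq_sum !big_seq; apply: eq_bigr => a ap.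
    by rewrite contractionZ DsqZ contractionX // (dhomog_mf Hp ap) /k; lia.
  - rewrite {1}(mpolyE p) Dsq_sum contraction_sum !big_seq; apply: eq_bigr => a ap.
    rewrite DsqZ DsqX contractionZ contraction_sum; congr (_ *: _).
    apply: eq_bigr => j _; rewrite contractionZ contractionX //.
    by rewrite mdegD mdeg1 (dhomog_mf Hp ap) /k; lia.
rewrite big_seq; apply: Fil_sum => a ap; apply: FilZ; apply: homotopy_mon.
by have := Fil_supp Fp ap.
Qed.

End Homotopy.

(** * Hit forms *)

Section Hits.
Local Open Scope ring_scope.
Variable r : nat.
Implicit Types (a b : 'X_{1..r}) (p q x : {mpoly F2[r]}).

(** The weight of a form is at most its degree, so [Hit n n] are all the hit forms
   of degree [n]; [Hit d.+1 n] are the ones that vanish in [frakQ^n_d]. *)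
Definition Hit k n x := exists y : nat -> {mpoly F2[r]},
  [/\ forall i, y i \is i.-homog for mdeg, forall i, Fil k (y i)
    & x = \sum_(i < n) sq n (y i)].

Lemma Hit0 k n : Hit k n 0.
Proof.
exists (fun=> 0); split=> [i|i|]; [exact: rpred0|exact: Fil0|].
by rewrite big1 // => i _; rewrite sq_is0.
Qed.

Lemma HitD k n x x' : Hit k n x -> Hit k n x' -> Hit k n (x + x').
Proof.
move=> [y [Hy Fy ->]] [y' [Hy' Fy' ->]]; exists (fun i => y i + y' i); split=> [i|i|].
- exact: rpredD.
- exact: FilD.
by rewrite -big_split; apply: eq_bigr => i _; rewrite sqD.
Qed.

Lemma HitZ k n (c : F2) x : Hit k n x -> Hit k n (c *: x).
Proof. by case: (F2_cases c) => ->; rewrite ?scale0r ?scale1r // => _; apply: Hit0. Qed.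

Lemma Hit_sum k n (I : Type) (l : seq I) (P : pred I) (f : I -> {mpoly F2[r]}) :
  (forall i, P i -> Hit k n (f i)) -> Hit k n (\sum_(i <- l | P i) f i).
Proof. by move=> H; elim/big_ind: _ => //; [exact: Hit0 | exact: HitD]. Qed.

Lemma HitW k l n x : (k <= l)%N -> Hit k n x -> Hit l n x.
Proof. by move=> kl [y [Hy Fy e]]; exists y; split=> // i; apply: FilW (Fy i). Qed.

Lemma Hit_sq k m n p : (m < n)%N -> p \is m.-homog for mdeg -> Fil k p ->
  Hit k n (sq n p).
Proof.
move=> mn Hp Fp; exists (fun i => if i == m then p else 0); split=> [i|i|].
- by case: eqP => [->|_] //; apply: rpred0.
- by case: eqP => _ //; apply: Fil0.
rewrite (bigD1 (Ordinal mn)) //= eqxx big1 ?addr0 // => i.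
by rewrite -val_eqE /= => /negPf->; rewrite sq_is0.
Qed.

Lemma Hit_Dsq k n p : p \is n.-homog for mdeg -> Fil k p -> Hit k n.+1 (Dsq p).
Proof. by move=> Hp Fp; rewrite (Dsq_sq1 Hp); apply: (Hit_sq _ Hp Fp). Qed.

Lemma Hit_homog k n x : Hit k n x -> x \is n.-homog for mdeg.
Proof. by move=> [y [_ _ ->]]; apply: rpred_sum => i _; apply: sq_homog. Qed.

Lemma Hit_Fil k n x : Hit k n x -> Fil k x.
Proof. by move=> [y [_ Fy ->]]; apply: Fil_sum => i _; apply: Fil_sq. Qed.

(** * Weights and degrees of exponents *)

Lemma popcount_mdeg a : (popcount (mdeg a) <= wt a)%N.
Proof.
rewrite mdegE /wt; elim/big_ind2: _ => // [m m' n n' h h'].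
exact: leq_trans (popcountD _ _) (leq_add h h').
Qed.

Lemma wt_sub_odd a i : odd (a i) -> (wt (a - U_(i))%MM).+1 = wt a.
Proof.
move=> ai; have ai0 : (0 < a i)%N by case: (a i) ai.
have := wt_addU (a - U_(i))%MM i; rewrite mnm_subUK // mnmBE mnm1E eqxx.
rewrite subn1 prednK // (popcountE (a i)) ai (popcountE (a i).-1).
have -> : (a i).-1./2 = (a i)./2 by lia.
have -> : odd (a i).-1 = false by lia.
lia.
Qed.

Lemma mdeg_subU a i : (0 < a i)%N -> (mdeg (a - U_(i))%MM).+1 = mdeg a.
Proof. by move=> ai; rewrite -{2}(mnm_subUK ai) mdegD mdeg1 addn1. Qed.

Lemma odd_mdeg a : odd (mdeg a) -> exists i, odd (a i).
Proof.
move=> o; apply/existsP; apply: contraLR o; rewrite negb_exists => /forallP H.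
by rewrite mdegE; elim/big_ind: _ => // x y /negPf ox /negPf oy; rewrite oddD ox oy.
Qed.

Lemma wt_off a b i : (forall j, j != i -> a j = b j) ->
  (wt a + popcount (b i) = wt b + popcount (a i))%N.
Proof.
move=> ab; rewrite /wt (bigD1 i) //= [X in _ = (X + _)%N](bigD1 i) //=.
rewrite (eq_bigr (fun j => popcount (b j))) => [|j /ab->//].
by rewrite addnC addnCA addnC -addnA; congr addn; rewrite addnC.
Qed.

Lemma mdeg_off a b i : (forall j, j != i -> a j = b j) ->
  (mdeg a + b i = mdeg b + a i)%N.
Proof.
move=> ab; rewrite !mdegE (bigD1 i) //= [X in _ = (X + _)%N](bigD1 i) //=.
rewrite (eq_bigr (fun j => b j)) => [|j /ab->//].
by rewrite addnC addnCA addnC -addnA; congr addn; rewrite addnC.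
Qed.

Lemma sq_coef0 n p b : mdeg b = n ->
  (forall a, a \in msupp p -> ~~ odd (\prod_i sq_bin (a i) (b i))) ->
  (sq n p)@_b = 0.
Proof.
move=> bn H; rewrite sq_coef // big_seq big1 // => a ap.
by rewrite F2_nat (negPf (H a ap)) mulr0.
Qed.

(** * Vanishing of leading parts *)

Lemma pivot_None_mod a i : pivot a = None ->
  (3 * popcount (a i) <= 2 * a i)%N.
Proof.
rewrite /pivot; case: pickP => // /(_ i) /negbT; rewrite /active negb_or => /andP[a1 _] _.
have := popcount_bound (a i); case: (eqVneq (a i) 1%N) => [e|]; first by rewrite e in a1.
lia.
Qed.

(** In each variable the exponent is 0 or 3 modulo 4, so never 1. *)
Lemma pivot_None_bound a : pivot a = None -> (3 * wt a <= 2 * mdeg a)%N.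
Proof.
move=> pa; rewrite mdegE /wt !big_distrr; apply: leq_sum => i _.
exact: pivot_None_mod.
Qed.

Lemma pivot_None_eq a : pivot a = None -> (2 * mdeg a <= 3 * wt a)%N ->
  forall i, a i = 0%N \/ a i = 3%N.
Proof.
move=> pa ma i; case: (posnP (a i)) => [|ai]; [by left|right].
have ai1 : (1 < a i)%N.
  case: (ltngtP (a i) 1%N) => //; first lia.
  by move=> e; have := pivot_None_mod i pa; rewrite e.
apply: popcount_bound_eq => //.
have rest : (3 * \sum_(j < r | j != i) popcount (a j) <= 2 * \sum_(j < r | j != i) a j)%N.
  by rewrite !big_distrr; apply: leq_sum => j _; apply: pivot_None_mod.
move: ma; rewrite mdegE /wt (bigD1 i) //= [X in (_ <= 3 * X)%N](bigD1 i) //= !mulnDr.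
by move=> ma; have := leq_trans ma (leq_add (leqnn _) rest); rewrite leq_add2r.
Qed.

Lemma Dsq_exact_high m e p : (2 * m < 3 * e)%N -> p \is m.-homog for mdeg ->
  Fil e.+1 p -> Fil e (Dsq p) ->
  exists2 u, u \is m.-1.-homog for mdeg & Fil e (p - Dsq u).
Proof.
move=> me Hp Fp FDp; have [u [Hu Fu] H] := Dsq_exact Hp Fp FDp; exists u => //.
have := FilD H (_ : Fil e (\sum_(a <- msupp p | pivot a == None) p@_a *: 'X_[a])).
rewrite subrK; apply; rewrite big_seq_cond; apply: Fil_sum => a /andP[ap /eqP pa].
apply/FilZ/FilX; have := pivot_None_bound pa; rewrite (dhomog_mf Hp ap); lia.
Qed.

(** The monomial [x_1 ... x_m] is the only source of the one obtained by squaring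
   three of its variables. *)
Lemma sq3_multilinear m p : (2 < m)%N -> p \is m.-homog for mdeg ->
  Fil m (sq m.+3 p) -> Fil m p.
Proof.
move=> m2 Hp Fs a ma.
case: (eqVneq (mdeg a) m) => [am|]; last exact: dhomog_nemf_coeff.
have a1 i : (a i <= 1)%N.
  have le j : (popcount (a j) <= a j)%N.
    have := popcount_bound (a j); case: (a j) => [|[|n]] //; lia.
  rewrite leqNgt; apply/negP => ai.
  have lt : (popcount (a i) < a i)%N.
    by have := popcount_bound (a i); case: (a i) ai => [|[|n]] //; lia.
  suff : (wt a < mdeg a)%N by rewrite am ltnNge ma.
  rewrite mdegE /wt (bigD1 i) //= [X in (_ < X)%N](bigD1 i) //= -addSn.
  by apply: leq_add => //; apply: leq_sum.
pose S := take 3 [seq i <- enum 'I_r | a i == 1%N].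
have mS : m = size [seq i <- enum 'I_r | a i == 1%N].
  rewrite size_filter -sum1_count big_mkcond -am mdegE big_enum /=.
  by apply: eq_bigr => i _; have := a1 i; case: (a i) => [|[|]].
have S3 : size S = 3 by rewrite size_takel -?mS.
have Su : uniq S by rewrite take_uniq // filter_uniq // enum_uniq.
have Sa i : i \in S -> a i = 1%N.
  by move/mem_take; rewrite mem_filter => /andP[/eqP].
pose b := [multinom (a i + (i \in S))%N | i < r].
have bE i : b i = (a i + (i \in S))%N by rewrite mnmE.
have bm : mdeg b = m.+3.
  rewrite mdegE (eq_bigr (fun i => (a i + (i \in S))%N)) // big_split /= -mdegE am.
  rewrite -addn3; congr addn; rewrite -[RHS]S3 -(card_uniqP Su) -sum1_card.
  by rewrite [RHS]big_mkcond; apply: eq_bigr => i _; case: (i \in S).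
have b0 : (sq m.+3 p)@_b = 0.
  apply: Fs; apply: leq_trans ma _; apply: leq_sum => i _; rewrite bE.
  by case: (boolP (i \in S)) => [/Sa->|] //; rewrite addn0.
rewrite -b0; symmetry; apply: sq_coef1 => // [a' a'p /odd_prod_sq_bin o|].
  symmetry; apply: mnm_eq_deg => [i|]; last by rewrite (dhomog_mf Hp a'p) am.
  by have := sq_bin_le (o i); rewrite bE; have := a1 i; case: (i \in S) (@Sa i) => [->|]; lia.
elim/big_ind: _ => // [u v|i _]; first by rewrite oddM => -> ->.
rewrite bE /sq_bin leq_addr addKn; case: (boolP (i \in S)) => [/Sa->|] //.
by rewrite bin0.
Qed.

End Hits.

(** * Lowering the weight of hits *)

Lemma popcount_small : ((popcount 1 = 1) * (popcount 2 = 1) * (popcount 3 = 2) *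
  (popcount 4 = 1) * (popcount 5 = 2) * (popcount 6 = 2) * (popcount 7 = 3))%type.
Proof. by []. Qed.

Section Core.
Local Open Scope ring_scope.
Variable r : nat.
Implicit Types (a b : 'X_{1..r}) (p q x : {mpoly F2[r]}).

(** A form [p] of degree [m] without multilinear part has leading part
   [x_1 ... x_(m-2) z ^ 2]. The monomial [x_1 ... x_(m-2) z ^ 4] occurs in
   [Sq^2 p] and in no other square of low weight. *)
Lemma sq2_leading m (y : nat -> {mpoly F2[r]}) :
  (forall i, y i \is i.-homog for mdeg) -> (forall i, Fil m (y i)) ->
  Fil m.-1 (\sum_(i < m.+2) sq m.+2 (y i)) -> Fil m.-1 (y m).
Proof.
move=> Hy Fy Fs a ma.
case: (eqVneq (mdeg a) m) => [am|am]; last exact: dhomog_nemf_coeff (Hy m) _.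
case: (leqP m (wt a)) => [ma'|am']; first exact: Fy.
have le j : (popcount (a j) <= a j)%N.
  have := popcount_bound (a j); case: (a j) => [|[|n]] //; lia.
have [i ai] : exists i, (popcount (a i) < a i)%N.
  apply/existsP; apply: contraT; rewrite negb_exists => /forallP H.
  suff : (mdeg a <= wt a)%N by rewrite am; lia.
  by rewrite mdegE /wt; apply: leq_sum => j _; have := H j; rewrite -leqNgt.
have wta : (mdeg a <= (wt a).+1)%N by rewrite am; lia.
have aj j : j != i -> (a j <= 1)%N.
  move=> ji; rewrite leqNgt; apply/negP => aj.
  have lt : (popcount (a j) < a j)%N.
    by have := popcount_bound (a j); case: (a j) aj => [|[|n]] //; lia.
  suff : ((wt a).+1 < mdeg a)%N by rewrite ltnNge wta.
  rewrite mdegE /wt (bigD1 i) //= (bigD1 j) //=.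
  rewrite [X in (_ < X)%N](bigD1 i) //= [X in (_ < _ + X)%N](bigD1 j) //=.
  have rest : (\sum_(l < r | (l != i) && (l != j)) popcount (a l) <=
      \sum_(l < r | (l != i) && (l != j)) a l)%N by apply: leq_sum.
  by have := leq_add ai (leq_add lt rest); rewrite !addSn addnS.
have ai3 : (a i = 2 \/ a i = 3)%N.
  have rest : (\sum_(j < r | j != i) popcount (a j) <= \sum_(j < r | j != i) a j)%N.
    exact: leq_sum.
  move: wta; rewrite mdegE /wt (bigD1 i) //= [X in (_ <= X.+1)%N](bigD1 i) //= => wta.
  have := leq_trans wta (_ : _ <= ((popcount (a i)).+1 + \sum_(j < r | j != i) a j))%N.
  rewrite leq_add2r -addSn leq_add2l => /(_ rest) h.
  have := popcount_bound (a i); case: (a i) ai h => [|[|[|[|n]]]] // _ h _.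
  - by left.
  - by right.
  - by exfalso; move: h; rewrite ltnS; have := popcount_bound n.+4; lia.
pose b := (a + U_(i) *+ 2)%MM.
have bi : b i = (a i).+2 by rewrite /b mnmDE mulmnE mnm1E eqxx mul1n addn2.
have bj j : j != i -> b j = a j.
  by move=> ji; rewrite /b mnmDE mulmnE mnm1E eq_sym (negPf ji) mul0n addn0.
have bm : mdeg b = m.+2 by rewrite mdegD mdegMn mdeg1 am addn2.
have := Fs b; rewrite raddf_sum /=.
have -> : (m.-1 <= wt b)%N.
  have := wt_off bj; rewrite bi.
  by case: ai3 => ->; rewrite !popcount_small; lia.
(* only the exponent of i may change: all the others are 0 or 1 in b *)
have src k a' : a' \in msupp (y k) -> odd (\prod_j sq_bin (a' j) (b j)) ->
    [/\ forall j, j != i -> a' j = a j, (a' i + m = a i + k)%N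
      & odd (sq_bin (a' i) (b i))].
  move=> a'p /odd_prod_sq_bin o.
  have ej j : j != i -> a' j = a j.
    by move=> ji; have := sq_bin_le (o j); rewrite bj //; have := aj j ji; lia.
  split=> //; have := mdeg_off ej.
  by rewrite am (dhomog_mf (Hy k) a'p); lia.
move=> /(_ isT); rewrite (bigD1 (Ordinal (leqnSn m.+1))) //= big1 => [|k km].
  rewrite addr0 => <-; symmetry; apply: sq_coef1 => // [a' a'p o|].
    have [ej ei _] := src _ _ a'p o; apply/mnmP => j.
    by case: (eqVneq j i) => [->|]; [lia|exact: ej].
  elim/big_ind: _ => // [u v|j _]; first by rewrite oddM => -> ->.
  case: (eqVneq j i) => [->|ji]; last by rewrite bj // /sq_bin leqnn subnn bin0.
  by rewrite bi; case: ai3 => ->.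
apply: sq_coef0 => // a' a'p; apply/negP => o.
have [ej ei oi] := src _ _ a'p o.
have {}km : (k : nat) <> m by move=> e; case/eqP: km; apply/val_inj.
have := sq_bin_le oi; rewrite bi; have := ltn_ord k => km2.
case: (ltngtP k m) => // mk; first by case: ai3 => ai2; rewrite ai2 in ei *; lia.
have {}ei : a' i = (a i).+1 by lia.
move=> _; move: oi; rewrite bi ei; case: ai3 => ai2; rewrite ai2 // => _.
have := Fil_supp (Fy k) a'p; have := wt_off ej; rewrite ei ai2.
rewrite !popcount_small; lia.
Qed.

(** [x] is, up to hits of lower weight, [Sq^1] of a form of degree [n - 1]. *)
Definition Sq1_hit e n x := exists2 z, z \is n.-1.-homog for mdeg /\ Fil e.+1 z
  & Hit e n (x - Dsq z).

(** If the leading part of [Sq^1 z] vanishes then [z] is [Sq^1 u] up to lower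
   weight, and [Sq^1 Sq^1 = 0]. *)
Lemma Sq1_hit_lower e n x : (1 < n)%N -> (2 * n.-1 < 3 * e)%N -> Fil e x ->
  Sq1_hit e n x -> Hit e n x.
Proof.
move=> n1 ne Fx [z [Hz Fz] Hx].
have FDz : Fil e (Dsq z).
  by have := FilB Fx (Hit_Fil Hx); rewrite opprB addrC subrK.
have [u Hu Fu] := Dsq_exact_high ne Hz Fz FDz.
have Du : Dsq z = Dsq (z - Dsq u).
  by rewrite lmod2_opp DsqD (Dsq_Dsq Hu) addr0.
have Hzu : z - Dsq u \is n.-1.-homog for mdeg.
  rewrite rpredB //; have := Dsq_homog Hu.
  by have -> : n.-1.-1.+1 = n.-1 by lia.
have := HitD Hx (_ : Hit e n (Dsq z)); rewrite subrK; apply.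
rewrite Du -(prednK (ltnW n1)); exact: Hit_Dsq.
Qed.

(** In weight [n - 1] the only leading part is multilinear, in degree [n - 1]. *)
Lemma Hit_lower1 n x : (1 < n)%N -> Hit n n x -> Fil n.-1 x -> Hit n.-1 n x.
Proof.
move=> n1 [y [Hy Fy xE]] Fx; apply: Sq1_hit_lower => //; first lia.
exists (y n.-1); first by rewrite prednK; [|lia].
case: n n1 xE {Fy Fx} => // n n1; rewrite big_ord_recr /= -(Dsq_sq1 (Hy n)) => ->.
rewrite addrK; apply: Hit_sum => i _; apply: (Hit_sq _ (Hy i)).
  by have := ltn_ord i; lia.
by apply: FilW (Fil_homog (Hy i)); have := ltn_ord i; lia.
Qed.

(** In weight [n - 2] there is also a multilinear leading part [v] in degree
   [n - 2]. It vanishes because [Sq^1] kills the relation [Sq^1 u + Sq^2 v] up to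
   [Sq^3 v]. *)
Lemma Hit_lower2 n x : (4 < n)%N -> Hit n.-1 n x -> Fil n.-2 x -> Hit n.-2 n x.
Proof.
move=> n4 [y [Hy Fy xE]] Fx; apply: Sq1_hit_lower => //; [lia|lia|].
case: n n4 xE Fy Fx => [|[|m]] // n4; rewrite !big_ord_recr /=.
set w := \sum_(i < m) _ => xE Fy Fx.
have Fm : Fil m (y m).
  apply: sq3_multilinear => //.
  have Hw : Fil m w.
    apply: Fil_sum => i _; apply: Fil_sq; apply: FilW (Fil_homog (Hy i)).
    by have := ltn_ord i; lia.
  have := FilD (Fil_Dsq Fx) (Fil_Dsq Hw); congr (Fil _ _).
  rewrite xE !DsqD (sq3 (Hy m)) -(Dsq_sq1 (Hy m.+1)) (Dsq_Dsq (Hy m.+1)) addr0.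
  by rewrite addrAC lmod2_addxx add0r.
exists (y m.+1) => //; rewrite (Dsq_sq1 (Hy m.+1)) xE addrK; apply: HitD.
  apply: Hit_sum => i _; apply: (Hit_sq _ (Hy i)).
    by have := ltn_ord i; lia.
  by apply: FilW (Fil_homog (Hy i)); have := ltn_ord i; lia.
exact: (Hit_sq _ (Hy m) Fm).
Qed.

(** In weight [n - 3] the contribution of degree [n - 3] is absorbed in that of
   degree [n - 1] by [Sq^3 = Sq^1 Sq^2]. *)
Lemma Sq1_hit3 k x : Hit k.+1 k.+3 x -> Fil k x -> Sq1_hit k k.+3 x.
Proof.
move=> [y [Hy Fy xE]] Fx.
have Fk : Fil k (y k.+1) by apply: (@sq2_leading k.+1) => //; rewrite -xE.
move: xE; rewrite !big_ord_recr /=; set w := \sum_(i < k) _ => xE.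
exists (y k.+2 + sq k.+2 (y k)).
  by split; [apply: rpredD => //; apply: sq_homog | apply: FilD => //; apply: Fil_sq].
rewrite DsqD -(sq3 (Hy k)) (Dsq_sq1 (Hy k.+2)) xE.
rewrite opprD addrA addrK addrAC addrK.
apply: HitD; last exact: (Hit_sq _ (Hy k.+1) Fk).
apply: Hit_sum => i _; apply: (Hit_sq _ (Hy i)).
  by have := ltn_ord i; lia.
by apply: FilW (Fil_homog (Hy i)); have := ltn_ord i; lia.
Qed.

(** A monomial with even exponents is the top square of a monomial of the same
   weight. *)
Lemma Hit_even k n x : (0 < n)%N -> x \is n.-homog for mdeg -> Fil k x ->
  (forall a, a \in msupp x -> forall i, ~~ odd (a i)) -> Hit k n x.
Proof.
move=> n0 Hx Fx ev; rewrite (mpolyE x) big_seq; apply: Hit_sum => a ax; apply: HitZ.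
pose b := [multinom (a i)./2 | i < r].
have ab : a = (b *+ 2)%MM.
  by apply/mnmP => i; rewrite mulmnE mnmE; have := ev a ax i; lia.
have nb : n = (2 * mdeg b)%N by have <- : mdeg a = n := dhomog_mf Hx ax; rewrite {1}ab mdegMn mulnC.
rewrite ab -sq_top -nb; apply: (@Hit_sq _ _ (mdeg b)); [lia|by rewrite dhomogX|].
apply: FilX; have := Fil_supp Fx ax; rewrite ab /wt.
rewrite (eq_bigr (fun i => popcount (b i))) // => i _.
by rewrite mulmnE muln2 popcount_double.
Qed.

(** Without an odd exponent or two, one for each unit of degree and weight
   that it takes, what remains has a weight too small for its degree. *)
Lemma low_weight_even n d a : (n <= 8)%N -> (n, d) <> (7, 3)%N -> (n, d) <> (8, 4)%N ->
  (d.+3 < n \/ n <= 4 /\ d.+2 < n)%N -> mdeg a = n -> (wt a <= d)%N ->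
  forall i, ~~ odd (a i).
Proof.
move=> n8 n73 n84 dn an ad i; apply/negP => ai.
have nd := popcount_mdeg a; rewrite an in nd.
have ai0 : (0 < a i)%N by case: (a i) ai.
have wi := wt_sub_odd ai; have mi := mdeg_subU ai0.
case: (boolP (odd n)) => on.
  have : (popcount n <= d)%N by lia.
  have [e|[e|[e|e]]] : n = 1%N \/ n = 3%N \/ n = 5%N \/ n = 7%N by lia.
  - by rewrite e !popcount_small; lia.
  - by rewrite e !popcount_small; lia.
  - by rewrite e !popcount_small; lia.
  - by rewrite e !popcount_small => d3; case: n73; rewrite e; congr pair; lia.
have [j bj] : exists j, odd ((a - U_(i))%MM j) by apply: odd_mdeg; lia.
have bj0 : (0 < (a - U_(i))%MM j)%N by case: (_ j) bj.
have wj := wt_sub_odd bj; have mj := mdeg_subU bj0.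
have := popcount_mdeg (a - U_(i) - U_(j))%MM.
have -> : mdeg (a - U_(i) - U_(j))%MM = n.-2 by lia.
have [e|[e|[e|e]]] : n = 2%N \/ n = 4%N \/ n = 6%N \/ n = 8%N by lia.
- by lia.
- by rewrite e /= !popcount_small; lia.
- by rewrite e /= !popcount_small; lia.
- rewrite e /= !popcount_small; case: (eqVneq d 4%N) => [d4|/eqP d4 h].
    by case: n84; rewrite e d4.
  lia.
Qed.

(** Down to weight [n - 3], and [n - 4] for [n = 8], all relations among leading
   parts come from [Sq^1 Sq^1 = 0] and [Sq^1 Sq^2 = Sq^3]; further down all
   exponents are even. For [(7, 3)] the leading part of [Sq^1] is not exact in
   degree 6 and weight 4. *)
Theorem Hit_strict n d x : (n <= 8)%N -> (n, d) <> (7, 3)%N ->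
  Fil d.+1 x -> Hit n n x -> Hit d.+1 n x.
Proof.
move=> n8 n73 Fx Hx.
case: (leqP n d.+1) => [nd|dn]; first exact: HitW Hx.
have H1 : Hit n.-1 n x.
  by apply: Hit_lower1 => //; [lia | apply: FilW Fx; lia].
case: (eqVneq n d.+2) => [e|/eqP nd2]; first by rewrite e in H1 *.
case: (boolP ((4 < n) && (n == d.+3))%N) => [/andP[n4 /eqP e]|nd3].
  have H2 : Hit n.-2 n x by apply: Hit_lower2 => //; apply: FilW Fx; lia.
  by rewrite e in H2 *.
case: (eqVneq (n, d) (8, 4)%N) => [[n8' d4]|/eqP n84].
  have H2 : Hit n.-2 n x by apply: Hit_lower2 => //; [lia|apply: FilW Fx; lia].
  subst n d; apply: Sq1_hit_lower => //.
  exact: Sq1_hit3.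
apply: Hit_even => //; [lia|exact: Hit_homog Hx|] => a ax.
have an : mdeg a = n := dhomog_mf (Hit_homog Hx) ax.
have ad : (wt a <= d)%N := Fil_supp Fx ax.
by apply: low_weight_even an ad => //; lia.
Qed.

End Core.

(** * Hit forms and the functors [frakQ] and [Qgr] *)

Section Bridges.
Local Open Scope ring_scope.

Definition pol n (V : vectType F2) (p : Sym n V) : {mpoly F2[rk V]} :=
  mpoly_of_dhomog (p : dhomog (rk V) F2 n).

Lemma pol_inj n V : injective (@pol n V).
Proof. exact: val_inj. Qed.

Lemma pol_homog n V (p : Sym n V) : pol p \is n.-homog for mdeg.
Proof. exact: dhomog_is_dhomog. Qed.

Lemma pol_linear n V : linear (@pol n V).
Proof. by []. Qed.

Lemma polD n V (p q : Sym n V) : pol (p + q) = pol p + pol q.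
Proof. by []. Qed.

Lemma polB n V (p q : Sym n V) : pol (p - q) = pol p - pol q.
Proof. by []. Qed.

Definition sym_of n (V : vectType F2) (q : {mpoly F2[rk V]})
  (Hq : q \is n.-homog for mdeg) : Sym n V := (DHomog Hq : dhomog (rk V) F2 n).

Lemma polyfilt_pol n k V (p : Sym n V) : polyfilt k (Sym n) V p <-> Fil k (pol p).
Proof. exact: polyfilt_Sym. Qed.

Definition pp_of n d (V : vectType F2) (q : {mpoly F2[rk V]})
  (Hq : q \is n.-homog for mdeg) (Fq : Fil d.+1 q) : p_ d (Sym n) V :=
  mksub (proj2 (@polyfilt_pol n d.+1 V (sym_of Hq)) Fq).

Definition ppol n d (V : vectType F2) (x : p_ d (Sym n) V) : {mpoly F2[rk V]} :=
  pol (sval_of x).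

Lemma ppol_Fil n d V (x : p_ d (Sym n) V) : Fil d.+1 (ppol x).
Proof. exact/polyfilt_pol/sub_ofP. Qed.

Lemma ppol_homog n d V (x : p_ d (Sym n) V) : ppol x \is n.-homog for mdeg.
Proof. exact: pol_homog. Qed.

Lemma ppol_linear n d V : linear (@ppol n d V).
Proof. by []. Qed.

Lemma ppolB n d V (x y : p_ d (Sym n) V) : ppol (x - y) = ppol x - ppol y.
Proof. by []. Qed.

Lemma ppol_inj n d V : injective (@ppol n d V).
Proof. by move=> x y /pol_inj exy; apply/val_inj. Qed.

Lemma pol_Sq m n V (p : Sym m V) : pol (Sq m n V p) = sq n (pol p).
Proof. by []. Qed.

Lemma sq_nat (V W : vectType F2) (f : 'Hom(V, W)) n (p : symalg V) :
  sq n (symalg_map f p) = symalg_map f (sq n p).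
Proof.
rewrite /sq -!/(total_sq _) total_sq_nat pihomog_comp //.
exact: sym_subst1.
Qed.

Lemma Hit_symalg_map (V W : vectType F2) (f : 'Hom(V, W)) k n (p : symalg V) :
  Hit k n p -> Hit k n (symalg_map f p).
Proof.
move=> [y [Hy Fy ->]]; exists (fun i => symalg_map f (y i)); split=> [i|i|].
- by have := symalg_map_homog f (DHomog (Hy i)).
- exact: Fil_sym_subst.
rewrite /symalg_map linear_sum /=; apply: eq_bigr => i _.
by rewrite -[_ \mPo _]/(symalg_map f (sq n (y i))) -sq_nat.
Qed.

Lemma smem_sum (U : lmodType F2) (N : submod U) (I : Type) (l : seq I) (f : I -> U) :
  (forall i, N (f i)) -> N (\sum_(i <- l) f i).
Proof.
move=> H; elim: l => [|i l IH]; first by rewrite big_nil; apply: smem0.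
by rewrite big_cons -[f i]scale1r; apply: smemP.
Qed.

(** A composite of operations ends with a square, so the subalgebra they generate
   hits no more than the squares. *)
Lemma hits_Hit n V (p : Sym n V) : hits SymSq n V p <-> Hit n n (pol p).
Proof.
split=> [Hp|[y [Hy Fy yE]]]; last first.
  have -> : p = \sum_(i < n) Sq i n V (sym_of (Hy i)).
    apply: pol_inj; rewrite yE.
    by rewrite (big_morph (@pol n V) (@polD n V) (lin0 (@pol_linear n V))).
  apply: (@smem_sum (Sym n V) (hits SymSq n V)) => i; apply: gen_sub_in.
  exists i, (Sq i n), (sym_of (Hy i)); split=> //.
  exact: (@pos_sq SymSq).
have op k l (b : nat_trans (SymSq k) (SymSq l)) : pos_op b ->
    forall W y, Hit l l (pol (b W y : Sym l W)).
  elim=> {k l b} [k l kl|k l b1 b2 _ IH1 _ IH2|k l l' b1 b2 _ _ _ IH2] W y.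
  - have Hy := pol_homog (y : Sym k W).
    exact: (Hit_sq kl Hy (FilW kl (Fil_homog Hy))).
  - exact: HitD (IH1 W y) (IH2 W y).
  - exact: IH2.
pose P W (q : Sym n W) := Hit n n (pol q).
have P0 W : P W 0 by apply: Hit0.
have PD W c u v : P W u -> P W v -> P W (c *: u + v).
  by move=> Hu Hv; apply: HitD => //; apply: HitZ.
have Pst W X (f : hom vect W X) x : P W x -> P X (fmap f x).
  exact: Hit_symalg_map.
apply: (Hp (@Subfunctor vect _ (fun W => Submod (P0 W) (@PD W)) Pst)).
move=> W _ [m [a [y [Ha ->]]]] /=.
exact: op Ha _ _.
Qed.

Lemma gr_proj0 n d V (x : p_ d (Sym n) V) :
  subquo_proj (polyfilt d.+1 (Sym n)) (polyfilt d (Sym n)) V x = 0 <-> Fil d (ppol x).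
Proof.
apply: iff_trans (polyfilt_pol d (sval_of x)).
exact: (quo_pi0 (preimage (sub_incl (polyfilt d.+1 (Sym n))) (polyfilt d (Sym n)) V)).
Qed.

Lemma gr_hits_Hit n d V (x : p_ d (Sym n) V) :
  hits (grSq d) n V (subquo_proj _ (polyfilt d (Sym n)) V x) <->
  exists2 x', Fil d x' & Hit d.+1 n (ppol x - x').
Proof.
set pr := fun m => subquo_proj (polyfilt d.+1 (Sym m)) (polyfilt d (Sym m)).
split=> [Hp|[x' Fx' [y [Hy Fy yE]]]]; last first.
  pose s := \sum_(i < n) sub_map (@polyfilt_nat d.+1 _ _ (Sq i n)) V (pp_of (Hy i) (Fy i)).
  have sE : ppol s = ppol x - x'.
    by rewrite yE (big_morph (@ppol n d V) (linD (@ppol_linear n d V)) (lin0 (@ppol_linear n d V))).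
  have -> : pr n V x = pr n V s.
    apply/eqP; rewrite -subr_eq0 -(linB (@nt_linear _ _ _ (pr n) V)); apply/eqP.
    by apply/gr_proj0; rewrite ppolB sE opprB addrC subrK.
  rewrite (big_morph (pr n V) (linD (@nt_linear _ _ _ (pr n) V))
    (lin0 (@nt_linear _ _ _ (pr n) V))).
  apply: (@smem_sum _ (hits (grSq d) n V)) => i; apply: gen_sub_in.
  exists i, (gr_map d (Sq i n)), (pr i V (pp_of (Hy i) (Fy i))); split.
    exact: (@pos_sq (grSq d)).
  symmetry; exact: (@subquo_map_pi _ _ _ (Sq i n)).
pose P W (z : gr d (Sym n) W) :=
  exists2 u : p_ d (Sym n) W, Hit d.+1 n (ppol u) & pr n W u = z.
have P0 W : P W 0.
  by exists 0; [exact: Hit0 | exact: (lin0 (@nt_linear _ _ _ (pr n) W))].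
have PD W c z1 z2 : P W z1 -> P W z2 -> P W (c *: z1 + z2).
  move=> [u Hu <-] [v Hv <-]; exists (c *: u + v); last by rewrite nt_linear.
  exact: HitD (HitZ c Hu) Hv.
have Pst W X (f : hom vect W X) z : P W z -> P X (fmap f z).
  move=> [u Hu <-]; exists (fmap f u); last by rewrite nt_nat.
  exact: Hit_symalg_map Hu.
have [|u Hu eu] := Hp (@Subfunctor vect _ (fun W => Submod (P0 W) (@PD W)) Pst).
  move=> W _ [m [a [y [Ha ->]]]] /=.
  have op k l (b : nat_trans (grSq d k) (grSq d l)) : pos_op b -> forall y,
    exists2 u : p_ d (Sym l) W, Hit d.+1 l (ppol u) & pr l W u = b W y.
    elim=> {k l b} [k l kl|k l b1 b2 _ IH1 _ IH2|k l l' b1 b2 _ _ _ IH2] z.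
    - move: z; apply: (@quoW _ (preimage (sub_incl (polyfilt d.+1 (Sym k)))
        (polyfilt d (Sym k)) W)) => z.
      exists (sub_map (@polyfilt_nat d.+1 _ _ (Sq k l)) W z).
        exact: (Hit_sq kl (ppol_homog z) (ppol_Fil z)).
      symmetry; exact: (@subquo_map_pi _ _ _ (Sq k l)).
    - have [u1 Hu1 e1] := IH1 z; have [u2 Hu2 e2] := IH2 z.
      exists (u1 + u2); first exact: HitD Hu1 Hu2.
      by rewrite (linD (@nt_linear _ _ _ (pr l) W)) e1 e2.
    - exact: IH2.
  exact: op.
exists (ppol x - ppol u); last by rewrite opprB addrC subrK.
rewrite -ppolB; apply/gr_proj0; rewrite (linB (@nt_linear _ _ _ (pr n) V)).
by rewrite [pr n V u]eu subrr.
Qed.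

Lemma frakQ_class0 n d V (x : p_ d (Sym n) V) :
  frakQ_class n d V x = 0 <-> exists2 x', Fil d x' & Hit d.+1 n (ppol x - x').
Proof.
apply: iff_trans (gr_hits_Hit x).
exact: (quo_pi0 (hits (grSq d) n V)).
Qed.

Lemma frakQ_classB n d V (x y : p_ d (Sym n) V) :
  frakQ_class n d V (x - y) = frakQ_class n d V x - frakQ_class n d V y.
Proof. exact: (linB (@nt_linear _ _ _ (frakQ_class n d) V)). Qed.

Lemma frakQ_class_surj n d V (z : frakQ n d V) : exists x, frakQ_class n d V x = z.
Proof.
move: z; apply: (@quoW _ (hits (grSq d) n V)).
apply: (@quoW _ (preimage (sub_incl (polyfilt d.+1 (Sym n))) (polyfilt d (Sym n)) V)).
by move=> x; exists x.
Qed.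

Lemma frakQ_to_Qgr_class0 n d V (x : p_ d (Sym n) V) :
  frakQ_to_Qgr n d V (frakQ_class n d V x) = 0 <->
  exists2 x', x' \is n.-homog for mdeg /\ Fil d x' & Hit n n (ppol x - x').
Proof.
rewrite frakQ_to_Qgr_class.
apply: iff_trans (quo_pi0 (preimage (sub_incl (Qfilt n d.+1)) (Qfilt n d) V) _) _.
rewrite /=; split=> [[x' ex']|[x' [Hx' Fx'] Hx]].
  exists (pol (sval_of x')); first by split; [exact: pol_homog | exact/polyfilt_pol/sub_ofP].
  rewrite -polB; apply/hits_Hit; apply/quo_piE.
  exact: (esym ex').
have Fx2 := proj2 (@polyfilt_pol n d V (sym_of Hx')) Fx'.
exists (mksub Fx2); apply/esym/quo_piE; apply/hits_Hit.
exact: Hx.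
Qed.

Lemma inj_epi_iso C (F G : functor C) (a : nat_trans F G) :
  (forall V, injective (a V)) -> is_epi a -> is_iso a.
Proof.
move=> aI aE; pose b V y := sval (cid (aE V y)).
have ab V : cancel (b V) (a V) by move=> y; exact: (svalP (cid (aE V y))).
have ba V : cancel (a V) (b V) by move=> x; apply: aI; rewrite ab.
have bL V : linear (b V) by move=> c x y; apply: aI; rewrite nt_linear !ab.
have bN V W (f : hom C V W) x : b W (fmap f x) = fmap f (b V x).
  by apply: aI; rewrite nt_nat !ab.
by exists (NatTrans bL bN).
Qed.

Lemma inj_of_ker C (F G : functor C) (a : nat_trans F G) V :
  (forall x, a V x = 0 -> x = 0) -> injective (a V).
Proof.
move=> H x y axy; apply/eqP; rewrite -subr_eq0; apply/eqP/H.
by rewrite (linB (@nt_linear _ _ _ a V)) axy subrr.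
Qed.

Lemma iso_part n d : (n <= 8)%N -> (n, d) <> (7, 3)%N -> is_iso (frakQ_to_Qgr n d).
Proof.
move=> n8 n73; apply: inj_epi_iso (@frakQ_to_Qgr_epi n d) => V.
apply: inj_of_ker => z; have [x <-] := frakQ_class_surj z.
move/frakQ_to_Qgr_class0 => [x' [Hx' Fx'] Hx]; apply/frakQ_class0; exists x' => //.
apply: Hit_strict => //; apply: FilB; first exact: ppol_Fil.
exact: FilW Fx'.
Qed.

End Bridges.

(** * Forms as images of tensors *)

Lemma comp_mpoly_Xexp m r (t : m.-tuple {mpoly F2[r]}) i n :
  ('X_i ^+ n \mPo t = tnth t i ^+ n)%R.
Proof. by rewrite rmorphXn /= comp_mpolyXU -tnth_nth. Qed.

Lemma comp_mpoly_prod m r (t : m.-tuple {mpoly F2[r]}) (I : finType)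
    (f : I -> {mpoly F2[m]}) :
  ((\prod_i f i) \mPo t = \prod_i (f i \mPo t))%R.
Proof. exact: rmorph_prod. Qed.

Definition frob_mon d (V : vectType F2) (s : 'I_d -> nat)
    (i : {ffun 'I_d -> 'I_(rk V)}) : symalg V :=
  (\prod_k 'X_(i k) ^+ (2 ^ s k))%R.

Section FrobTensor.
Local Open Scope ring_scope.
Variables (d : nat) (V : vectType F2).
Implicit Types (t : Tens d V) (s : 'I_d -> nat).

Lemma frob_tensorE s t : frob_tensor s t = \sum_i t i *: frob_mon s i.
Proof. by []. Qed.

Lemma frob_tensor_linear s : linear (@frob_tensor d s V).
Proof.
move=> c t u; rewrite /frob_tensor scaler_sumr -big_split; apply: eq_bigr => i _ /=.
by rewrite !ffunE scalerDl scalerA.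
Qed.

Lemma frob_monX s (i : {ffun 'I_d -> 'I_(rk V)}) :
  frob_mon s i = 'X_[\sum_k U_(i k) *+ (2 ^ s k)].
Proof.
rewrite (big_morph _ (@mpolyXD (rk V) F2) (mpolyX0 _ _)).
by apply: eq_bigr => k _; rewrite mpolyXn.
Qed.

Lemma mdeg_frob s (i : {ffun 'I_d -> 'I_(rk V)}) :
  mdeg (\sum_k U_(i k) *+ (2 ^ s k))%MM = (\sum_k 2 ^ s k)%N.
Proof.
by rewrite mdeg_sum; apply: eq_bigr => k _; rewrite mdegMn mdeg1 mul1n.
Qed.

Lemma frob_tensor_homog s t : frob_tensor s t \is (\sum_k 2 ^ s k)%N.-homog for mdeg.
Proof.
apply: rpred_sum => i _; apply: rpredZ; rewrite -/(frob_mon s i) frob_monX dhomogX /=.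
by rewrite mdeg_frob.
Qed.

Lemma Fil_frob_tensor s t : Fil d.+1 (frob_tensor s t).
Proof.
apply: Fil_sum => i _; apply: FilZ.
have := @Fil_prod (rk V) _ (enum 'I_d) (fun k => 'X_(i k) ^+ (2 ^ s k)).
rewrite size_enum_ord big_enum; apply=> k; exact: Fil_Xexp.
Qed.

Lemma tens_permE (u : 'S_d) t i : tens_perm V u t i = t [ffun k => i (u k)].
Proof. by rewrite lfunE ffunE. Qed.

Lemma frob_tensor_perm (u : 'S_d) s t :
  frob_tensor s (tens_perm V u t) = frob_tensor (fun k => s (u k)) t.
Proof.
pose h (i : {ffun 'I_d -> 'I_(rk V)}) := [ffun k => i ((u^-1)%g k)].
pose h' (i : {ffun 'I_d -> 'I_(rk V)}) := [ffun k => i (u k)].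
have hK : cancel h h' by move=> i; apply/ffunP=> k; rewrite !ffunE permK.
have h'K : cancel h' h by move=> i; apply/ffunP=> k; rewrite !ffunE permKV.
rewrite /frob_tensor (reindex h) /=; last by exists h' => i _; rewrite ?hK ?h'K.
apply: eq_bigr => i _; rewrite tens_permE -/(h' (h i)) hK; congr (_ *: _).
rewrite (reindex_inj (@perm_inj _ u)) /=.
by apply: eq_bigr => k _; rewrite ffunE permK.
Qed.

(** The total square of [x ^ (2 ^ s)] is [x ^ (2 ^ s) + x ^ (2 ^ (s + 1))]; [S] is
   the set of the factors that are squared. *)
Lemma sq_frob_tensor n s t : sq n (frob_tensor s t) =
  \sum_(S : {set 'I_d} | (\sum_k 2 ^ (s k + (k \in S)) == n)%N)
    frob_tensor (fun k => s k + (k \in S))%N t.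
Proof.
rewrite /frob_tensor sq_sum exchange_big /=; apply: eq_bigr => i _.
rewrite sqZ -scaler_sumr; congr (_ *: _).
rewrite /sq; have -> : \prod_k 'X_(i k) ^+ (2 ^ s k) \mPo sq_subst (rk V) =
    \sum_(S : {set 'I_d}) frob_mon (fun k => s k + (k \in S))%N i.
  rewrite comp_mpoly_prod (eq_bigr (fun k =>
    'X_(i k) ^+ (2 ^ (s k).+1) + 'X_(i k) ^+ (2 ^ s k))) => [|k _]; last first.
    rewrite comp_mpoly_Xexp tnth_mktuple (frobD _ _ _ (pchar_mpoly2 _)).
    rewrite addrC -exprM -expnS; congr (_ + _).
  rewrite bigA_distr; apply: eq_bigr => S _; apply: eq_bigr => k _.
  by case: (k \in S); rewrite ?addn0 ?addn1.
rewrite linear_sum /= [RHS]big_mkcond; apply: eq_bigr => S _ /=.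
by rewrite frob_monX pihomogX /= mdeg_frob -frob_monX.
Qed.

(** The Frobenius is additive and fixes the coefficients of [f]. *)
Lemma frob_tensor_nat (W : vectType F2) (f : 'Hom(V, W)) s t :
  frob_tensor s (tens_map d f t) = symalg_map f (frob_tensor s t).
Proof.
have sum (i : {ffun 'I_d -> 'I_(rk V)}) : symalg_map f (frob_mon s i) =
    \sum_(j : {ffun 'I_d -> 'I_(rk W)}) (\prod_k coef f (i k) (j k)) *: frob_mon s j.
  rewrite /symalg_map /frob_mon comp_mpoly_prod.
  rewrite (eq_bigr (fun k => \sum_(l < rk W) (coef f (i k) l) *: 'X_l ^+ (2 ^ s k))).
    rewrite bigA_distr_bigA; apply: eq_bigr => j _.
    by rewrite scaler_prod.
  move=> k _; rewrite comp_mpoly_Xexp tnth_mktuple.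
  rewrite (frob_sum _ _ _ (pchar_mpoly2 _)); apply: eq_bigr => l _.
  by rewrite exprZn F2_exp // expn_gt0.
rewrite /frob_tensor /symalg_map linear_sum /=.
under [RHS]eq_bigr => i _ do
  rewrite comp_mpolyZ -[_ \mPo _]/(symalg_map f (frob_mon s i)) sum scaler_sumr.
rewrite exchange_big /=; apply: eq_bigr => j _.
rewrite lfunE ffunE scaler_suml; apply: eq_bigr => i _.
by rewrite scalerA.
Qed.

Definition tens_bas (i : {ffun 'I_d -> 'I_(rk V)}) : Tens d V :=
  [ffun j => (j == i)%:R].

Lemma frob_tensor_bas s (i : {ffun 'I_d -> 'I_(rk V)}) : frob_tensor s (tens_bas i) = frob_mon s i.
Proof.
rewrite frob_tensorE (bigD1 i) //= ffunE eqxx scale1r big1 ?addr0 // => j /negPf ji.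
by rewrite ffunE ji scale0r.
Qed.

(** The factors are those of the binary digits of the exponents. *)
Lemma mon_frob (a : 'X_{1..rk V}) : wt a = d ->
  exists s i, 'X_[a] = frob_mon s i :> symalg V.
Proof.
move=> ad; have sz : size (factors a) == d by rewrite size_factors ad.
pose T := Tuple sz.
exists (fun k => (tnth T k).2), [ffun k => (tnth T k).1].
rewrite mpolyXE_id prod_factors /frob_mon -[factors a]/(tval T) big_tuple.
by apply: eq_bigr => k _; rewrite ffunE.
Qed.

(** When all monomials of degree [n] and weight [d] have the same shape, up to the
   order of the factors, a single [frob_tensor s] reaches all leading parts. *)
Lemma frob_tensor_lead n s (p : symalg V) :
  (forall s' : 'I_d -> nat, (\sum_k 2 ^ s' k = n)%N ->
     exists u : 'S_d, s' =1 fun k => s (u k)) ->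
  p \is n.-homog for mdeg -> Fil d.+1 p ->
  exists t, Fil d (p - frob_tensor s t).
Proof.
move=> Hs Hp Fp; rewrite (mpolyE p) big_seq.
pose P (q : {mpoly F2[rk V]}) := exists t, Fil d (q - frob_tensor s t).
apply: (big_ind P) => [|q1 q2 [t1 H1] [t2 H2]|a ap].
- by exists 0; rewrite (lin0 (@frob_tensor_linear s)) subr0; apply: Fil0.
- exists (t1 + t2); rewrite (linD (@frob_tensor_linear s)) opprD addrACA.
  exact: (FilD H1 H2).
have [c0|c0] := F2_cases p@_a.
  by exists 0; rewrite c0 scale0r (lin0 (@frob_tensor_linear s)) subr0; apply: Fil0.
rewrite c0 scale1r; have := Fil_supp Fp ap; rewrite ltnS leq_eqVlt => /orP[/eqP ad|ad].
  have [s' [i e]] := mon_frob ad.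
  have [u s'u] : exists u : 'S_d, s' =1 fun k => s (u k).
    apply: Hs; have : frob_mon s' i \is n.-homog for mdeg.
      by rewrite -e dhomogX /= (dhomog_mf Hp ap).
    by rewrite frob_monX dhomogX /= mdeg_frob => /eqP.
  exists (tens_perm V u (tens_bas i)); rewrite frob_tensor_perm -/(frob_tensor _ _).
  rewrite frob_tensor_bas e (_ : frob_mon _ i = frob_mon s' i) ?subrr; first exact: Fil0.
  by apply: eq_bigr => k _; rewrite s'u.
exists 0; rewrite (lin0 (@frob_tensor_linear s)) subr0; exact: FilX.
Qed.

End FrobTensor.

(** * Leading parts of weight 4 *)

Section Quad.
Local Open Scope ring_scope.

(** Concrete values on the four slots make permutations of them compute. *)
Definition quad (T : Type) (a b c e : T) (k : 'I_4) : T :=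
  match val k with 0 => a | 1 => b | 2 => c | _ => e end.

Definition sl0 : 'I_4 := @Ordinal 4 0 isT.
Definition sl1 : 'I_4 := @Ordinal 4 1 isT.
Definition sl2 : 'I_4 := @Ordinal 4 2 isT.
Definition sl3 : 'I_4 := @Ordinal 4 3 isT.

Lemma quadP (P : 'I_4 -> Prop) : P sl0 -> P sl1 -> P sl2 -> P sl3 -> forall k, P k.
Proof.
move=> P0 P1 P2 P3 [[|[|[|[|k]]]] lt] //.
- by rewrite (_ : Ordinal lt = sl0); [|apply/val_inj].
- by rewrite (_ : Ordinal lt = sl1); [|apply/val_inj].
- by rewrite (_ : Ordinal lt = sl2); [|apply/val_inj].
- by rewrite (_ : Ordinal lt = sl3); [|apply/val_inj].
Qed.

Lemma quadE (T : Type) (f : 'I_4 -> T) : f =1 quad (f sl0) (f sl1) (f sl2) (f sl3).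
Proof. exact: quadP. Qed.

Lemma quad_ext (T : Type) (f g : 'I_4 -> T) :
  f sl0 = g sl0 -> f sl1 = g sl1 -> f sl2 = g sl2 -> f sl3 = g sl3 -> f =1 g.
Proof. exact: quadP. Qed.

Lemma sum_quad (F : 'I_4 -> nat) :
  (\sum_k F k = F sl0 + (F sl1 + (F sl2 + F sl3)))%N.
Proof.
rewrite !big_ord_recl big_ord0 addn0.
by congr (F _ + (F _ + (F _ + F _)))%N; apply/val_inj.
Qed.

(** The sixteen terms of the Cartan formula for four factors. *)
Lemma sum_set4 (M : nmodType) (G : ('I_4 -> nat) -> M) :
  \sum_(S : {set 'I_4}) G (fun k => (k \in S) : nat) =
  (((G (quad 1 1 1 1) + G (quad 1 1 1 0)) + (G (quad 1 1 0 1) + G (quad 1 1 0 0))) + ((G (quad 1 0 1 1) + G (quad 1 0 1 0)) + (G (quad 1 0 0 1) + G (quad 1 0 0 0)))) + (((G (quad 0 1 1 1) + G (quad 0 1 1 0)) + (G (quad 0 1 0 1) + G (quad 0 1 0 0))) + ((G (quad 0 0 1 1) + G (quad 0 0 1 0)) + (G (quad 0 0 0 1) + G (quad 0 0 0 0)))).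
Proof.
pose F (b0 b1 b2 b3 : bool) := G (quad (b0 : nat) b1 b2 b3).
pose h (x : bool * bool * bool * bool) : {set 'I_4} :=
  [set k | quad x.1.1.1 x.1.1.2 x.1.2 x.2 k].
pose h' (S : {set 'I_4}) := (sl0 \in S, sl1 \in S, sl2 \in S, sl3 \in S).
transitivity (\sum_(x : bool * bool * bool * bool) F x.1.1.1 x.1.1.2 x.1.2 x.2).
  rewrite (reindex h) /=.
    apply: eq_bigr => -[[[b0 b1] b2] b3] _; rewrite /F; congr (G _); apply/funext.
    by apply: quadP; rewrite inE.
  exists h'; first by move=> [[[b0 b1] b2] b3] _; rewrite /h' /h !inE.
  move=> S _; apply/setP => k; rewrite /h inE /=.
  by move: k; apply: quadP.
rewrite -(pair_bigA _ (fun y b => F y.1.1 y.1.2 y.2 b)) /=.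
rewrite -(pair_bigA _ (fun y b => \sum_b3 F y.1 y.2 b b3)) /=.
rewrite -(pair_bigA _ (fun y b => \sum_b2 \sum_b3 F y b b2 b3)) /=.
by rewrite !big_bool.
Qed.

End Quad.

Section Tens4.
Local Open Scope ring_scope.
Variable V : vectType F2.
Implicit Types (t : Tens 4 V) (a b c e : 'I_(rk V)).

Definition idx4 a b c e : {ffun 'I_4 -> 'I_(rk V)} := [ffun k => quad a b c e k].

Definition at4 t a b c e : F2 := t (idx4 a b c e).

Lemma tens4P t t' : (forall a b c e, at4 t a b c e = at4 t' a b c e) -> t = t'.
Proof.
move=> H; apply/ffunP => i; have := H (i sl0) (i sl1) (i sl2) (i sl3).
rewrite /at4 (_ : idx4 _ _ _ _ = i) //.
by apply/ffunP => k; rewrite ffunE -quadE.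
Qed.

Lemma at4D t t' a b c e : at4 (t + t') a b c e = at4 t a b c e + at4 t' a b c e.
Proof. by rewrite /at4 ffunE. Qed.

Lemma at4Z (x : F2) t a b c e : at4 (x *: t) a b c e = x * at4 t a b c e.
Proof. by rewrite /at4 ffunE. Qed.

Definition s01 : 'S_4 := tperm sl0 sl1.
Definition s23 : 'S_4 := tperm sl2 sl3.
Definition s02 : 'S_4 := tperm sl0 sl2.
Definition s13 : 'S_4 := tperm sl1 sl3.
Definition s12 : 'S_4 := tperm sl1 sl2.
Definition s03 : 'S_4 := tperm sl0 sl3.

Lemma at4_perm (u : 'S_4) t a b c e :
  at4 (tens_perm V u t) a b c e =
  at4 t (quad a b c e (u sl0)) (quad a b c e (u sl1)) (quad a b c e (u sl2))
    (quad a b c e (u sl3)).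
Proof.
rewrite /at4 tens_permE; congr (t _); apply/ffunP => k; rewrite !ffunE.
by move: k; apply: quadP.
Qed.

Lemma at4_s01 t a b c e : at4 (tens_perm V s01 t) a b c e = at4 t b a c e.
Proof. by rewrite at4_perm !permE. Qed.
Lemma at4_s23 t a b c e : at4 (tens_perm V s23 t) a b c e = at4 t a b e c.
Proof. by rewrite at4_perm !permE. Qed.
Lemma at4_s02 t a b c e : at4 (tens_perm V s02 t) a b c e = at4 t c b a e.
Proof. by rewrite at4_perm !permE. Qed.
Lemma at4_s13 t a b c e : at4 (tens_perm V s13 t) a b c e = at4 t a e c b.
Proof. by rewrite at4_perm !permE. Qed.
Lemma at4_s12 t a b c e : at4 (tens_perm V s12 t) a b c e = at4 t a c b e.
Proof. by rewrite at4_perm !permE. Qed.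
Lemma at4_s03 t a b c e : at4 (tens_perm V s03 t) a b c e = at4 t e b c a.
Proof. by rewrite at4_perm !permE. Qed.

Definition at4E := (at4D, at4_s01, at4_s23, at4_s02, at4_s13, at4_s12, at4_s03).

Notation "u .* t" := (tens_perm V u t) (at level 35, right associativity).

(** The projection of the tensors to Lambda^2 (x) Lambda^2, followed by the
   antisymmetrisation, which is injective. *)
Definition alt22 t := (t + s01 .* t) + s23 .* (t + s01 .* t).

(** [Sq^1 : Lambda^3 (x) Lambda^1 -> Lambda^2 (x) Lambda^2]. *)
Definition op31 t := t + s12 .* t + s02 .* t.

(** [Sq^2 : Lambda^4 -> Lambda^2 (x) Lambda^2]. *)
Definition op4 t :=
  t + s12 .* t + s13 .* t + s02 .* t + s03 .* t + s02 .* (s13 .* t).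

Definition deg22 : 'I_4 -> nat := quad 0 0 1 1.
Definition deg31 : 'I_4 -> nat := quad 0 0 0 1.
Definition deg4 : 'I_4 -> nat := quad 0 0 0 0.

Lemma frob_tensor_ext d (s s' : 'I_d -> nat) (t : Tens d V) : s =1 s' ->
  frob_tensor s t = frob_tensor s' t.
Proof. by move=> /funext->. Qed.

Definition sq_term n (s : 'I_4 -> nat) t (chi : 'I_4 -> nat) : symalg V :=
  if (2 ^ (s sl0 + chi sl0) + (2 ^ (s sl1 + chi sl1) +
      (2 ^ (s sl2 + chi sl2) + 2 ^ (s sl3 + chi sl3))) == n)%N
  then frob_tensor (quad (s sl0 + chi sl0)%N (s sl1 + chi sl1)%N
    (s sl2 + chi sl2)%N (s sl3 + chi sl3)%N) t else 0.

Lemma sq_frob_quad n (s : 'I_4 -> nat) t : sq n (frob_tensor s t) =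
  \sum_(S : {set 'I_4}) sq_term n s t (fun k => (k \in S) : nat).
Proof.
rewrite sq_frob_tensor big_mkcond; apply: eq_bigr => S _.
rewrite sum_quad /sq_term. case: ifP; last by []. move=> _.
exact/frob_tensor_ext/quadE.
Qed.

Lemma frob_tensor_quad (s : 'I_4 -> nat) t :
  frob_tensor s t = frob_tensor (quad (s sl0) (s sl1) (s sl2) (s sl3)) t.
Proof. exact/frob_tensor_ext/quadE. Qed.

Lemma sq_frob31 t : sq 6 (frob_tensor deg31 t) = frob_tensor deg22 (op31 t).
Proof.
rewrite sq_frob_quad (sum_set4 (sq_term _ _ _)) /sq_term /= !addr0 !add0r.
rewrite !(linD (@frob_tensor_linear _ _ _)) !frob_tensor_perm.
rewrite (frob_tensor_quad (fun k => _ (s12 k))) (frob_tensor_quad (fun k => _ (s02 k))).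
rewrite !permE /deg22 /= [RHS]addrC [X in _ = _ + X]addrC.
by [].
Qed.

Lemma sq_frob4 t : sq 6 (frob_tensor deg4 t) = frob_tensor deg22 (op4 t).
Proof.
rewrite sq_frob_quad (sum_set4 (sq_term _ _ _)) /sq_term /= !addr0 !add0r.
rewrite !(linD (@frob_tensor_linear _ _ _)) !frob_tensor_perm.
rewrite (frob_tensor_quad (fun k => _ (s12 k))) (frob_tensor_quad (fun k => _ (s02 k))).
rewrite (frob_tensor_quad (fun k => _ (s13 k))) (frob_tensor_quad (fun k => _ (s03 k))).
rewrite (frob_tensor_quad (fun k => _ (_ (s13 k)))).
rewrite !permE; pose f (x y z w : nat) : {mpoly F2[rk V]} := frob_tensor (quad x y z w) t.
change ((f 1 1 0 0)%N + ((f 1 0 1 0)%N + (f 1 0 0 1)%N) + ((f 0 1 1 0)%N + (f 0 1 0 1)%N + (f 0 0 1 1)%N) =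
  (f 0 0 1 1)%N + (f 0 1 0 1)%N + (f 0 1 1 0)%N + (f 1 0 0 1)%N + (f 1 0 1 0)%N + (f 1 1 0 0)%N).
move: (f 1 1 0 0)%N (f 1 0 1 0)%N (f 1 0 0 1)%N (f 0 1 1 0)%N (f 0 1 0 1)%N (f 0 0 1 1)%N.
by move=> x1 x2 x3 x4 x5 x6; ring.
Qed.

End Tens4.

(** * The leading part of degree 6 and weight 4 *)

Section Detect.
Local Open Scope ring_scope.
Variable V : vectType F2.
Implicit Types (t : Tens 4 V) (a b c e : 'I_(rk V)).

Definition mon22 a b c e : 'X_{1..rk V} := (U_(a) + U_(b) + U_(c) *+ 2 + U_(e) *+ 2)%MM.

Lemma mon22E a b c e i :
  mon22 a b c e i = ((a == i) + (b == i) + 2 * ((c == i) + (e == i)))%N.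
Proof. by rewrite !mnmDE !mnm1E; lia. Qed.

Lemma frob_mon22 (i : {ffun 'I_4 -> 'I_(rk V)}) :
  frob_mon deg22 i = 'X_[mon22 (i sl0) (i sl1) (i sl2) (i sl3)].
Proof.
rewrite frob_monX; congr 'X_[_]; apply/mnmP => l.
rewrite mnm_sumE sum_quad mon22E !mulmnE !mnm1E.
rewrite -[deg22 sl0]/(0%N) -[deg22 sl1]/(0%N) -[deg22 sl2]/(1%N) -[deg22 sl3]/(1%N).
by lia.
Qed.

Lemma wt_mon22 a b c e : a != b -> c != e -> wt (mon22 a b c e) = 4.
Proof.
move=> ab ce; rewrite /wt.
have E i : popcount (mon22 a b c e i) = ((a == i) + (b == i) + ((c == i) + (e == i)))%N.
  have nab : ~~ ((a == i) && (b == i)) by apply: contra ab => /andP[/eqP-> /eqP->].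
  have nce : ~~ ((c == i) && (e == i)) by apply: contra ce => /andP[/eqP-> /eqP->].
  rewrite mon22E; case: (a == i) nab; case: (b == i) => //= _;
  by case: (c == i) nce; case: (e == i).
rewrite (eq_bigr _ (fun i _ => E i)) !big_split /=.
have one (x : 'I_(rk V)) : (\sum_i (x == i) = 1)%N.
  by rewrite (bigD1 x) //= eqxx big1 ?addn0 // => i; rewrite eq_sym => /negPf->.
by rewrite !one.
Qed.

Lemma wt_mon22_eq a b c e : (a == b) || (c == e) -> (wt (mon22 a b c e) < 4)%N.
Proof.
have w1 (x : 'I_(rk V)) k : wt (U_(x) *+ 2 ^ k)%MM = 1%N by rewrite wtUn popcount_exp2.
have dbl (x : 'I_(rk V)) k : (U_(x) *+ k + U_(x) *+ k = U_(x) *+ (2 * k))%MM.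
  by apply/mnmP => i; rewrite !mnmDE !mulmnE; lia.
have W (x y z : 'X_{1..rk V}) : (wt x = 1 -> wt y = 1 -> wt z = 1 -> wt (x + y + z)%MM < 4)%N.
  by move=> x1 y1 z1; have := wtD (x + y)%MM z; have := wtD x y; lia.
case/orP => /eqP->.
  rewrite /mon22 -[U_(b)%MM in X in (wt X < _)%N]/(U_(b) *+ 1)%MM (dbl b 1%N).
  by apply: W; [exact: (w1 b 1%N)|exact: (w1 c 1%N)|exact: (w1 e 1%N)].
rewrite /mon22 -addmA (dbl e 2%N).
by apply: W; [exact: (w1 a 0%N)|exact: (w1 b 0%N)|exact: (w1 e 2%N)].
Qed.

(** The parities of the exponents determine the pair of simple factors. *)
Lemma mon22_inj a b c e a' b' c' e' : a != b -> c != e ->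
  (mon22 a' b' c' e' == mon22 a b c e) =
  ((a' == a) && (b' == b) || (a' == b) && (b' == a)) &&
  ((c' == c) && (e' == e) || (c' == e) && (e' == c)).
Proof.
move=> ab ce; apply/eqP/idP => [/mnmP H|]; last first.
  by case/andP => /orP[] /andP[/eqP-> /eqP->] /orP[] /andP[/eqP-> /eqP->];
     apply/mnmP => i; rewrite !mon22E; lia.
have {}H i : ((a' == i) + (b' == i) + 2 * ((c' == i) + (e' == i)) =
    (a == i) + (b == i) + 2 * ((c == i) + (e == i)))%N by rewrite -!mon22E.
have Hab : (a' == a) && (b' == b) || (a' == b) && (b' == a).
  have par x : (a' == x) (+) (b' == x) = (a == x) (+) (b == x).
    by have := H x; rewrite !mul2n => /(congr1 odd); rewrite !(odd_double, oddD) !addbF !oddb.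
  have := par a; have := par b; rewrite !eqxx (eq_sym b a) (negPf ab).
  have : ~~ ((a' == a) && (a' == b)) by apply: contra ab => /andP[/eqP<- /eqP<-].
  have : ~~ ((b' == a) && (b' == b)) by apply: contra ab => /andP[/eqP<- /eqP<-].
  by case: (a' == a); case: (a' == b); case: (b' == a); case: (b' == b).
rewrite Hab /=.
have {}H i : ((c' == i) + (e' == i) = (c == i) + (e == i))%N.
  by have := H i; case/orP: Hab => /andP[/eqP-> /eqP->]; lia.
have := H c; have := H e; rewrite !eqxx (eq_sym e c) (negPf ce).
have : ~~ ((c' == c) && (c' == e)) by apply: contra ce => /andP[/eqP<- /eqP<-].
have : ~~ ((e' == c) && (e' == e)) by apply: contra ce => /andP[/eqP<- /eqP<-].
by case: (c' == c); case: (c' == e); case: (e' == c); case: (e' == e).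
Qed.

Lemma at4_alt22 t a b c e : at4 (alt22 t) a b c e =
  at4 t a b c e + at4 t b a c e + (at4 t a b e c + at4 t b a e c).
Proof. by rewrite /alt22 !at4E. Qed.

Lemma at4_sum t a b c e : at4 t a b c e = \sum_i t i * (idx4 a b c e == i)%:R.
Proof.
rewrite (bigD1 (idx4 a b c e)) //= eqxx mulr1 big1 ?addr0 // => i.
by rewrite eq_sym => /negPf->; rewrite mulr0.
Qed.

Lemma idx4_eq a b c e (i : {ffun 'I_4 -> 'I_(rk V)}) :
  (idx4 a b c e == i) = [&& i sl0 == a, i sl1 == b, i sl2 == c & i sl3 == e].
Proof.
apply/eqP/and4P => [<-|[/eqP i0 /eqP i1 /eqP i2 /eqP i3]]; first by rewrite !ffunE !eqxx.
by apply/ffunP => k; rewrite ffunE; move: k; apply: quadP.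
Qed.

Lemma frob22_coef t a b c e : a != b -> c != e ->
  (frob_tensor deg22 t)@_(mon22 a b c e) = at4 (alt22 t) a b c e.
Proof.
move=> ab ce; rewrite at4_alt22 !at4_sum -!big_split frob_tensorE raddf_sum /=.
apply: eq_bigr => i _; rewrite mcoeffZ frob_mon22 mcoeffX mon22_inj // !idx4_eq.
rewrite -!mulrDr; congr (_ * _).
have nab x : ~~ ((x == a) && (x == b)) by apply: contra ab => /andP[/eqP<- /eqP<-].
have nce x : ~~ ((x == c) && (x == e)) by apply: contra ce => /andP[/eqP<- /eqP<-].
move: (nab (i sl0)) (nab (i sl1)) (nce (i sl2)) (nce (i sl3)).
case: (i sl0 == a); case: (i sl0 == b); case: (i sl1 == a); case: (i sl1 == b) => //= _ _;
case: (i sl2 == c); case: (i sl2 == e); case: (i sl3 == c); case: (i sl3 == e) => //= _ _;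
by rewrite ?addr0 ?add0r.
Qed.

(** Products with a repeated factor have lower weight, and the others are
   determined by two pairs of variables: only [Lambda^2 (x) Lambda^2] counts. *)
Lemma Fil_frob22 t : Fil 4 (frob_tensor deg22 t) <-> alt22 t = 0.
Proof.
split=> [F4|t0 m m4].
  apply: tens4P => a b c e; rewrite [RHS]/at4 ffunE.
  case: (eqVneq a b) => [->|ab]; first by rewrite at4_alt22 !F2_addcc.
  case: (eqVneq c e) => [->|ce]; first by rewrite at4_alt22 F2_addcc.
  by rewrite -frob22_coef // F4 // wt_mon22.
case: (pselect (exists a b c e, [/\ a != b, c != e & m = mon22 a b c e])).
  move=> [a [b [c [e [ab ce me]]]]].
  by rewrite me frob22_coef // t0 /at4 ffunE.
rewrite frob_tensorE raddf_sum /= => H; apply: big1 => i _; rewrite mcoeffZ frob_mon22 mcoeffX.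
case: eqP => [e|]; last by rewrite mulr0.
case: (boolP ((i sl0 == i sl1) || (i sl2 == i sl3))) => [/wt_mon22_eq|].
  by rewrite e ltnNge m4.
rewrite negb_or => /andP[n1 n2]; case: H.
by exists (i sl0), (i sl1), (i sl2), (i sl3).
Qed.


End Detect.

(** * The strict structure of [frakQ^6_4] *)

Section Shapes.

(** In degree at most 6 a factor of a product of four is simple or squared, so
   the degree determines the shape. *)
Lemma exp2_sum4 (s : 'I_4 -> nat) n : n <= 6 -> \sum_k 2 ^ s k = n ->
  exists b : 'I_4 -> bool, s =1 b.
Proof.
move=> n6; rewrite sum_quad => e.
have p k : 0 < 2 ^ s k by rewrite expn_gt0.
have h k : (2 ^ s k <= 3) -> s k = (s k == 1) :> nat.
  by case: (s k) => [|[|m]] //; rewrite !expnS; have := expn_gt0 2 m; lia.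
exists (fun k => s k == 1); apply: quadP; apply: h;
  have := p sl0; have := p sl1; have := p sl2; have := p sl3; lia.
Qed.

Lemma shape22 (s : 'I_4 -> nat) : \sum_k 2 ^ s k = 6 ->
  exists u : 'S_4, s =1 fun k => deg22 (u k).
Proof.
move=> e; have [b sb] := exp2_sum4 (leqnn 6) e.
move: e; rewrite sum_quad !sb.
have U (u : 'S_4) : [/\ b sl0 = deg22 (u sl0) :> nat, b sl1 = deg22 (u sl1) :> nat,
    b sl2 = deg22 (u sl2) :> nat & b sl3 = deg22 (u sl3) :> nat] ->
    exists u : 'S_4, s =1 fun k => deg22 (u k).
  by move=> [e0 e1 e2 e3]; exists u; apply: quad_ext; rewrite sb.
case b0: (b sl0); case b1: (b sl1); case b2: (b sl2); case b3: (b sl3) => //= _.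
- by apply: (U (s02 * s13)%g); rewrite !permE b0 b1 b2 b3 /= !permE.
- by apply: (U s03); rewrite !permE b0 b1 b2 b3.
- by apply: (U s02); rewrite !permE b0 b1 b2 b3.
- by apply: (U s13); rewrite !permE b0 b1 b2 b3.
- by apply: (U s12); rewrite !permE b0 b1 b2 b3.
- by apply: (U 1%g); rewrite !permE b0 b1 b2 b3.
Qed.

Lemma shape31 (s : 'I_4 -> nat) : \sum_k 2 ^ s k = 5 ->
  exists u : 'S_4, s =1 fun k => deg31 (u k).
Proof.
move=> e; have [b sb] := exp2_sum4 (isT : 5 <= 6) e.
move: e; rewrite sum_quad !sb.
have U (u : 'S_4) : [/\ b sl0 = deg31 (u sl0) :> nat, b sl1 = deg31 (u sl1) :> nat,
    b sl2 = deg31 (u sl2) :> nat & b sl3 = deg31 (u sl3) :> nat] ->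
    exists u : 'S_4, s =1 fun k => deg31 (u k).
  by move=> [e0 e1 e2 e3]; exists u; apply: quad_ext; rewrite sb.
case b0: (b sl0); case b1: (b sl1); case b2: (b sl2); case b3: (b sl3) => //= _.
- by apply: (U s03); rewrite !permE b0 b1 b2 b3.
- by apply: (U s13); rewrite !permE b0 b1 b2 b3.
- by apply: (U s23); rewrite !permE b0 b1 b2 b3.
- by apply: (U 1%g); rewrite !permE b0 b1 b2 b3.
Qed.

Lemma shape4 (s : 'I_4 -> nat) : \sum_k 2 ^ s k = 4 ->
  exists u : 'S_4, s =1 fun k => deg4 (u k).
Proof.
move=> e; have [b sb] := exp2_sum4 (isT : 4 <= 6) e.
move: e; rewrite sum_quad !sb.
case b0: (b sl0); case b1: (b sl1); case b2: (b sl2); case b3: (b sl3) => //= _.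
by exists 1%g; apply: quad_ext; rewrite sb ?b0 ?b1 ?b2 ?b3 permE.
Qed.

End Shapes.

Section Linear4.
Local Open Scope ring_scope.

Lemma tens_perm_gamma d (V W : vectType F2) (f : gamma_hom d V W) (u : 'S_d) t :
  (f : 'Hom(Tens d V, Tens d W)) (tens_perm V u t) = tens_perm W u (f t).
Proof. by have /lfunP/(_ t) := gamma_homP f u; rewrite !comp_lfunE. Qed.

Section Gamma.
Variables (V W : vectType F2) (f : gamma_hom 4 V W).
Let F : 'Hom(Tens 4 V, Tens 4 W) := f.

Let FD t u : F (t + u) = F t + F u. Proof. exact: linearD. Qed.
Let FP u t : F (tens_perm V u t) = tens_perm W u (F t).
Proof. exact: tens_perm_gamma. Qed.

Lemma alt22_gamma t : F (alt22 t) = alt22 (F t).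
Proof. by rewrite /alt22 !(FD, FP). Qed.

Lemma op31_gamma t : F (op31 t) = op31 (F t).
Proof. by rewrite /op31 !(FD, FP). Qed.

Lemma op4_gamma t : F (op4 t) = op4 (F t).
Proof. by rewrite /op4 !(FD, FP). Qed.
End Gamma.

Section Ops.
Variable V : vectType F2.
Implicit Types t u : Tens 4 V.

Lemma alt22_linear : linear (@alt22 V).
Proof.
by move=> c t u; apply: tens4P => i j k l; rewrite [RHS]at4D [in RHS]at4Z !at4_alt22 !(at4D, at4Z); ring.
Qed.

Lemma op31_linear : linear (@op31 V).
Proof.
move=> c t u; apply: tens4P => i j k l.
by rewrite /op31 !(at4E, at4Z); ring.
Qed.

Lemma op4_linear : linear (@op4 V).
Proof.
move=> c t u; apply: tens4P => i j k l.
by rewrite /op4 !(at4E, at4Z); ring.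
Qed.
End Ops.

(** The relations of [frakQ^6_4] in the fourth tensor power. They are written with
   permutations of the slots, which commute with the morphisms of [gamma 4]. *)
Definition rel64 (V : vectType F2) (t : Tens 4 V) :=
  exists t' t'', alt22 t = alt22 (op31 t' + op4 t'').

Lemma rel64_alt22 (V : vectType F2) (t t' : Tens 4 V) :
  alt22 t = alt22 (op31 t') -> rel64 t.
Proof.
by move=> e; exists t', 0; rewrite (lin0 (@op4_linear V)) addr0.
Qed.

Lemma rel64_0 (V : vectType F2) : rel64 (0 : Tens 4 V).
Proof. by apply: (@rel64_alt22 _ _ 0); rewrite (lin0 (@op31_linear V)). Qed.

Lemma rel64_P (V : vectType F2) (c : F2) (t u : Tens 4 V) :
  rel64 t -> rel64 u -> rel64 (c *: t + u).
Proof.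
move=> [t' [t'' et]] [u' [u'' eu]]; exists (c *: t' + u'), (c *: t'' + u'').
rewrite alt22_linear et eu -alt22_linear; congr alt22.
by rewrite op31_linear op4_linear scalerDr addrACA.
Qed.

Local Obligation Tactic := idtac.

Program Definition TensG d : functor (gamma d) :=
  @Functor (gamma d) (Tens d)
    (fun V W (f : gamma_hom d V W) t => (f : 'Hom(Tens d V, Tens d W)) t) _ _ _.
Next Obligation. by move=> d V W f a x y; rewrite linearP. Qed.
Next Obligation. by move=> d V x; rewrite /= id_lfunE. Qed.
Next Obligation. by move=> d U V W g f x; rewrite /= comp_lfunE. Qed.

Program Definition K64 : subfunctor (TensG 4) :=
  @Subfunctor (gamma 4) (TensG 4) (fun V => @Submod (Tens 4 V) (@rel64 V) _ _) _.
Next Obligation. exact: rel64_0. Qed.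
Next Obligation. move=> V a u v /= Hu Hv; exact: rel64_P. Qed.
Next Obligation.
move=> V W f t /= [t' [t'' e]]; exists ((f : gamma_hom 4 V W) t'), ((f : gamma_hom 4 V W) t'').
by rewrite -op31_gamma -op4_gamma -linearD -!alt22_gamma e.
Qed.

Definition T64_fun : functor (gamma 4) := quo_functor K64.

Lemma T64_map (V W : vectType F2) (f : gamma_hom 4 V W) (t : Tens 4 V) :
  fmap (f : hom (gamma 4) V W) (quo_pi (K64 V) t : T64_fun V) = quo_pi (K64 W) (f t).
Proof. exact: (@quo_map_subproof (gamma 4) (TensG 4) K64 V W f t). Qed.

Program Definition T64 : strict 4 := @Strict 4 T64_fun _.
Next Obligation.
move=> V W a f g; apply: quoW => t; rewrite !T64_map.
by rewrite -quo_pi_linear /= add_lfunE scale_lfunE.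
Qed.

Section Theta.
Variable V : vectType F2.
Implicit Types t : Tens 4 V.

Lemma frob22_homog t : frob_tensor deg22 t \is 6.-homog for mdeg.
Proof. by have := frob_tensor_homog deg22 t; rewrite sum_quad. Qed.
Lemma frob31_homog t : frob_tensor deg31 t \is 5.-homog for mdeg.
Proof. by have := frob_tensor_homog deg31 t; rewrite sum_quad. Qed.
Lemma frob4_homog t : frob_tensor deg4 t \is 4.-homog for mdeg.
Proof. by have := frob_tensor_homog deg4 t; rewrite sum_quad. Qed.

Definition pp22 t : p_ 4 (Sym 6) V := pp_of (frob22_homog t) (Fil_frob_tensor deg22 t).

Lemma ppol_pp22 t : ppol (pp22 t) = frob_tensor deg22 t.
Proof. by []. Qed.

Lemma pp22_linear : linear pp22.
Proof. by move=> c t u; apply: ppol_inj; rewrite !ppol_pp22 frob_tensor_linear. Qed.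

Lemma frob22B_Fil t u : Fil 4 (frob_tensor deg22 t - frob_tensor deg22 u) <->
  alt22 t = alt22 u.
Proof.
rewrite -(linB (@frob_tensor_linear _ _ _)); apply: iff_trans (Fil_frob22 _) _.
by rewrite (linB (@alt22_linear V)); split=> [/eqP|->]; rewrite ?subrr // subr_eq0 => /eqP.
Qed.

(** In weight 4 a form of degree 6 is only hit from the shapes of [op31] and
   [op4], in degrees 5 and 4. *)
Lemma class_pp22 t : frakQ_class 6 4 V (pp22 t) = 0 <-> rel64 t.
Proof.
apply: iff_trans (frakQ_class0 _) _; rewrite ppol_pp22.
split=> [[x' Fx' [y [Hy Fy yE]]]|[t' [t'' e]]]; last first.
  exists (frob_tensor deg22 t - frob_tensor deg22 (op31 t' + op4 t'')).
    exact/frob22B_Fil.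
  rewrite opprB addrC subrK (linD (@frob_tensor_linear _ _ _)) -sq_frob31 -sq_frob4.
  apply: HitD; [apply: (Hit_sq _ (frob31_homog t')) => // | apply: (Hit_sq _ (frob4_homog t'')) => //];
    exact: Fil_frob_tensor.
have [t' H'] := frob_tensor_lead shape31 (Hy 5) (Fy 5).
have [t'' H''] := frob_tensor_lead shape4 (Hy 4) (Fy 4).
exists t', t''; apply/frob22B_Fil.
rewrite (linD (@frob_tensor_linear _ _ _)) -sq_frob31 -sq_frob4.
have xE : frob_tensor deg22 t = x' + (\sum_(i < 4) sq 6 (y i) + sq 6 (y 4) + sq 6 (y 5)).
  by move: yE; rewrite big_ord_recr big_ord_recr /= => <-; rewrite addrC subrK.
have Fw : Fil 4 (\sum_(i < 4) sq 6 (y i)).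
  apply: Fil_sum => i _; apply: Fil_sq; apply: FilW (Fil_homog (Hy i)).
  exact: ltn_ord.
have := FilD (FilD Fx' Fw) (FilD (Fil_sq 6 H') (Fil_sq 6 H'')).
rewrite xE 3!lmod2_opp 2!sqD.
move: (\sum_(i < 4) sq 6 (y i)) (sq 6 (y 4)) (sq 6 (y 5)) => w a b.
move: (sq 6 (frob_tensor deg31 t')) (sq 6 (frob_tensor deg4 t'')) => c e.
by congr (Fil _ _); move: x' w a b c e {xE Fx' yE Fw} => x' w a b c e; ring.
Qed.

Lemma rel64_pp22 t u : frakQ_class 6 4 V (pp22 t) = frakQ_class 6 4 V (pp22 u) <->
  rel64 (t - u).
Proof.
apply: iff_trans _ (class_pp22 (t - u)).
rewrite (linB pp22_linear) frakQ_classB.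
by split=> [->|/eqP]; rewrite ?subrr // subr_eq0 => /eqP.
Qed.

Definition theta64_fun (x : T64 V) : frakQ 6 4 V :=
  frakQ_class 6 4 V (pp22 (generic_quotient.repr (x : quo (K64 V)))).

Lemma theta64_pi t : theta64_fun (quo_pi (K64 V) t) = frakQ_class 6 4 V (pp22 t).
Proof.
by apply/rel64_pp22; apply: (proj1 (quo_piE (K64 V) _ _)); rewrite quo_piK.
Qed.

Lemma theta64_linear : linear theta64_fun.
Proof.
move=> c; apply: quoW => t; apply: quoW => u.
by rewrite -quo_pi_linear !theta64_pi pp22_linear nt_linear.
Qed.

Lemma theta64_inj : injective theta64_fun.
Proof.
apply: quoW => t; apply: quoW => u; rewrite !theta64_pi => /rel64_pp22 H.
exact/quo_piE.
Qed.

Lemma theta64_surj z : exists x, theta64_fun x = z.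
Proof.
have [x <-] := frakQ_class_surj z.
have [t Ft] := frob_tensor_lead shape22 (ppol_homog x) (ppol_Fil x).
exists (quo_pi (K64 V) t); rewrite theta64_pi.
apply/eqP; rewrite -subr_eq0 -frakQ_classB; apply/eqP/frakQ_class0.
exists (ppol (pp22 t - x)); last by rewrite subrr; apply: Hit0.
by rewrite ppolB ppol_pp22 lmod2_opp addrC -[X in _ + X]lmod2_opp.
Qed.

End Theta.

Lemma theta64_nat (V W : vectType F2) (f : hom vect V W) (x : forget T64 V) :
  theta64_fun (fmap f x) = fmap f (theta64_fun x).
Proof.
move: x; apply: (@quoW _ (K64 V)) => t.
transitivity (theta64_fun (quo_pi (K64 W) (tens_map 4 f t))).
  apply: (congr1 (@theta64_fun W)); exact: (T64_map (gamma_pow 4 f) t).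
rewrite !theta64_pi -nt_nat; congr (frakQ_class 6 4 W _).
by apply: ppol_inj; rewrite ppol_pp22 frob_tensor_nat.
Qed.

Definition theta64 : nat_trans (forget T64) (frakQ 6 4) :=
  @NatTrans vect (forget T64) (frakQ 6 4) (@theta64_fun) (@theta64_linear) theta64_nat.

Lemma theta64_iso : is_iso theta64.
Proof. by apply: inj_epi_iso => V; [exact: theta64_inj | exact: theta64_surj]. Qed.

(** The other orders of the factors differ from [deg22] by a permutation of the
   slots. For the other degrees [frob_tensor s t] is not of degree 6 unless it
   vanishes. *)
Lemma theta64_strict : strict_frakQ theta64.
Proof.
split=> [|s V W phi t x y a ex ey ea]; first exact: theta64_iso.
case: (eqVneq (\sum_k 2 ^ s k)%N 6) => [s6|s6].
  have [u su] := shape22 s6.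
  have tE (U : vectType F2) (z : Tens 4 U) :
      frob_tensor s z = frob_tensor deg22 (tens_perm U u z).
    by rewrite frob_tensor_perm; apply: frob_tensor_ext.
  have xE : x = pp22 (tens_perm V u t).
    by apply: ppol_inj; rewrite ppol_pp22 -tE.
  have yE : y = pp22 (tens_perm W u ((phi : 'Hom(Tens 4 V, Tens 4 W)) t)).
    by apply: ppol_inj; rewrite ppol_pp22 -tE.
  have -> : a = quo_pi (K64 V) (tens_perm V u t).
    by apply: theta64_inj; rewrite theta64_pi -xE.
  transitivity (theta64_fun (quo_pi (K64 W)
      ((phi : 'Hom(Tens 4 V, Tens 4 W)) (tens_perm V u t)))).
    apply: (congr1 (@theta64_fun W)); exact: T64_map.
  by rewrite theta64_pi tens_perm_gamma -yE.
have Z (U : vectType F2) (z : Tens 4 U) (w : p_ 4 (Sym 6) U) :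
    ppol w = frob_tensor s z -> w = 0.
  move=> ew; apply: ppol_inj; rewrite (lin0 (@ppol_linear 6 4 U)).
  apply/eqP; apply: contraT => nz; case/eqP: s6.
  apply: (dhomog_uniq nz); last exact: ppol_homog.
  by rewrite ew frob_tensor_homog.
have a0 : a = 0.
  apply: theta64_inj; rewrite (lin0 (@theta64_linear V)) [LHS]ea (Z _ _ _ ex).
  exact: (lin0 (@nt_linear _ _ _ (frakQ_class 6 4) V)).
rewrite a0 (Z _ _ _ ey) (lin0 (fmap_linear _)).
rewrite (lin0 (@nt_linear _ _ _ (frakQ_class 6 4) W)).
exact: (lin0 (@nt_linear _ _ _ theta64 W)).
Qed.

End Linear4.

(** * Symmetric tensors and the Frobenius twist of [Lambda^2] *)

Section Tens2.
Local Open Scope ring_scope.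

Section OneSpace.
Variable V : vectType F2.
Implicit Types (t u : Tens 2 V) (a b c e : 'I_(rk V)).

Definition idx2 a b : {ffun 'I_2 -> 'I_(rk V)} :=
  [ffun k : 'I_2 => if val k is 0 then a else b].

Definition at2 t a b : F2 := t (idx2 a b).

Lemma ord2P (P : 'I_2 -> Prop) : P ord0 -> P ord_max -> forall k, P k.
Proof.
move=> P0 P1 [[|[|k]] lt] //.
- by rewrite (_ : Ordinal lt = ord0); [|apply/val_inj].
- by rewrite (_ : Ordinal lt = ord_max); [|apply/val_inj].
Qed.

Lemma idx2_id (i : {ffun 'I_2 -> 'I_(rk V)}) : idx2 (i ord0) (i ord_max) = i.
Proof. by apply/ffunP => k; rewrite ffunE; move: k; apply: ord2P. Qed.

Lemma tens2P t u : (forall a b, at2 t a b = at2 u a b) -> t = u.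
Proof. by move=> H; apply/ffunP => i; have := H (i ord0) (i ord_max); rewrite /at2 idx2_id. Qed.

Lemma at2D t u a b : at2 (t + u) a b = at2 t a b + at2 u a b.
Proof. by rewrite /at2 ffunE. Qed.

Lemma at2Z (x : F2) t a b : at2 (x *: t) a b = x * at2 t a b.
Proof. by rewrite /at2 ffunE. Qed.

Lemma at2_0 a b : at2 0 a b = 0.
Proof. by rewrite /at2 ffunE. Qed.

Lemma at2_sum (I : Type) (l : seq I) (f : I -> Tens 2 V) a b :
  at2 (\sum_(i <- l) f i) a b = \sum_(i <- l) at2 (f i) a b.
Proof.
apply: (big_morph (fun t => at2 t a b) (fun t u => at2D t u a b)).
by rewrite /at2 ffunE.
Qed.

Definition bas2 a b : Tens 2 V := tens_bas (idx2 a b).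

Lemma idx2_eq a b c e : (idx2 a b == idx2 c e) = (a == c) && (b == e).
Proof.
apply/eqP/andP => [/ffunP H|[/eqP-> /eqP->]] //.
by have := H ord0; have := H ord_max; rewrite !ffunE /= => -> ->; rewrite !eqxx.
Qed.

Lemma at2_bas a b c e : at2 (bas2 a b) c e = ((c == a) && (e == b))%:R.
Proof. by rewrite /at2 ffunE idx2_eq. Qed.

Lemma pick2 (F : 'I_(rk V) -> 'I_(rk V) -> F2) a b :
  \sum_i \sum_j F i j * ((a == i) && (b == j))%:R = F a b.
Proof.
rewrite (bigD1 a) //= [X in _ + X]big1 => [|i ia].
  rewrite addr0 (bigD1 b) //= !eqxx mulr1 big1 ?addr0 // => j jb.
  by rewrite eq_sym (negPf jb) mulr0.
by apply: big1 => j _; rewrite eq_sym (negPf ia) mulr0.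
Qed.

Lemma tens2_bas t : t = \sum_i \sum_j at2 t i j *: bas2 i j.
Proof.
apply: tens2P => a b; rewrite at2_sum.
under eq_bigr do rewrite at2_sum.
under eq_bigr do under eq_bigr do rewrite at2Z at2_bas.
by rewrite pick2.
Qed.

Definition sym2 t := forall a b, at2 t a b = at2 t b a.

Lemma crd_bas a b : crd a (bas b : V) = (a == b)%:R.
Proof.
rewrite /crd /bas (tnth_nth 0) coord_free; last exact: basis_free (vbasisP _).
by rewrite eq_sym.
Qed.

Lemma at2_pure (v : 'I_2 -> V) a b : at2 (pure v) a b = crd a (v ord0) * crd b (v ord_max).
Proof.
rewrite /at2 ffunE big_ord_recl big_ord1 !ffunE /=.
by congr (_ * crd _ (v _)); apply/val_inj.
Qed.

End OneSpace.

Lemma at2_map (V W : vectType F2) (f : 'Hom(V, W)) (t : Tens 2 V) a b :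
  at2 (tens_map 2 f t) a b = \sum_i \sum_j at2 t i j * (coef f i a * coef f j b).
Proof.
rewrite /at2 lfunE ffunE pair_bigA /=.
rewrite (reindex (fun x : 'I_(rk V) * 'I_(rk V) => idx2 x.1 x.2)) /=.
  by apply: eq_bigr => -[i j] _; rewrite big_ord_recl big_ord1 !ffunE /=.
exists (fun i : {ffun 'I_2 -> 'I_(rk V)} => (i ord0, i ord_max)).
  by move=> [i j] _; rewrite !ffunE.
by move=> i _; rewrite idx2_id.
Qed.

Local Obligation Tactic := idtac.

Program Definition SymT2 : subfunctor (TensF 2) :=
  @Subfunctor vect (TensF 2) (fun V => @Submod (Tens 2 V) (@sym2 V) _ _) _.
Next Obligation. by move=> V a b; rewrite /at2 !ffunE. Qed.
Next Obligation. by move=> V c t u Ht Hu a b; rewrite !at2D !at2Z Ht Hu. Qed.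
Next Obligation.
move=> V W f t Ht a b.
apply: etrans (at2_map f t a b) (etrans _ (esym (at2_map f t b a))).
rewrite exchange_big; apply: eq_bigr => j _; apply: eq_bigr => i _.
by rewrite (Ht i j) [coef f i a * _]mulrC.
Qed.

Definition ext2_rel (V : vectType F2) (t : TensF 2 V) :=
  exists (v : 'I_2 -> V) i j, [/\ i != j, v i = v j & t = pure v].

(** Over F_2 a sum [v (x) w + w (x) v] is a combination of squares, by polarization. *)
Lemma ext2_kernel (V : vectType F2) (t : Tens 2 V) :
  gen_sub (F := TensF 2) ext2_rel V t <-> sym2 t.
Proof.
split=> [Ht|Ht].
  apply: (Ht SymT2) => W _ [v [i [j [ij vij ->]]]] a b.
  have v01 : v ord0 = v ord_max.
    move: i j ij vij; apply: ord2P; apply: ord2P => //.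
  by rewrite !at2_pure v01 mulrC.
pose N := gen_sub (F := TensF 2) ext2_rel V.
have Nsq w : N (pure (fun=> w)).
  by apply: gen_sub_in; exists (fun=> w), ord0, ord_max.
have ND u v : N u -> N v -> N (u + v).
  by move=> Nu Nv; rewrite -[u]scale1r; apply: smemP.
have NZ (c : F2) u : N u -> N (c *: u).
  by move=> Nu; rewrite -[_ *: _]addr0; apply: smemP => //; apply: smem0.
have N2 a b : N (bas2 a b + bas2 b a).
  have -> : bas2 a b + bas2 b a = pure (fun=> bas a + bas b) +
      (pure (fun=> bas a) + pure (fun=> bas b)) :> Tens 2 V.
    apply: tens2P => c e; rewrite !at2D !at2_pure !at2_bas /crd !linearD /=.
    rewrite -!/(crd _ _) !crd_bas !mulrDl !mulrDr -!natrM !mulnb.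
    move: ((c == a) && _)%:R ((c == b) && _)%:R ((c == a) && (e == a))%:R => x y z.
    move: ((c == b) && (e == b))%:R => w.
    have -> : z + x + (y + w) + (z + w) = x + y + (z + z) + (w + w) by ring.
    by rewrite !F2_addcc !addr0.
  by apply: (ND _ _ (Nsq _)); apply: ND.
have N1 a : N (bas2 a a).
  have -> : bas2 a a = pure (fun=> bas a) :> Tens 2 V; last exact: Nsq.
  by apply: tens2P => c e; rewrite at2_pure at2_bas !crd_bas -natrM mulnb.
pose G i j : Tens 2 V := at2 t i j *:
  (if (i < j)%N then bas2 i j + bas2 j i else if i == j then bas2 i j else 0).
have -> : t = \sum_i \sum_j G i j.
  apply: tens2P => a b; rewrite at2_sum.
  under eq_bigr do rewrite at2_sum.
  transitivity (\sum_i \sum_j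
      ((at2 t i j * (i <= j)%N%:R) * ((a == i) && (b == j))%:R +
       (at2 t i j * (i < j)%N%:R) * ((b == i) && (a == j))%:R)).
    under eq_bigr do rewrite big_split.
    rewrite big_split /= !pick2 -(Ht a b) -mulrDr -natrD.
    by case: ltngtP; rewrite ?mulr1.
  apply: eq_bigr => i _; apply: eq_bigr => j _; rewrite /G at2Z -!mulrA -mulrDr.
  congr (_ * _); rewrite leq_eqVlt orbC val_eqE; case: ltnP => ij /=.
    by rewrite at2D !at2_bas !mul1r [(b == i) && _]andbC.
  rewrite mul0r addr0; case: (eqVneq i j) => [<-|ne]; first by rewrite mul1r at2_bas.
  by rewrite mul0r at2_0.
apply: smem_sum => i; apply: smem_sum => j; rewrite /G; apply: NZ.
case: ifP => _ //; case: eqP => [->|_] //; exact: smem0.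
Qed.

Section Double.
Variable V : vectType F2.
Implicit Types (t u : Tens 2 V) (g : Tens 4 V) (a b c e : 'I_(rk V)).

(** The Frobenius twist, up to the relations: [v (x) w] becomes
   [v (x) w (x) v (x) w]. *)
Definition dbl t : Tens 4 V := [ffun i : {ffun 'I_4 -> 'I_(rk V)} =>
  if (i sl2 == i sl0) && (i sl3 == i sl1) then at2 t (i sl0) (i sl1) else 0].

Definition diag g : Tens 2 V := [ffun i : {ffun 'I_2 -> 'I_(rk V)} =>
  at4 g (i ord0) (i ord_max) (i ord0) (i ord_max)].

Lemma at4_dbl t a b c e :
  at4 (dbl t) a b c e = if (c == a) && (e == b) then at2 t a b else 0.
Proof. by rewrite /at4 ffunE !ffunE. Qed.

Lemma at2_diag g a b : at2 (diag g) a b = at4 g a b a b.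
Proof. by rewrite /at2 ffunE !ffunE. Qed.

Lemma dbl_linear : linear dbl.
Proof.
move=> x t u; apply: tens4P => a b c e; rewrite [RHS]at4D [in RHS]at4Z !at4_dbl.
by case: ifP => _; rewrite ?at2D ?at2Z // mulr0 addr0.
Qed.

Lemma alt22_dbl t a b c e : at4 (alt22 (dbl t)) a b c e =
  ((c == a) && (e == b))%:R * (at2 t a b + at2 t b a) +
  ((c == b) && (e == a))%:R * (at2 t a b + at2 t b a).
Proof.
rewrite at4_alt22 !at4_dbl ![(e == _) && (c == _)]andbC.
by case: ((c == a) && _); case: ((c == b) && _); rewrite ?mul1r ?mul0r ?addr0 ?add0r //; ring.
Qed.

Lemma rel64_dbl_sym t : sym2 t -> rel64 (dbl t).
Proof.
move=> Ht; apply: (@rel64_alt22 _ _ 0).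
rewrite (lin0 (@op31_linear V)) (lin0 (@alt22_linear V)).
apply: tens4P => a b c e; rewrite alt22_dbl (Ht a b) F2_addcc !mulr0 addr0.
by rewrite /at4 ffunE.
Qed.

Lemma s02_eq g : tens_perm V s02 g = g -> forall a b c e, at4 g c b a e = at4 g a b c e.
Proof. by move=> E a b c e; rewrite -{2}E at4_s02. Qed.

Lemma s13_eq g : tens_perm V s13 g = g -> forall a b c e, at4 g a e c b = at4 g a b c e.
Proof. by move=> E a b c e; rewrite -{2}E at4_s13. Qed.

(** Symmetrising a tensor in [v_1], [v_3] that is symmetric in [v_0], [v_2]
   gives a value of [Sq^1]. *)
Lemma rel64_s13 g : (forall a b c e, at4 g c b a e = at4 g a b c e) ->
  rel64 (g + tens_perm V s13 g).
Proof.
move=> H; apply: (@rel64_alt22 _ _ (tens_perm V s23 g)).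
apply: tens4P => a b c e; rewrite !at4_alt22 /op31 !at4E.
rewrite (H c b e a) (H c a e b).
rewrite -[LHS]addr0 -[X in _ + X](F2_addcc (at4 g c b e a + at4 g c a e b)).
move: (at4 g a b c e) (at4 g a e c b) (at4 g b a c e) (at4 g b e c a)
  (at4 g a b e c) (at4 g a c e b) (at4 g b a e c) (at4 g b c e a)
  (at4 g c b e a) (at4 g c a e b).
by move=> *; ring.
Qed.

Lemma rel64_s02 g : (forall a b c e, at4 g a e c b = at4 g a b c e) ->
  rel64 (g + tens_perm V s02 g).
Proof.
move=> H; apply: (@rel64_alt22 _ _ (tens_perm V s01 g)).
apply: tens4P => a b c e; rewrite !at4_alt22 /op31 !at4E.
rewrite (H b c a e) (H a c b e).
rewrite -[LHS]addr0 -[X in _ + X](F2_addcc (at4 g b c a e + at4 g a c b e)).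
move: (at4 g a b c e) (at4 g c b a e) (at4 g b e c a) (at4 g c a b e)
  (at4 g a b e c) (at4 g e b a c) (at4 g b c e a) (at4 g e a b c)
  (at4 g b c a e) (at4 g a c b e).
by move=> *; ring.
Qed.

(** A tensor invariant under both exchanges is determined, up to the
   relations, by its values on the diagonal: the orbits off the diagonal are
   values of [Sq^1]. *)
Lemma rel64_diag g : tens_perm V s02 g = g -> tens_perm V s13 g = g ->
  rel64 (g - dbl (diag g)).
Proof.
move=> /s02_eq H02 /s13_eq H13.
pose g1 : Tens 4 V := [ffun i : {ffun 'I_4 -> 'I_(rk V)} =>
  if (i sl1 < i sl3)%N then g i else 0].
pose g2 : Tens 4 V := [ffun i : {ffun 'I_4 -> 'I_(rk V)} =>
  if (i sl1 == i sl3) && (i sl0 < i sl2)%N then g i else 0].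
have g1E a b c e : at4 g1 a b c e = if (b < e)%N then at4 g a b c e else 0.
  by rewrite /at4 ffunE !ffunE.
have g2E a b c e : at4 g2 a b c e = if (b == e) && (a < c)%N then at4 g a b c e else 0.
  by rewrite /at4 ffunE !ffunE.
have -> : g - dbl (diag g) = 1 *: (g1 + tens_perm V s13 g1) + (g2 + tens_perm V s02 g2).
  rewrite lmod2_opp scale1r; apply: tens4P => a b c e.
  rewrite !at4D at4_dbl at2_diag at4_s13 at4_s02 !g1E !g2E (H02 a b c e) (H13 a b c e).
  case: (eqVneq b e) => [<-|be].
    rewrite ltnn ?eqxx andbT !add0r /=; case: (eqVneq a c) => [<-|ac].
      by rewrite ?eqxx ltnn F2_addcc addr0.
    rewrite ?[c == a]eq_sym ?(negPf ac) addr0.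
    by move: ac; rewrite -val_eqE /=; case: ltngtP => // _ _; rewrite ?addr0 ?add0r.
  rewrite ?[e == b]eq_sym ?(negPf be) andbF !addr0 /=.
  by move: be; rewrite -val_eqE /=; case: ltngtP => // _ _; rewrite ?addr0 ?add0r.
apply: rel64_P.
  by apply: rel64_s13 => a b c e; rewrite !g1E (H02 a b c e).
apply: rel64_s02 => a b c e; rewrite !g2E (H13 a b c e) eq_sym.
by [].
Qed.

Lemma dbl_s02 t : tens_perm V s02 (dbl t) = dbl t.
Proof.
apply: tens4P => a b c e; rewrite at4_s02 !at4_dbl eq_sym.
by case: eqP => [->|].
Qed.

Lemma dbl_s13 t : tens_perm V s13 (dbl t) = dbl t.
Proof.
apply: tens4P => a b c e; rewrite at4_s13 !at4_dbl [b == e]eq_sym.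
by case: (e =P b) => [->|]; rewrite ?andbF.
Qed.

End Double.

(** The diagonal coefficients of the image have the coordinates of [f] squared,
   and these are in F_2. *)
Lemma diag_map (V W : vectType F2) (f : 'Hom(V, W)) (t : Tens 2 V) :
  diag (tens_map 4 f (dbl t)) = tens_map 2 f t.
Proof.
apply: tens2P => a b; rewrite at2_diag at2_map /at4 lfunE ffunE.
rewrite pair_bigA /=.
pose h (x : 'I_(rk V) * 'I_(rk V)) : {ffun 'I_4 -> 'I_(rk V)} := idx4 x.1 x.2 x.1 x.2.
pose dg (i : {ffun 'I_4 -> 'I_(rk V)}) := (i sl2 == i sl0) && (i sl3 == i sl1).
rewrite (bigID dg) /= [X in _ + X]big1 ?addr0 => [|i /negPf ni]; last first.
  by rewrite ffunE -/(dg i) ni mul0r.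
rewrite (reindex h) /=; last first.
  exists (fun i : {ffun 'I_4 -> 'I_(rk V)} => (i sl0, i sl1)).
    by move=> [i j] _; rewrite !ffunE.
  move=> i /andP[/eqP e2 /eqP e3]; apply/ffunP => k; rewrite ffunE /=.
  by move: k; apply: quadP.
apply: eq_big => [[i j]|[i j] _]; first by rewrite /dg !ffunE /quad /= !eqxx.
rewrite ffunE -/(dg _) (_ : dg _); last by rewrite /dg !ffunE /quad /= !eqxx.
rewrite !big_ord_recl big_ord0 mulr1 !ffunE /quad /=; congr (_ * _).
by rewrite mulrA -expr2 F2_exp.
Qed.

Lemma dbl_nat (V W : vectType F2) (f : 'Hom(V, W)) (t : Tens 2 V) :
  rel64 (tens_map 4 f (dbl t) - dbl (tens_map 2 f t)).
Proof.
rewrite -diag_map; apply: rel64_diag.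
  by have := tens_perm_gamma (gamma_pow 4 f) s02 (dbl t); rewrite /= dbl_s02.
by have := tens_perm_gamma (gamma_pow 4 f) s13 (dbl t); rewrite /= dbl_s13.
Qed.

End Tens2.

(** * The connecting operation *)

Section Connect.
Local Open Scope ring_scope.

(** [Sq^1] induces a map from the classes of [frakQ^6_4] on which it lowers
   the filtration to [frakQ^7_3]: a relation [Sq^1 u + Sq^2 v] whose [Sq^1] has
   lower weight must have [v] of lower weight, since [Sq^1 Sq^2 v = Sq^3 v]. *)
Lemma connect_wd (V : vectType F2) (x : p_ 4 (Sym 6) V) :
  frakQ_class 6 4 V x = 0 -> Fil 4 (Dsq (ppol x)) -> Hit 4 7 (Dsq (ppol x)).
Proof.
move=> /frakQ_class0 [f Ff [y [Hy Fy yE]]] FD.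
pose w := \sum_(i < 4) sq 6 (y i).
have Fw : Fil 4 w.
  apply: Fil_sum => i _; apply: Fil_sq; apply: FilW (Fil_homog (Hy i)).
  exact: ltn_ord.
have Hw : w \is 6.-homog for mdeg by apply: rpred_sum => i _; apply: sq_homog.
have xE : ppol x = w + sq 6 (y 4) + Dsq (y 5) + f.
  move: yE; rewrite big_ord_recr big_ord_recr /= -/w (Dsq_sq1 (Hy 5)) => yE.
  exact: (canRL (subrK f) yE).
have Hf : f + w \is 6.-homog for mdeg.
  have -> : f + w = ppol x - sq 6 (y 4) - Dsq (y 5).
    rewrite xE; move: (sq 6 (y 4)) (Dsq (y 5)) => a b.
    by clear; move: w f a b => w f a b; ring.
  apply: rpredB; last exact: (Dsq_homog (Hy 5)).
  by apply: rpredB; [exact: ppol_homog | exact: sq_homog].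
have DxE : Dsq (ppol x) = Dsq (f + w) + sq 7 (y 4).
  rewrite xE (DsqD _ f) (DsqD _ (Dsq (y 5))) (DsqD w) (Dsq_Dsq (Hy 5)) (sq3 (Hy 4)).
  rewrite (DsqD f w); move: (Dsq w) (Dsq f) (Dsq (sq 6 (y 4))).
  by clear; move=> a b c; ring.
have Ffw : Fil 4 (f + w) by apply: FilD.
have F4 : Fil 4 (y 4).
  apply: (sq3_multilinear _ (Hy 4)) => //.
  have := FilB FD (Fil_Dsq Ffw); rewrite DxE (addrC (Dsq (f + w))) addrK; exact.
rewrite DxE; apply: HitD; first exact: Hit_Dsq.
exact: (Hit_sq _ (Hy 4) F4).
Qed.

Section Cube.
Variable V : vectType F2.
Implicit Types (t : Tens 2 V) (a b : 'I_(rk V)).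

(** The sum of the [t_ij x_i^3 x_j^3]. *)
Definition cube t : {mpoly F2[rk V]} := frob_tensor deg22 (dbl t).

Lemma cube_homog t : cube t \is 6.-homog for mdeg.
Proof. exact: frob22_homog. Qed.

Lemma cube_linear : linear cube.
Proof. by move=> c t u; rewrite /cube dbl_linear frob_tensor_linear. Qed.

Lemma Dsq_linear r : linear (@Dsq r).
Proof. by move=> c p q; rewrite DsqD DsqZ. Qed.

(** In [x_i^3 x_j^3], [Sq^1] raises an exponent from 3 to 4 and so loses a digit. *)
Lemma Fil_Dsq_cube t : Fil 4 (Dsq (cube t)).
Proof.
rewrite /cube frob_tensorE Dsq_sum; apply: Fil_sum => i _; rewrite DsqZ ffunE.
case: ifP => [/andP[/eqP e2 /eqP e3]|_]; last by rewrite scale0r; apply: Fil0.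
apply: FilZ; rewrite frob_mon22 e2 e3 DsqX; apply: Fil_sum => j _.
set m := mon22 _ _ _ _; rewrite F2_nat.
have mj : m j = (3 * ((i sl0 == j) + (i sl1 == j)))%N by rewrite mon22E -mulSn.
case: (boolP (odd (m j))) => [oj|_]; last by rewrite scale0r; apply: Fil0.
apply/FilZ/FilX; apply: (@leq_trans (wt m)).
  by apply: wt_addU3; move: oj; rewrite mj; case: (_ == j); case: (_ == j).
have Fm : Fil 5 ('X_[m] : {mpoly F2[rk V]}).
  by rewrite /m -{2}e2 -{2}e3 -frob_mon22 -frob_tensor_bas; apply: Fil_frob_tensor.
rewrite leqNgt; apply/negP => m5; have /eqP := Fm m m5.
by rewrite mcoeffX eqxx oner_eq0.
Qed.

Definition iota_pp t : p_ 3 (Sym 7) V := pp_of (Dsq_homog (cube_homog t)) (@Fil_Dsq_cube t).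

Lemma ppol_iota_pp t : ppol (iota_pp t) = Dsq (cube t).
Proof. by []. Qed.

Definition iota_fun t : frakQ 7 3 V := frakQ_class 7 3 V (iota_pp t).

Lemma iota_linear : linear iota_fun.
Proof.
move=> c t u; rewrite /iota_fun -nt_linear; congr (frakQ_class 7 3 V _).
by apply: ppol_inj; rewrite ppol_linear !ppol_iota_pp cube_linear Dsq_linear.
Qed.

(** So [Sq^1] is defined on classes, as far as it lowers the weight. *)
Lemma connect_eq (x x' : p_ 4 (Sym 6) V) (y y' : p_ 3 (Sym 7) V) :
  frakQ_class 6 4 V x = frakQ_class 6 4 V x' ->
  ppol y = Dsq (ppol x) -> ppol y' = Dsq (ppol x') ->
  frakQ_class 7 3 V y = frakQ_class 7 3 V y'.
Proof.
move=> exx' ey ey'; apply/eqP; rewrite -subr_eq0 -frakQ_classB; apply/eqP.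
have dE : ppol (y - y') = Dsq (ppol (x - x')).
  by rewrite ppolB ey ey' ppolB (linB (@Dsq_linear _)).
apply/frakQ_class0; exists 0; first exact: Fil0.
rewrite subr0 dE; apply: connect_wd; first by rewrite frakQ_classB exx' subrr.
rewrite -dE; exact: ppol_Fil.
Qed.

Lemma iota_rel t u : rel64 (dbl t - dbl u) -> iota_fun t = iota_fun u.
Proof. by move=> /rel64_pp22 e; apply: (connect_eq e). Qed.

Definition mon2 a b j k : 'X_{1..rk V} := (U_(a) *+ j + U_(b) *+ k)%MM.

(** The three monomials are those obtained by giving the exponents 1, 2, 4 to
   [x_a], [x_a], [x_b]: permuting the factors does not change the sum. *)
Definition detect a b (p : {mpoly F2[rk V]}) : F2 :=
  p@_(mon2 a b 3 4) + p@_(mon2 a b 5 2) + p@_(mon2 a b 6 1).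

Lemma detectB a b p q : detect a b (p - q) = detect a b p - detect a b q.
Proof.
rewrite /detect !mcoeffB.
move: (p@_(mon2 a b 3 4)) (p@_(mon2 a b 5 2)) (p@_(mon2 a b 6 1)) => p1 p2 p3.
by move: (q@_(mon2 a b 3 4)) (q@_(mon2 a b 5 2)) (q@_(mon2 a b 6 1)) => q1 q2 q3; ring.
Qed.

Definition sq_bin2 (j k l n : nat) := odd (sq_bin j k * sq_bin l n).

Lemma sq_bin2_table : all (fun j => all (fun l => (j + l < 7)%N ==>
  (sq_bin2 j 3 l 4 (+) sq_bin2 j 5 l 2 (+) sq_bin2 j 6 l 1 == (j == 3) && (l == 3)))
  (iota 0 7)) (iota 0 7).
Proof. by []. Qed.

Lemma sq_bin_table j l : (j + l < 7)%N ->
  sq_bin2 j 3 l 4 (+) sq_bin2 j 5 l 2 (+) sq_bin2 j 6 l 1 = (j == 3) && (l == 3).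
Proof.
move=> jl; have /allP/(_ j) := sq_bin2_table; rewrite mem_iota add0n => /(_ ltac:(lia)).
by move=> /allP/(_ l); rewrite mem_iota add0n jl => /(_ ltac:(lia)) /eqP.
Qed.

Lemma mdeg_mon2 a b j k : mdeg (mon2 a b j k) = (j + k)%N.
Proof. by rewrite mdegD !mdegMn !mdeg1 !mul1n. Qed.

Lemma mon2E a b j k i : mon2 a b j k i = ((a == i) * j + (b == i) * k)%N.
Proof. by rewrite mnmDE !mulmnE !mnm1E. Qed.

Lemma mon22_mon2 a b : mon22 a b a b = mon2 a b 3 3.
Proof. by apply/mnmP => i; rewrite mon22E mon2E; lia. Qed.

Lemma prod_sq_bin_mon2 a b j k (m : 'X_{1..rk V}) : a != b ->
  \prod_i sq_bin (m i) (mon2 a b j k i) =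
  if [forall i, (i != a) && (i != b) ==> (m i == 0)%N]
  then (sq_bin (m a) j * sq_bin (m b) k)%N else 0%N.
Proof.
move=> ab; have ea : mon2 a b j k a = j.
  by rewrite mon2E eqxx eq_sym (negPf ab) mul1n mul0n addn0.
have eb : mon2 a b j k b = k by rewrite mon2E eqxx (negPf ab) mul1n mul0n.
have eo i : i != a -> i != b -> mon2 a b j k i = 0%N.
  by move=> ia ib; rewrite mon2E ![_ == i]eq_sym (negPf ia) (negPf ib) !mul0n.
case: ifP => [/forallP H|/negbT].
  rewrite (bigD1 a) //= (bigD1 b) 1?eq_sym //= ea eb big1 => [|i /andP[ia ib]].
    by rewrite mulr1.
  by have := H i; rewrite ia ib eo // => /eqP->.
rewrite negb_forall => /existsP[i]; rewrite negb_imply => /andP[/andP[ia ib] mi].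
by rewrite (bigD1 i) //= eo // /sq_bin leqn0 (negPf mi) mul0r.
Qed.

Lemma eq_mon2 a b j k (m : 'X_{1..rk V}) : a != b ->
  (m == mon2 a b j k) =
  [forall i, (i != a) && (i != b) ==> (m i == 0)%N] && ((m a == j) && (m b == k)).
Proof.
move=> ab; apply/eqP/and3P => [->|[/forallP H /eqP ma /eqP mb]].
  split; rewrite ?mon2E ?eqxx ?[b == a]eq_sym ?(negPf ab) ?mul1n ?mul0n ?addn0 //.
  apply/forallP => i; apply/implyP => /andP[ia ib].
  by rewrite mon2E ![_ == i]eq_sym (negPf ia) (negPf ib).
apply/mnmP => i; rewrite mon2E.
case: (eqVneq i a) => [->|ia].
  by rewrite ?eqxx (eq_sym b a) (negPf ab) mul1n mul0n addn0.
case: (eqVneq i b) => [->|ib]; first by rewrite ?eqxx ?(negPf ab) mul1n mul0n.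
by have := H i; rewrite ia ib => /eqP->.
Qed.

(** The three terms cancel for all monomials of degree at most 6, except
   [x_a^3 x_b^3]. *)
Lemma detect_sq a b i (y : {mpoly F2[rk V]}) : a != b -> (i < 7)%N ->
  y \is i.-homog for mdeg -> detect a b (sq 7 y) = y@_(mon22 a b a b).
Proof.
move=> ab i7 Hy; rewrite /detect !sq_coef ?mdeg_mon2 // -!big_split /=.
transitivity ((\sum_(m <- msupp y) y@_m *: 'X_[m])@_(mon22 a b a b));
  last by rewrite -mpolyE.
rewrite raddf_sum /= big_seq [RHS]big_seq; apply: eq_bigr => m my.
rewrite mcoeffZ mcoeffX -!mulrDr -!natrD F2_nat; congr (_ * (nat_of_bool _)%:R).
rewrite mon22_mon2 eq_mon2 // !prod_sq_bin_mon2 //.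
case: ifP => //= /forallP H; rewrite !oddD; apply: sq_bin_table.
have : (mdeg m < 7)%N by rewrite (dhomog_mf Hy my).
rewrite mdegE (bigD1 a) //= (bigD1 b) 1?eq_sym //= big1 ?addn0 // => k /andP[ka kb].
by have := H k; rewrite ka kb => /eqP.
Qed.

Lemma wt_mon2 a b j k : a != b -> wt (mon2 a b j k) = (popcount j + popcount k)%N.
Proof.
move=> ab; rewrite /wt (bigD1 a) //= (bigD1 b) 1?eq_sym //= big1 => [|i /andP[ia ib]].
  by rewrite !mon2E !eqxx (eq_sym b a) (negPf ab) !mul1n !mul0n !addn0.
by rewrite mon2E ![_ == i]eq_sym (negPf ia) (negPf ib).
Qed.

Lemma detect_Fil a b p : a != b -> Fil 3 p -> detect a b p = 0.
Proof.
by move=> ab Fp; rewrite /detect !Fp ?addr0 // wt_mon2 // !popcount_small.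
Qed.

Lemma detect_Hit a b p : a != b -> Hit 4 7 p -> detect a b p = 0.
Proof.
move=> ab [y [Hy Fy ->]]; rewrite /detect !raddf_sum -!big_split /= big1 // => i _.
rewrite -/(detect a b (sq 7 (y i))) (detect_sq ab (ltn_ord i) (Hy i)).
by apply: Fy; rewrite wt_mon22.
Qed.

Lemma detect_cube a b t : a != b -> detect a b (Dsq (cube t)) = at2 t a b + at2 t b a.
Proof.
move=> ab; rewrite (Dsq_sq1 (cube_homog t)) (detect_sq ab (isT : 6 < 7)%N (cube_homog t)).
rewrite frob22_coef // alt22_dbl !eqxx (negPf ab) mul1r mul0r addr0.
by [].
Qed.

Lemma iota_eq0 t : iota_fun t = 0 <-> sym2 t.
Proof.
split=> [/frakQ_class0[x' Fx' Hx] a b|Ht].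
  case: (eqVneq a b) => [->//|ab]; apply: F2_add0; rewrite -detect_cube //.
  by rewrite -(detect_Hit ab Hx) detectB (detect_Fil ab Fx') subr0.
rewrite -(lin0 iota_linear); apply: iota_rel.
by rewrite (lin0 (@dbl_linear V)) subr0; apply: rel64_dbl_sym.
Qed.

End Cube.
End Connect.

(** * The kernel in degree 7 *)

Section Iota.
Local Open Scope ring_scope.

Lemma iota_nat (V W : vectType F2) (f : hom vect V W) (t : TensF 2 V) :
  iota_fun (fmap f t) = fmap f (iota_fun t).
Proof.
pose t' : Tens 2 V := t.
have e : frakQ_class 6 4 W (pp22 (dbl (tens_map 2 f t'))) =
    frakQ_class 6 4 W (pp22 (tens_map 4 f (dbl t'))).
  apply/rel64_pp22; have := dbl_nat f t'.
  by rewrite -[X in rel64 X -> _]lmod2_opp opprB.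
have nat : ppol (fmap f (iota_pp t')) = Dsq (ppol (pp22 (tens_map 4 f (dbl t')))).
  rewrite ppol_pp22 frob_tensor_nat.
  transitivity (symalg_map f (Dsq (cube t'))); first by [].
  rewrite (Dsq_sq1 (cube_homog t')) -sq_nat -(Dsq_sq1 (m := 6)) //.
  exact: (symalg_map_homog f (DHomog (cube_homog t'))).
rewrite [RHS](_ : _ = frakQ_class 7 3 W (fmap f (iota_pp t'))); last first.
  by rewrite nt_nat.
exact: (@connect_eq W (pp22 (dbl (tens_map 2 f t'))) (pp22 (tens_map 4 f (dbl t')))
  (iota_pp (tens_map 2 f t')) (fmap f (iota_pp t')) e (erefl _) nat).
Qed.

Definition iota0 : nat_trans (TensF 2) (frakQ 7 3) :=
  @NatTrans vect (TensF 2) (frakQ 7 3) (@iota_fun) (@iota_linear) iota_nat.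

Lemma iota0_rel V (t : TensF 2 V) :
  gen_sub (F := TensF 2) ext2_rel V t -> iota0 V t = 0.
Proof. by move=> /ext2_kernel Ht; apply/iota_eq0. Qed.

Definition iota73 : nat_trans (Ext 2) (frakQ 7 3) := quo_lift iota0_rel.

Lemma iota73_pi V (t : TensF 2 V) :
  iota73 V (quo_pi (gen_sub (F := TensF 2) ext2_rel V) t) = iota_fun t.
Proof. exact: (quo_lift_pi iota0_rel t). Qed.

Lemma iota73_inj V : injective (iota73 V).
Proof.
apply: inj_of_ker; apply: quoW => t; rewrite iota73_pi => /iota_eq0 Ht.
by apply/quo_pi0; apply/ext2_kernel.
Qed.

(** In degree 6 and weight 4 the bound [3 wt <= 2 deg] on the homology of [Sq^1] is
   an equality, so that all exponents are 0 or 3. *)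
Lemma cube_homology (V : vectType F2) (z : {mpoly F2[rk V]}) :
  z \is 6.-homog for mdeg -> Fil 5 z -> exists t : Tens 2 V,
  Fil 4 (\sum_(m <- msupp z | pivot m == None) z@_m *: 'X_[m] - cube t).
Proof.
move=> Hz Fz.
pose t : Tens 2 V := [ffun i : {ffun 'I_2 -> 'I_(rk V)} =>
  if (i ord0 < i ord_max)%N then z@_(mon22 (i ord0) (i ord_max) (i ord0) (i ord_max))
  else 0].
have tE a b : at2 t a b = if (a < b)%N then z@_(mon22 a b a b) else 0.
  by rewrite /at2 ffunE !ffunE.
exists t => m m4.
have lead : (\sum_(m <- msupp z | pivot m == None) z@_m *: 'X_[m])@_m =
    if pivot m == None then z@_m else 0.
  rewrite raddf_sum /=; under eq_bigr do rewrite mcoeffZ mcoeffX.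
  case: eqP => pm; last first.
    apply: big1 => m' /eqP pm'; case: eqP => [e|]; last by rewrite mulr0.
    by case: pm; rewrite -e.
  transitivity ((\sum_(m' <- msupp z) z@_m' *: 'X_[m'])@_m); last by rewrite -mpolyE.
  rewrite raddf_sum /= big_mkcond; apply: eq_bigr => m' _.
  rewrite mcoeffZ mcoeffX; case: eqP => // pm'.
  by case: eqP => [e|]; [case: pm'; rewrite e | rewrite mulr0].
rewrite mcoeffB lead.
case: (pselect (exists a b, a != b /\ m = mon22 a b a b)) => [[a [b [ab ->]]]|nm].
  have pm : pivot (mon22 a b a b) = None.
    rewrite /pivot; case: pickP => // i; rewrite /active mon22E.
    have : ~~ ((a == i) && (b == i)) by apply: contra ab => /andP[/eqP-> /eqP->].
    by case: (a == i); case: (b == i).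
  rewrite pm eqxx frob22_coef // alt22_dbl !eqxx (negPf ab) mul1r mul0r addr0.
  rewrite !tE (_ : mon22 b a b a = mon22 a b a b); last first.
    by apply/mnmP => i; rewrite !mon22E; lia.
  by move: ab; rewrite -val_eqE /=; case: ltngtP => // _ _; rewrite ?addr0 ?add0r subrr.
have -> : (cube t)@_m = 0.
  rewrite /cube frob_tensorE raddf_sum /= big1 // => i _.
  rewrite mcoeffZ frob_mon22 mcoeffX ffunE.
  case: ifP => [/andP[/eqP e2 /eqP e3]|_]; last by rewrite mul0r.
  case: eqP => [e|]; last by rewrite mulr0.
  case: (eqVneq (i sl0) (i sl1)) => [e01|n01].
    have w4 : (wt (mon22 (i sl0) (i sl1) (i sl2) (i sl3)) < 4)%N.
      by apply: wt_mon22_eq; rewrite e01 eqxx.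
    by move: w4; rewrite e ltnNge m4.
  by case: nm; exists (i sl0), (i sl1); rewrite -e e2 e3.
rewrite subr0; case: eqP => // pm; apply/eqP; apply: contraT => zm.
have ms : m \in msupp z by rewrite mcoeff_msupp.
have dm : mdeg m = 6 := dhomog_mf Hz ms.
have wm : wt m = 4 by have := Fil_supp Fz ms; lia.
have e03 := pivot_None_eq pm; rewrite dm wm in e03; have {}e03 := e03 isT.
(* six is 3 + 3: exactly two exponents are 3 *)
have [a [b [ab [ma mb mo]]]] : exists a b, [/\ a != b &
    [/\ m a = 3%N, m b = 3%N & forall i, i != a -> i != b -> m i = 0%N]].
  have [a ma] : exists a, m a = 3%N.
    apply: contrapT => H; suff : mdeg m = 0%N by rewrite dm.
    by rewrite mdegE big1 // => i _; have [//|mi] := e03 i; case: H; exists i.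
  have rest : (\sum_(i < rk V | i != a) m i = 3)%N.
    by move: dm; rewrite mdegE (bigD1 a) //= ma => /(@addnI 3 _ 3).
  have [b [ba mb]] : exists b, b != a /\ m b = 3%N.
    apply: contrapT => H; move: rest; rewrite big1 // => i ia.
    by have [//|mi] := e03 i; case: H; exists i.
  exists a, b; split; first by rewrite eq_sym.
  split=> // i ia ib; move: rest; rewrite (bigD1 b) //= mb => /(@addnI 3 _ 0%N).
  by rewrite (bigD1 i) ?ia //= => /eqP; rewrite addn_eq0 => /andP[/eqP].
case: nm; exists a, b; split=> //; apply/mnmP => i; rewrite mon22E.
case: (eqVneq a i) => [<-|ai]; first by rewrite eq_sym (negPf ab) ma.
case: (eqVneq b i) => [<-|bi]; first by rewrite mb.
by rewrite mo // eq_sym.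
Qed.

(** A hit form of weight 3 is hit from weight 3 up to [Sq^1 z], where only the
   homology class of the leading part of [z] matters. *)
Lemma iota73_exact V (y : frakQ 7 3 V) :
  frakQ_to_Qgr 7 3 V y = 0 <-> exists x, iota73 V x = y.
Proof.
split=> [|[x <-]]; last first.
  move: x; apply: quoW => t; rewrite iota73_pi.
  apply/frakQ_to_Qgr_class0; exists 0; first by split; [exact: rpred0 | exact: Fil0].
  rewrite subr0 ppol_iota_pp; apply: Hit_Dsq; first exact: cube_homog.
  exact: Fil_homog (cube_homog t).
have [x <-] := frakQ_class_surj y; move/frakQ_to_Qgr_class0 => [x' [Hx' Fx'] HX].
set X := ppol x - x' in HX.
have FX : Fil 4 X by apply: FilB; [exact: ppol_Fil | exact: FilW Fx'].
have H6 : Hit 6 7 X by apply: (@Hit_lower1 _ 7) => //; apply: FilW FX.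
have H5 : Hit 5 7 X by apply: (@Hit_lower2 _ 7) => //; apply: FilW FX.
have [z [Hz Fz] HXz] := Sq1_hit3 H5 FX.
have FDz : Fil 4 (Dsq z).
  by have := FilB FX (Hit_Fil HXz); rewrite opprB addrC subrK.
have [u [Hu Fu] Hzu] := Dsq_exact Hz Fz FDz.
have [t Ht] := cube_homology Hz Fz.
have Fd : Fil 4 (z - Dsq u - cube t).
  by have := FilD Hzu Ht; rewrite addrA subrK.
have Hd : z - Dsq u - cube t \is 6.-homog for mdeg.
  apply: rpredB; last exact: cube_homog.
  by apply: rpredB => //; exact: (Dsq_homog Hu).
have Dd : Dsq (z - Dsq u - cube t) = Dsq z - Dsq (cube t).
  by rewrite !(linB (@Dsq_linear _)) (Dsq_Dsq Hu) subr0.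
exists (quo_pi _ t); rewrite iota73_pi; symmetry.
apply/eqP; rewrite -subr_eq0 -frakQ_classB; apply/eqP/frakQ_class0.
exists x' => //; rewrite ppolB ppol_iota_pp.
have alg (p q q' p' : {mpoly F2[rk V]}) : p - p' - q + (q - q') = p - q' - p' by ring.
rewrite -(alg _ (Dsq z)) -Dd; exact: HitD HXz (Hit_Dsq Hd Fd).
Qed.

Lemma iota73_short_exact : short_exact iota73 (frakQ_to_Qgr 7 3).
Proof.
by split; [exact: iota73_inj | exact: iota73_exact | exact: frakQ_to_Qgr_epi].
Qed.

End Iota.

(** * The object [L_(2,2)] *)

Section Simple.
Local Open Scope ring_scope.

Local Obligation Tactic := idtac.

(** The classes of the tensors invariant under the exchanges of the slots 0, 2
   and 1, 3: the kernel of [Sq^1] on the leading parts. *)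
Program Definition B64 : subfunctor T64 :=
  @Subfunctor (gamma 4) T64 (fun V => @Submod (T64 V)
    (fun z => exists t : Tens 4 V, [/\ tens_perm V s02 t = t, tens_perm V s13 t = t
       & quo_pi (K64 V) t = z]) _ _) _.
Next Obligation.
by move=> V; exists 0; rewrite !linear0; split=> //; exact: (lin0 (@quo_pi_linear _ (K64 V))).
Qed.
Next Obligation.
move=> V c z1 z2 [t [t02 t13 <-]] [u [u02 u13 <-]]; exists (c *: t + u).
rewrite (linearP (tens_perm V s02)) (linearP (tens_perm V s13)) /= t02 t13 u02 u13.
by split=> //; exact: (@quo_pi_linear _ (K64 V)).
Qed.
Next Obligation.
move=> V W f z [t [t02 t13 <-]]; exists ((f : gamma_hom 4 V W) t).
by rewrite -!tens_perm_gamma t02 t13; split=> //; rewrite -T64_map.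
Qed.

Definition L22_fun : functor (gamma 4) := sub_functor B64.

Program Definition L22 : strict 4 := @Strict 4 L22_fun _.
Next Obligation.
move=> V W a f g x; apply/val_inj; exact: (strict_linear (s := T64) a f g (sval_of x)).
Qed.

Fact B64_dbl V (t : Tens 2 V) : B64 V (quo_pi (K64 V) (dbl t)).
Proof. by exists (dbl t); rewrite dbl_s02 dbl_s13. Qed.

Definition eta_fun V (t : Tens 2 V) : L22 V := mksub (@B64_dbl V t).

Lemma eta_linear V : linear (@eta_fun V).
Proof.
move=> c t u; apply/val_inj; rewrite /= dbl_linear.
exact: (@quo_pi_linear _ (K64 V)).
Qed.

Lemma eta_nat (V W : vectType F2) (f : hom vect V W) (t : TensF 2 V) :
  eta_fun (fmap f t : Tens 2 W) = fmap (gamma_pow 4 f) (eta_fun (t : Tens 2 V)).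
Proof.
apply/val_inj; rewrite [RHS](T64_map (gamma_pow 4 f) (dbl t)) /=.
apply/quo_piE; rewrite -[X in smem _ X]lmod2_opp opprB; exact: (dbl_nat f t).
Qed.

Definition eta0 : nat_trans (TensF 2) (forget L22) :=
  @NatTrans vect (TensF 2) (forget L22) (@eta_fun) (@eta_linear) eta_nat.

(** [Sq^1] separates the classes: [iota_fun] factors through [eta_fun]. *)
Lemma eta_eq0 V (t : Tens 2 V) : eta_fun t = 0 <-> sym2 t.
Proof.
split=> [/(congr1 (@sval_of _ _)) e|Ht].
  apply/iota_eq0; rewrite -(lin0 (@iota_linear V)); apply: iota_rel.
  by rewrite (lin0 (@dbl_linear V)) subr0; apply/(quo_pi0 (K64 V)).
by apply/val_inj; apply/(quo_pi0 (K64 V)); exact: rel64_dbl_sym.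
Qed.

Lemma eta_surj V (x : L22 V) : exists t, eta_fun t = x.
Proof.
have [t [t02 t13 tx]] := sub_ofP x; exists (diag t); apply/val_inj.
rewrite -[RHS]tx; apply/quo_piE; rewrite -[X in smem _ X]lmod2_opp opprB.
exact: rel64_diag.
Qed.

Lemma eta0_rel V (t : TensF 2 V) :
  gen_sub (F := TensF 2) ext2_rel V t -> eta0 V t = 0.
Proof. by move=> /ext2_kernel Ht; apply/eta_eq0. Qed.

Definition eta22 : nat_trans (Ext 2) (forget L22) := quo_lift eta0_rel.

Lemma eta22_pi V (t : TensF 2 V) :
  eta22 V (quo_pi (gen_sub (F := TensF 2) ext2_rel V) t) = eta_fun t.
Proof. exact: (quo_lift_pi eta0_rel t). Qed.

Lemma eta22_iso : is_iso eta22.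
Proof.
apply: inj_epi_iso => [V|V x]; last first.
  by have [t <-] := eta_surj x; exists (quo_pi _ t); rewrite eta22_pi.
apply: inj_of_ker; apply: quoW => t; rewrite eta22_pi => /eta_eq0 Ht.
by apply/quo_pi0; apply/ext2_kernel.
Qed.

(** * Simplicity and weights *)

Lemma eta_fun_bas_sum V (t : Tens 2 V) :
  eta_fun t = \sum_i \sum_j at2 t i j *: eta_fun (bas2 i j).
Proof.
have ED := linD (@eta_linear V); have E0 := lin0 (@eta_linear V).
rewrite {1}(tens2_bas t) (big_morph _ ED E0); apply: eq_bigr => i _.
rewrite (big_morph _ ED E0); apply: eq_bigr => j _.
by rewrite -[_ *: bas2 i j]addr0 eta_linear E0 addr0.
Qed.

Lemma nsym_bas2 V (i j : 'I_(rk V)) : i != j -> ~ sym2 (bas2 i j).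
Proof.
by move=> ij /(_ i j); rewrite !at2_bas !eqxx (negPf ij) andbF => /eqP; rewrite oner_eq0.
Qed.

Lemma gamma_eta V W (f : gamma_hom 4 V W) (t : Tens 2 V) :
  sval_of (fmap (f : hom (gamma 4) V W) (eta_fun t)) =
  quo_pi (K64 W) ((f : 'Hom(Tens 4 V, Tens 4 W)) (dbl t)).
Proof. exact: (T64_map f (dbl t)). Qed.

Lemma card_content V (a b l : 'I_(rk V)) :
  #|[set k | idx4 a b a b k == l]| = (2 * ((a == l) + (b == l)))%N.
Proof.
rewrite -sum1_card big_mkcond (eq_bigr (fun k => (quad a b a b k == l) : nat)).
  by rewrite sum_quad /quad /=; lia.
by move=> k _; rewrite inE ffunE; case: (_ == _).
Qed.

Lemma at4_weight_proj V (mu : 'I_(rk V) -> nat) (t : Tens 4 V) a b c e :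
  at4 ((weight_proj 4 mu : gamma_hom 4 V V) t) a b c e =
  if has_content mu (idx4 a b c e) then at4 t a b c e else 0.
Proof. by rewrite /at4 /= lfunE ffunE. Qed.

Definition restrict_content V (mu : 'I_(rk V) -> nat) (t : Tens 2 V) : Tens 2 V :=
  [ffun i : {ffun 'I_2 -> 'I_(rk V)} =>
    if has_content mu (idx4 (i ord0) (i ord_max) (i ord0) (i ord_max)) then t i else 0].

Lemma at2_restrict V (mu : 'I_(rk V) -> nat) (t : Tens 2 V) a b :
  at2 (restrict_content mu t) a b =
  if has_content mu (idx4 a b a b) then at2 t a b else 0.
Proof. by rewrite /at2 ffunE !ffunE. Qed.

Lemma weight_proj_eta V (mu : 'I_(rk V) -> nat) (t : Tens 2 V) :
  fmap (weight_proj 4 mu) (eta_fun t) = eta_fun (restrict_content mu t).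
Proof.
apply/val_inj; rewrite [LHS]gamma_eta /=; congr (quo_pi _ _).
apply: tens4P => a b c e; rewrite at4_weight_proj !at4_dbl at2_restrict.
by case: (c =P a) => [->|_]; case: (e =P b) => [->|_] //=; rewrite if_same.
Qed.

Lemma has_content_idx4 V (mu : 'I_(rk V) -> nat) a b :
  has_content mu (idx4 a b a b) = [forall l, (2 * ((a == l) + (b == l)) == mu l)%N].
Proof. by apply: eq_forallb => l; rewrite card_content. Qed.

(** A weight idempotent isolates one coordinate of [Lambda^2]. *)
Lemma eta_restrict V (i j : 'I_(rk V)) (t : Tens 2 V) : i != j ->
  at2 t i j != at2 t j i ->
  eta_fun (restrict_content (fun l => 2 * ((i == l) + (j == l)))%N t) =
  eta_fun (bas2 i j).
Proof.
move=> ij tij; apply/eqP; rewrite -subr_eq0 -(linB (@eta_linear V)); apply/eqP/eta_eq0.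
move=> a b; rewrite lmod2_opp !at2D !at2_restrict !has_content_idx4 !at2_bas.
have sw : [forall l, (2 * ((b == l) + (a == l)) == 2 * ((i == l) + (j == l)))%N] =
    [forall l, (2 * ((a == l) + (b == l)) == 2 * ((i == l) + (j == l)))%N].
  by apply: eq_forallb => l; rewrite addnC.
rewrite sw; case: ifP => [/forallP H|].
  have nij l : ~~ ((i == l) && (j == l)) by apply: contra ij => /andP[/eqP-> /eqP->].
  have [[-> ->]|[-> ->]] : (a = i /\ b = j) \/ (a = j /\ b = i).
    have ha : (i == a) || (j == a).
      have := H a; rewrite eqxx; case: (i == a); case: (j == a) => //=; case: (b == a) => //.
    have hb : (i == b) || (j == b).
      have := H b; rewrite eqxx; case: (i == b); case: (j == b) => //=; case: (a == b) => //.
    have nab : a != b.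
      apply/eqP => e; have := H a; rewrite e eqxx; have := nij b.
      by case: (i == b); case: (j == b).
    case/orP: ha => /eqP ha; case/orP: hb => /eqP hb; subst; rewrite ?eqxx in nab => //.
    - by left.
    - by right.
  - rewrite !eqxx (negPf ij) andbF addr0.
    by move: tij; case: (F2_cases (at2 t i j)) => ->; case: (F2_cases (at2 t j i)) => ->;
       rewrite ?eqxx ?addr0 ?add0r ?F2_addcc.
  - rewrite !eqxx (negPf ij) andbF addr0.
    by move: tij; case: (F2_cases (at2 t i j)) => ->; case: (F2_cases (at2 t j i)) => ->;
       rewrite ?eqxx ?addr0 ?add0r ?F2_addcc.
move=> /negbT nf; suff [-> ->] : (a == i) && (b == j) = false /\ (b == i) && (a == j) = false.
  by [].
split; apply: contraNF nf => /andP[/eqP-> /eqP->]; apply/forallP => l //.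
by rewrite addnC.
Qed.

Lemma nsym_witness V (t : Tens 2 V) : ~ sym2 t ->
  exists i j, i != j /\ at2 t i j != at2 t j i.
Proof.
move=> Ht; apply: contrapT => H; apply: Ht => i j; apply/eqP.
apply: contraT => tij; case: H; exists i, j; split=> //.
by apply: contra tij => /eqP->.
Qed.

Definition two_map_fun (V W : vectType F2) (i j : 'I_(rk V)) (w w' : W) (v : V) : W :=
  crd i v *: w + crd j v *: w'.
Fact two_map_linear V W i j w w' : linear (@two_map_fun V W i j w w').
Proof.
move=> c x y; rewrite /two_map_fun scalerDr !scalerA addrACA -!scalerDl.
by rewrite /crd !linearP.
Qed.
HB.instance Definition _ (V W : vectType F2) (i j : 'I_(rk V)) (w w' : W) :=
  GRing.isLinear.Build F2 V W *:%R (@two_map_fun V W i j w w')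
    (@two_map_linear V W i j w w').

Lemma two_map_bas2 V W (i j : 'I_(rk V)) (k l : 'I_(rk W)) : i != j ->
  tens_map 2 (linfun (two_map_fun i j (bas k) (bas l))) (bas2 i j) = bas2 k l.
Proof.
move=> ij; apply: tens2P => a b; rewrite at2_map at2_bas.
have ci : coef (linfun (two_map_fun i j (bas k) (bas l))) i a = (a == k)%:R.
  rewrite /coef lfunE /= /two_map_fun !crd_bas eqxx eq_sym (negPf ij).
  by rewrite scale1r scale0r addr0 crd_bas.
have cj : coef (linfun (two_map_fun i j (bas k) (bas l))) j b = (b == l)%:R.
  rewrite /coef lfunE /= /two_map_fun !crd_bas eqxx (negPf ij).
  by rewrite scale1r scale0r add0r crd_bas.
rewrite (bigD1 i) //= [X in _ + X]big1 => [|i' ii']; last first.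
  by apply: big1 => j' _; rewrite at2_bas (negPf ii') mul0r.
rewrite addr0 (bigD1 j) //= [X in _ + X]big1 => [|j' jj']; last first.
  by rewrite at2_bas (negPf jj') andbF mul0r.
by rewrite addr0 at2_bas !eqxx mul1r ci cj -natrM mulnb.
Qed.

(** A coordinate isolated by an idempotent is carried to all the others by linear
   maps. *)
Lemma sub_all_bas2 (A : subfunctor L22) V (x : L22 V) : A V x -> x <> 0 ->
  forall W y, A W y.
Proof.
have [t <-] := eta_surj x => At t0 W y; have [u <-] := eta_surj y.
have [|i [j [ij tij]]] := @nsym_witness V t; first by move=> /eta_eq0.
have Aij : A V (eta_fun (bas2 i j)).
  by rewrite -(eta_restrict ij tij) -weight_proj_eta; apply: sf_stable.
rewrite eta_fun_bas_sum; apply: smem_sum => k; apply: smem_sum => l.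
rewrite -[_ *: _]addr0; apply: smemP; last exact: smem0.
rewrite -(two_map_bas2 k l ij).
by have := sf_stable (gamma_pow 4 (linfun (two_map_fun i j (bas k) (bas l)))) Aij;
   rewrite -eta_nat.
Qed.

Definition plane : vectType F2 := 'rV[F2]_2.

Lemma rk_plane : rk plane = 2.
Proof. by rewrite /rk dimvf /dim /= mul1n. Qed.

Lemma eta_bas2_neq0 V (i j : 'I_(rk V)) : i != j -> eta_fun (bas2 i j) <> 0.
Proof. by move=> ij /eta_eq0; apply: nsym_bas2. Qed.

Lemma L22_simple : simple L22.
Proof.
split=> [H|A].
  pose i : 'I_(rk plane) := cast_ord (esym rk_plane) ord0.
  pose j : 'I_(rk plane) := cast_ord (esym rk_plane) ord_max.
  have ij : i != j by rewrite -val_eqE.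
  by apply: (eta_bas2_neq0 ij); apply: H.
case: (pselect (exists V (x : L22 V), A V x /\ x <> 0)) => [[V [x [Ax x0]]]|H].
  by right; apply: sub_all_bas2 Ax x0.
left=> V x Ax; apply: contrapT => x0; apply: H.
by exists V, x.
Qed.

Lemma L22_weight V (x : L22 V) (mu : 'I_(rk V) -> nat) : x != 0 ->
  fmap (weight_proj 4 mu) x = x ->
  exists i j, i != j /\ forall l, mu l = (2 * ((i == l) + (j == l)))%N.
Proof.
have [t <-] := eta_surj x => t0; rewrite weight_proj_eta => et.
have [|i [j [ij tij]]] := @nsym_witness V (restrict_content mu t).
  by move=> /eta_eq0 e; move: t0; rewrite -et e eqxx.
exists i, j; split=> // l; move: tij; rewrite !at2_restrict !has_content_idx4.
have -> : [forall l, (2 * ((j == l) + (i == l)) == mu l)%N] =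
    [forall l, (2 * ((i == l) + (j == l)) == mu l)%N].
  by apply: eq_forallb => l'; rewrite addnC.
by case: ifP => [/forallP/(_ l)/eqP|_] //; rewrite eqxx.
Qed.

Lemma L22_highest_weight : highest_weight L22 [:: 2; 2].
Proof.
split=> [V V2|V mu [x x0 ex] m].
  pose i : 'I_(rk V) := Ordinal (ltnW V2 : (0 < rk V)%N).
  pose j : 'I_(rk V) := Ordinal (V2 : (1 < rk V)%N).
  have ij : i != j by rewrite -val_eqE.
  exists (eta_fun (bas2 i j)); first exact/eqP/eta_bas2_neq0.
  rewrite weight_proj_eta; congr eta_fun; apply: tens2P => a b.
  rewrite at2_restrict at2_bas; case: ifP => // /negbT nf.
  case: andP => // -[/eqP ai /eqP bj]; case/negP: nf.
  rewrite has_content_idx4; apply/forallP => l; rewrite ai bj -!val_eqE /=.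
  by case: (val l) => [|[|[|k]]].
have [i [j [ij muE]]] := L22_weight x0 ex.
have one (k : 'I_(rk V)) : (\sum_(l < rk V | l < m) (k == l) = (k < m))%N.
  rewrite big_mkcond (bigD1 k) //= eqxx big1 ?addn0 => [|l lk]; first by case: ltnP.
  by rewrite eq_sym (negPf lk) if_same.
rewrite (eq_bigr (fun l => (i == l) + (j == l) + ((i == l) + (j == l)))%N); last first.
  by move=> l _; rewrite muE mul2n addnn.
rewrite !big_split /= !one.
have nij : (i : nat) <> j by move=> e; case/eqP: ij; apply/val_inj.
case: m one => [|[|m]] _; first by rewrite big_ord0.
  rewrite big_ord_recl big_ord0 /=.
  by have := nij; case: (nat_of_ord i) => [|n]; case: (nat_of_ord j) => [|n'].
rewrite !big_ord_recl /=.
by case: (_ < _)%N; case: (_ < _)%N.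
Qed.

End Simple.

Section Assembly.
Local Open Scope ring_scope.

Definition L22_of_B64 : nat_trans (sub_functor B64) L22 :=
  @NatTrans (gamma 4) (sub_functor B64) L22 (fun V x => x)
    (fun V c x y => erefl) (fun V W f x => erefl).

Lemma connect_eta V (t : Tens 2 V) :
  (exists2 x : p_ 4 (Sym 6) V,
     frakQ_class 6 4 V x = theta64 V (sval_of (eta_fun t)) &
     sq_connects x (iota_fun t)) /\
  (forall (x : p_ 4 (Sym 6) V) (z : frakQ 7 3 V),
     frakQ_class 6 4 V x = theta64 V (sval_of (eta_fun t)) ->
     sq_connects x z -> z = iota_fun t).
Proof.
have th : theta64 V (sval_of (eta_fun t)) = frakQ_class 6 4 V (pp22 (dbl t)).
  exact: theta64_pi.
split=> [|x z ex [y ey ->]].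
  exists (pp22 (dbl t)) => //; exists (iota_pp t) => //.
  by apply: pol_inj; rewrite pol_Sq; exact: (Dsq_sq1 (cube_homog t)).
rewrite th in ex; apply: (@connect_eq V x (pp22 (dbl t)) y (iota_pp t) ex) => //.
by rewrite /ppol ey pol_Sq (Dsq_sq1 (pol_homog _)).
Qed.

End Assembly.

Theorem corollary6p17 :
  (forall n d : nat, n <= 8 -> (n, d) <> (7, 3) -> is_iso (frakQ_to_Qgr n d)) /\
  exists (iota : nat_trans (Ext 2) (frakQ 7 3))
         (L : strict 4) (eps : nat_trans (forget L) (Ext 2))
         (T : strict 4) (theta : nat_trans (forget T) (frakQ 6 4))
         (B : subfunctor T) (pi : nat_trans (sub_functor B) L),
    [/\ short_exact iota (frakQ_to_Qgr 7 3),
        simple L /\ highest_weight L [:: 2; 2],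
        is_iso eps,
        strict_frakQ theta /\ is_epi pi
      & forall (V : vectType F2) (b : sub_functor B V),
          (exists2 x : p_ 4 (Sym 6) V,
             frakQ_class 6 4 V x = theta V (sval_of b)
             & sq_connects x (iota V (eps V (pi V b)))) /\
          (forall (x : p_ 4 (Sym 6) V) (z : frakQ 7 3 V),
             frakQ_class 6 4 V x = theta V (sval_of b) ->
             sq_connects x z -> z = iota V (eps V (pi V b)))].
Proof.
split; first exact: iso_part.
have [eps [etaK epsK]] := eta22_iso.
exists iota73, L22, eps, T64, theta64, B64, L22_of_B64; split.
- exact: iota73_short_exact.
- split; [exact: L22_simple | exact: L22_highest_weight].
- by exists eta22; split.
- by split; [exact: theta64_strict | move=> V y; exists y].
move=> V b.
pose N := gen_sub (F := TensF 2) ext2_rel V.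
have [t et] : exists t : Tens 2 V, quo_pi N t = eps V b.
  by exists (generic_quotient.repr (eps V b : quo N)); apply: quo_piK.
have bE : eta_fun t = b by rewrite -eta22_pi et; apply: epsK.
have := connect_eta t; rewrite -(iota73_pi t) et bE; exact.
Qed.
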